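(* Let $N\ge1$, fix a starting point $x\in C_N^B$ and $k_2>0$, and for $k_1>0$ let $(X_{t,(k_1,k_2)})_{t\ge0}$ be the Bessel process of type $B_N$ with multiplicities $(k_1,k_2)$ started in $x$. Let $\mathbf 1:=(1,\dots,1)\in\mathbb R^N$. Then for every $t>0$, $$X_{t,(k_1,k_2)}-\sqrt{2tk_1}\,\mathbf 1$$ converges in distribution as $k_1\to\infty$ to $X^A_{t/2,k_2}$, where $(X^A_{s,k_2})_{s\ge0}$ is the Bessel process of type $A_{N-1}$ with multiplicity $k_2$ started in the origin.
   Context: $C_N^B:=\{x\in\mathbb R^N: x_1\ge\dots\ge x_N\ge0\}$, $C_N^A:=\{x\in\mathbb R^N:x_1\ge\dots\ge x_N\}$. The Bessel process of type $B_N$ with multiplicities $(k_1,k_2)$ is the diffusion on $C_N^B$ with reflecting boundary and generator $Lf=\frac12\Delta f+k_2\sum_{i}\sum_{j\ne i}\big(\frac{1}{x_i-x_j}+\frac{1}{x_i+x_j}\big)\partial_i f+k_1\sum_i\frac{1}{x_i}\partial_i f$ (domain: restrictions of $C^2$ functions invariant under permutations and sign changes of coordinates). The Bessel process of type $A_{N-1}$ with multiplicity $k$ is the diffusion on $C_N^A$ with reflecting boundary and generator $Lf=\frac12\Delta f+k\sum_i\sum_{j\ne i}\frac{1}{x_i-x_j}\partial_i f$ (domain: restrictions of permutation-invariant $C^2$ functions); started in $0$, $X^A_{s,k}$ has density on $C_N^A$ proportional to $e^{-\|y\|^2/(2s)}\prod_{i<j}(y_i-y_j)^{2k}$. *)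

(* Defs.v *)
From HB Require Import structures.
From mathcomp Require Import all_boot all_order all_algebra all_fingroup.
From mathcomp Require Import all_classical all_reals all_analysis.
Set Implicit Arguments. Unset Strict Implicit. Unset Printing Implicit Defensive.
Import Order.TTheory GRing.Theory Num.Theory.
Import numFieldNormedType.Exports.
Local Open Scope classical_set_scope.
Local Open Scope ring_scope.

(* generated by the coordinate maps (= product Borel = Borel of R^N),
   exactly as the library does for n.-tuple T. *)
Definition rV_display : measure_display -> measure_display.
Proof. exact. Qed.

Section measurable_rV.
Context {d} {T : sigmaRingType d}.
Variable n : nat.
Let coors : 'I_n -> 'rV[T]_n -> T := fun i x => x ord0 i.
Let rV_set0 : g_sigma_preimage coors set0.
Proof. exact: sigma_algebra0. Qed.
Let rV_setC A : g_sigma_preimage coors A -> g_sigma_preimage coors (~` A).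
Proof. exact: sigma_algebraC. Qed.
Let rV_bigcup (F : _^nat) : (forall i, g_sigma_preimage coors (F i)) ->
  g_sigma_preimage coors (\bigcup_i (F i)).
Proof. exact: sigma_algebra_bigcup. Qed.
HB.instance Definition _ := Pointed.on 'rV[T]_n.
HB.instance Definition _ := @isMeasurable.Build (rV_display d)
  ('rV[T]_n) (g_sigma_preimage coors) rV_set0 rV_setC rV_bigcup.
End measurable_rV.

Section Bessel.
Variables (R : realType) (N : nat).
Local Notation V := 'rV[R]_N.

Definition chamberB : set V :=
  [set x | forall i j : 'I_N, (i <= j)%N -> x ord0 j <= x ord0 i /\ 0 <= x ord0 j].
Definition chamberA : set V :=
  [set x | forall i j : 'I_N, (i <= j)%N -> x ord0 j <= x ord0 i].

Definition evec (i : 'I_N) : V := delta_mx ord0 i.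
Definition partial (i : 'I_N) (f : V -> R) : V -> R := fun y => 'D_(evec i) f y.

Definition C2 (f : V -> R) : Prop :=
  continuous f /\
  forall i j : 'I_N,
    (forall y, derivable f y (evec i)) /\
    continuous (partial i f) /\
    (forall y, derivable (partial i f) y (evec j)) /\
    continuous (partial j (partial i f)).

Definition compact_support (f : V -> R) : Prop :=
  exists M : R, forall y : V, M < `|y| -> f y = 0.

Definition perm_invariant (f : V -> R) : Prop :=
  forall (s : 'S_N) (y : V), f (\row_i y ord0 (s i)) = f y.

Definition sign_invariant (f : V -> R) : Prop :=
  forall (b : 'I_N -> bool) (y : V), f (\row_i ((-1) ^+ b i * y ord0 i)) = f y.

Definition domB (f : V -> R) : Prop :=
  C2 f /\ compact_support f /\ perm_invariant f /\ sign_invariant f.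
Definition domA (f : V -> R) : Prop :=
  C2 f /\ compact_support f /\ perm_invariant f.

Definition laplacian (f : V -> R) : V -> R :=
  fun y => \sum_(i < N) partial i (partial i f) y.

Definition genB (k1 k2 : R) (f : V -> R) : V -> R := fun y =>
  2^-1 * laplacian f y
  + k2 * \sum_(i < N) \sum_(j < N | j != i)
        ((y ord0 i - y ord0 j)^-1 + (y ord0 i + y ord0 j)^-1) * partial i f y
  + k1 * \sum_(i < N) (y ord0 i)^-1 * partial i f y.

Definition genA (k : R) (f : V -> R) : V -> R := fun y =>
  2^-1 * laplacian f y
  + k * \sum_(i < N) \sum_(j < N | j != i) (y ord0 i - y ord0 j)^-1 * partial i f y.

(* (mu t)_{t >= 0} is the family of one-dimensional marginal laws of the
   diffusion on the closed chamber S with generator L (on the domain Dom),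
   started in x: each mu t lives on S and Dynkin's formula holds
     E f(X_t) = f(x) + \int_0^t E (Lf)(X_s) ds   for all f in Dom.          *)
Definition diffusion_marginals (S : set V) (L : (V -> R) -> V -> R)
    (Dom : (V -> R) -> Prop) (x : V)
    (mu : R -> probability V R) : Prop :=
  (forall t, 0 <= t -> mu t (~` S) = 0%E) /\
  forall f, Dom f -> forall t, 0 <= t ->
    Rintegral (mu t) setT f =
      f x + Rintegral lebesgue_measure `[0, t] (fun s => Rintegral (mu s) setT (L f)).

Definition BesselB_marginals (k1 k2 : R) (x : V) (mu : R -> probability V R) :=
  diffusion_marginals chamberB (genB k1 k2) domB x mu.

Definition BesselA_marginals (k : R) (x : V) (mu : R -> probability V R) :=
  diffusion_marginals chamberA (genA k) domA x mu.

End Bessel.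

(* Main.v *)
Require Import Defs.
From HB Require Import structures.
From mathcomp Require Import all_boot all_order all_algebra all_fingroup.
From mathcomp Require Import all_classical all_reals all_analysis.
From mathcomp Require Import ring lra measurable_realfun.
Set Implicit Arguments. Unset Strict Implicit. Unset Printing Implicit Defensive.
Import Order.TTheory GRing.Theory Num.Theory.
Import numFieldNormedType.Exports.
Local Open Scope classical_set_scope.
Local Open Scope ring_scope.

(* Put [c = 2 sqrt(2 t k1)] and [b = 2 k1 s]. In the variables [w_i = (y_i^2 - b) / c] at time
   [s], the type B dynamics applied to a product of power sums of [w] is [s / t] times the
   type A operator plus a term of order [1 / c]: the part of the generator of order [k1 / c]
   is exactly cancelled by the motion of the centre [b]. Hence the moments of the symmetric
   functions of [w] at time [t], which are polynomials in [s], converge to those of the type A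
   process at time [t / 2], by induction on the degree. The type A moments of degree [2 m]
   grow like [B^m m!], so that expectations of symmetric polynomials of [sin (xi w_i)] converge
   too (Taylor expansion of the sine), and these approximate any bounded continuous function
   on the chamber. Finally [w_i] and [y_i - sqrt(2 t k1)] differ by [O(w_i^2 / sqrt(t k1))].

   Only compactly supported test functions are available at the start. The generator, whose
   coefficients are singular on the walls, is controlled there because the first derivatives
   of an invariant function differ by at most its Hessian times the distance to the wall, and
   the process is shown to spend no time on the walls. *)

(** The coordinates are squared for two reasons. A power sum of [(y_i^2 - b) / c] is invariant under
    sign changes, hence an admissible test function after a cutoff; and [1/(y_i - y_j) + 1/(y_i +
    y_j) = 2 y_i / (y_i^2 - y_j^2)] merges the two singular kernels of type B into a single kernel
    of type A. Put [s0 = sqrt(2 t k1)]. At time [t] one has [b = s0^2], and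
    [y^2 - s0^2 = (y - s0)(y + s0)] with [y + s0] close to [2 s0], which explains the choice of [c].
    The speed [4 b / c^2 = s / t] integrates over [[0, t]] to [t / 2], the time at which the limit
    is taken. The hypotheses provide only one-dimensional laws and Dynkin's formula, so even the
    measurability of [s -> E (L f)(X_s)] has to be derived. Sines make the test functions bounded,
    and their Taylor remainder is itself bounded by a symmetric polynomial; convergence of moments
    transfers this bound to the type B laws, so that the growth estimate is invoked for the limit
    law alone. *)

(** * Symmetric polynomials as combinations of products of power sums *)

Section PowerSums.
Variables (R : realType) (N : nat).
Local Notation V := 'rV[R]_N.

Definition psum (m : nat) (y : V) : R := \sum_(i < N) y ord0 i ^+ m.

Definition pprod (s : seq nat) (y : V) : R := \prod_(m <- s) psum m y.

(** Kept as a list of coefficients and exponent lists, because expectations and generators are later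
    evaluated term by term. [Q] restricts the exponent lists: in use it is a bound on the weight
    [sumn], or no restriction at all. *)
Definition sympoly (Q : seq nat -> bool) (F : V -> R) : Prop :=
  exists P : seq (R * seq nat), all (fun c => Q c.2) P /\
    forall y, F y = \sum_(c <- P) c.1 * pprod c.2 y.

Lemma pprod_cons m s y : pprod (m :: s) y = psum m y * pprod s y.
Proof. by rewrite /pprod big_cons. Qed.

Lemma pprod_nil y : pprod [::] y = 1.
Proof. by rewrite /pprod big_nil. Qed.

Lemma pprod_cat s s' y : pprod (s ++ s') y = pprod s y * pprod s' y.
Proof. by rewrite /pprod big_cat. Qed.

Lemma sympoly_ext Q F G : F =1 G -> sympoly Q F -> sympoly Q G.
Proof. by move=> FG [P [QP FP]]; exists P; split=> // y; rewrite -FG. Qed.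

Lemma sympoly_sub (Q Q' : seq nat -> bool) F :
  (forall s, Q s -> Q' s) -> sympoly Q F -> sympoly Q' F.
Proof.
move=> QQ' [P [QP FP]]; exists P; split=> //.
by apply/allP => c /(allP QP); exact: QQ'.
Qed.

Lemma sympoly_pprod (Q : seq nat -> bool) s : Q s -> sympoly Q (pprod s).
Proof.
by move=> Qs; exists [:: (1, s)]; split=> [|y]; rewrite ?big_seq1 ?mul1r //= Qs.
Qed.

Lemma sympoly0 Q : sympoly Q (fun=> 0).
Proof. by exists [::]; split=> // y; rewrite big_nil. Qed.

Lemma sympolyD Q F G : sympoly Q F -> sympoly Q G -> sympoly Q (fun y => F y + G y).
Proof.
move=> [P [QP FP]] [P' [QP' GP']]; exists (P ++ P'); split=> [|y].
  by rewrite all_cat QP.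
by rewrite FP GP' big_cat.
Qed.

Lemma sympolyZ Q a F : sympoly Q F -> sympoly Q (fun y => a * F y).
Proof.
move=> [P [QP FP]]; exists [seq (a * c.1, c.2) | c <- P]; split=> [|y].
  by rewrite all_map; apply: sub_all QP.
by rewrite FP big_map mulr_sumr; apply: eq_bigr => c _; rewrite mulrA.
Qed.

Lemma sympoly_sum Q I (r : seq I) (C : pred I) (F : I -> V -> R) :
  (forall i, C i -> sympoly Q (F i)) -> sympoly Q (fun y => \sum_(i <- r | C i) F i y).
Proof.
move=> QF; elim: r => [|i r IH].
  by apply: sympoly_ext (sympoly0 Q) => y; rewrite big_nil.
have [Ci|nCi] := boolP (C i).
  by apply: sympoly_ext (sympolyD (QF _ Ci) IH) => y; rewrite big_cons Ci.
by apply: sympoly_ext IH => y; rewrite big_cons (negbTE nCi).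
Qed.

Lemma sympolyM (Q Q1 Q2 : seq nat -> bool) F G :
  (forall s t, Q1 s -> Q2 t -> Q (s ++ t)) ->
  sympoly Q1 F -> sympoly Q2 G -> sympoly Q (fun y => F y * G y).
Proof.
move=> QQ [P [QP FP]] [P' [QP' GP']].
exists [seq (c.1 * c'.1, c.2 ++ c'.2) | c <- P, c' <- P']; split=> [|y].
  apply/allP => c /allpairsP[[c1 c2] /= [c1P c2P ->]] /=.
  by apply: QQ; [exact: (allP QP)|exact: (allP QP')].
rewrite FP GP' big_allpairs_dep mulr_suml; apply: eq_bigr => c _.
rewrite mulr_sumr; apply: eq_bigr => c' _ /=.
by rewrite pprod_cat mulrACA.
Qed.

Lemma sympoly_cst (Q : seq nat -> bool) a : Q [::] -> sympoly Q (fun=> a).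
Proof.
move=> Q0; apply: sympoly_ext (sympolyZ a (sympoly_pprod Q0)) => y.
by rewrite pprod_nil mulr1.
Qed.

Lemma sympoly_psum_horner (q : {poly R}) :
  sympoly xpredT (fun y => \sum_(i < N) q.[y ord0 i]).
Proof.
apply: (@sympoly_ext _ (fun y => \sum_(m < size q) q`_m * pprod [:: m : nat] y)).
  move=> y; under [RHS]eq_bigr do rewrite horner_coef.
  rewrite exchange_big /=; apply: eq_bigr => m _.
  by rewrite pprod_cons pprod_nil mulr1 /psum mulr_sumr.
by apply: sympoly_sum => m _; apply: sympolyZ; apply: sympoly_pprod.
Qed.

(** The permanent of the matrix with entries [phi i] at [y_j], that is, the unnormalised
    symmetrization of a product of one-variable polynomials. *)
Definition permprod (phi : 'I_N -> {poly R}) (y : V) : R :=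
  \sum_(s : 'S_N) \prod_(i < N) (phi i).[y ord0 (s i)].

(** Induction on the number of slots that carry a nontrivial factor. Empty slot [a] and multiply the
    remaining permanent by the sum of [phi a] over all coordinates: the factor [phi a] then falls on
    each slot [l] in turn. On an empty slot this restores [permprod phi]; on an occupied one two
    factors merge and fewer slots are occupied. The number of empty slots is nonzero and can be
    divided out. *)
Lemma sympoly_permprod phi : sympoly xpredT (permprod phi).
Proof.
suff H r : forall (U : {set 'I_N}) (phi : 'I_N -> {poly R}), #|U| = r -> (forall i, i \notin U -> phi i = 1) ->
    sympoly xpredT (permprod phi).
  by apply: (H #|[set: 'I_N]%SET| [set: 'I_N]%SET phi erefl) => i; rewrite inE.
elim: r => [|r IH] U {}phi.
  move=> /eqP; rewrite cards_eq0 => /eqP -> phi1.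
  apply: (@sympoly_ext _ (fun=> \sum_(s : 'S_N) 1)); last exact: sympoly_cst.
  move=> y; apply: eq_bigr => s _; rewrite big1// => i _.
  by rewrite phi1 ?inE// hornerC.
move=> cU phi1; have /card_gt0P[a aU] : (0 < #|U|)%N by rewrite cU.
pose U' := (U :\ a)%SET; have cU' : #|U'| = r.
  by apply/eqP; rewrite -eqSS -cU (cardsD1 a U) aU.
pose phi' i : {poly R} := if i == a then 1 else phi i.
pose psi l i : {poly R} := if i == l then phi a * phi' i else phi' i.
have step (y : V) : (\sum_(i < N) (phi a).[y ord0 i]) * permprod phi' y =
    \sum_l permprod (psi l) y.
  rewrite mulr_sumr exchange_big/=; apply: eq_bigr => s _.
  rewrite mulr_suml (reindex_inj (@perm_inj _ s))/=; apply: eq_bigr => l _.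
  rewrite (bigD1 l)//= [RHS](bigD1 l)//= /psi eqxx hornerM mulrA; congr (_ * _).
  by apply: eq_bigr => i /negbTE ->.
(* Moving [phi a] from slot [a] to an empty slot [l] is a transposition, which the sum over
   permutations absorbs. *)
have same (y : V) l : l \notin U' -> permprod (psi l) y = permprod phi y.
  move=> lU'.
  rewrite /permprod [RHS](reindex_inj (mulgI (tperm a l)))/=; apply: eq_bigr => s _.
  rewrite [RHS](reindex_inj (@perm_inj _ (tperm a l)))/=; apply: eq_bigr => i _.
  rewrite permM tpermK; congr (_.[_]); rewrite /psi /phi'.
  have [->{l lU'}|la] := eqVneq l a; first by rewrite tperm1 perm1; case: eqVneq => [->|//]; rewrite mulr1.
  have lU : l \notin U by move: lU'; rewrite !inE la.
  case: tpermP => [->|->|/eqP ia /eqP il]; rewrite ?eqxx ?(negbTE ia) ?(negbTE il)//.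
    by rewrite eq_sym (negbTE la) phi1.
  by rewrite (negbTE la) (phi1 l)// mulr1.
have nz : (#|~: U'|%:R : R) != 0.
  rewrite pnatr_eq0 -lt0n; apply/card_gt0P; exists a.
  by rewrite !inE eqxx.
have key : sympoly xpredT (fun y => #|~: U'|%:R^-1 *
   ((\sum_(i < N) (phi a).[y ord0 i]) * permprod phi' y +
    (-1) * \sum_(l in U') permprod (psi l) y)).
  apply/sympolyZ/sympolyD.
    apply: (@sympolyM _ xpredT xpredT) => //; first exact: sympoly_psum_horner.
    apply: (IH U') => // i; rewrite !inE negb_and negbK /phi'.
    by case: eqVneq => //= _; exact: phi1.
  apply/sympolyZ/sympoly_sum => l lU'; apply: (IH U') => // i iU'.
  have il : i != l by apply: contraNneq iU' => ->.
  rewrite /psi (negbTE il) /phi'; case: eqVneq => // ia; apply: phi1.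
  by move: iU'; rewrite !inE ia.
apply: sympoly_ext key => y; rewrite step (bigID [in U'])/=.
rewrite mulN1r addrAC subrr add0r.
rewrite (eq_bigr (fun=> permprod phi y)); last by move=> l; exact: same.
rewrite (eq_bigl [in ~: U']); last by move=> l /=; rewrite finset.in_setC.
rewrite sumr_const -[permprod phi y *+ _]mulr_natl.
by rewrite mulrA mulVf ?mul1r.
Qed.

End PowerSums.

(** * Sorted vectors *)

Section Sorting.
Variables (R : realType) (N : nat).
Local Notation V := 'rV[R]_N.

(** Pigeonhole. Suppose [v_i <= u_i] and every [|u_l - v_(s l)|] is smaller than [u_i - v_i]:
    monotonicity then forces [s] to map the indices [<= i] into the indices [< i]. In other words,
    matching two vectors in sorted order minimizes the largest distance. *)
Lemma chamberA_rearrange (u v : V) (s : 'S_N) i : chamberA u -> chamberA v ->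
  exists l, `|u ord0 i - v ord0 i| <= `|u ord0 l - v ord0 (s l)|.
Proof.
suff H (u' v' : V) (s' : 'S_N) : chamberA u' -> chamberA v' -> v' ord0 i <= u' ord0 i ->
    exists l, `|u' ord0 i - v' ord0 i| <= `|u' ord0 l - v' ord0 (s' l)|.
  move=> cu cv; have [vu|/ltW uv] := leP (v ord0 i) (u ord0 i); first exact: H.
  have [l hl] := H _ _ s^-1%g cv cu uv; exists (s^-1%g l).
  by rewrite permKV distrC [leRHS]distrC.
move=> cu cv vu; apply/not_existsP => hl.
have sl (l : 'I_N) : (l <= i)%N -> (s' l < i)%N.
  move=> li; rewrite ltnNge; apply/negP => isl.
  have := hl l; rewrite (ger0_norm (_ : 0 <= u' ord0 i - _)) ?subr_ge0//.
  have h1 := cu _ _ li; have h2 := cv _ _ isl.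
  by move=> h; apply: h; rewrite ler_normr; apply/orP; left; lra.
pose A := [set l : 'I_N | (l <= i)%N]%SET; pose B := [set l : 'I_N | (l < i)%N]%SET.
have : #|[set s' l | l in A]%SET| = #|A| by rewrite card_imset//; exact: perm_inj.
have /subset_leq_card sAB : [set s' l | l in A]%SET \subset B.
  by apply/fintype.subsetP => z /imsetP[l lA ->]; move: lA; rewrite !finset.inE; exact: sl.
move=> e; move: sAB; rewrite e leqNgt => /negP; apply.
apply: proper_card; apply/properP; split.
  by apply/fintype.subsetP => l; rewrite !finset.inE => /ltnW.
by exists i; rewrite !finset.inE ?leqnn ?ltnn.
Qed.

Lemma chamberA_sort (w : V) : exists s : 'S_N, chamberA (\row_i w ord0 (s i)).
Proof.
pose t := [tuple w ord0 i | i < N].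
have /tuple_permP[s hs] : perm_eq (sort_tuple >=%R t) t by rewrite perm_sort.
exists s => i j ij; rewrite !mxE.
have nthE (k : 'I_N) : w ord0 (s k) = nth 0 (sort >=%R t) k.
  have -> : sort >=%R t = [tuple tnth t (s i) | i < N] by [].
  by rewrite -tnth_nth !tnth_mktuple.
rewrite !nthE; apply: (@sorted_leq_nth _ >=%R) => //.
- by move=> x y z yx xz; exact: le_trans xz yx.
- by move=> x; exact: lexx.
- by apply: sort_sorted => x y; exact: le_total.
- by rewrite inE size_sort size_tuple.
- by rewrite inE size_sort size_tuple.
Qed.

End Sorting.

(** * Bernstein polynomials *)

Section Bernstein.
Variables (R : realType).

Definition bernw (n j : nat) (u : R) : R := 'C(n, j)%:R * (u ^+ j * (1 - u) ^+ (n - j)).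

(** For [u] in [[0, 1]] this is the expectation of [f] under the binomial law of [n] trials with
    success probability [u]. *)
Definition bernE (n : nat) (f : nat -> R) (u : R) : R :=
  \sum_(j < n.+1) f j * bernw n j u.

(** Condition on the outcome of one trial. The mean and the variance follow by induction from this
    recursion. *)
Lemma bernES n f u :
  bernE n.+1 f u = u * bernE n (f \o succn) u + (1 - u) * bernE n f u.
Proof.
rewrite /bernE big_ord_recl [X in (1 - u) * X]big_ord_recl/=.
rewrite /bernw !bin0 !subn0 !expr0 !mul1r.
under eq_bigr => j _.
  rewrite /bump /= add1n binS natrD subSS.
  over.
transitivity (f 0%N * (1 - u) ^+ n.+1 +
   \sum_(j < n.+1) f j.+1 * ('C(n, j.+1)%:R * (u ^+ j.+1 * (1 - u) ^+ (n - j))) +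
   \sum_(j < n.+1) f j.+1 * ('C(n, j)%:R * (u ^+ j.+1 * (1 - u) ^+ (n - j)))).
  rewrite -addrA -big_split/=; congr (_ + _); apply: eq_bigr => j _.
  by rewrite mulrDl mulrDr.
rewrite addrC; congr (_ + _).
  by rewrite mulr_sumr; apply: eq_bigr => j _; rewrite exprS /=; ring.
rewrite mulrDr; congr (_ + _); first by rewrite exprS; ring.
rewrite big_ord_recr/= bin_small// mul0r mulr0 addr0 mulr_sumr.
apply: eq_bigr => j _; rewrite /bump /= add1n.
by rewrite -(subnSK (ltn_ord j)) [(1 - u) ^+ _.+1]exprS; ring.
Qed.

Lemma bernED n f g u : bernE n (fun j => f j + g j) u = bernE n f u + bernE n g u.
Proof. by rewrite /bernE -big_split; apply: eq_bigr => j _; rewrite mulrDl. Qed.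

Lemma bernEZ n a f u : bernE n (fun j => a * f j) u = a * bernE n f u.
Proof. by rewrite /bernE mulr_sumr; apply: eq_bigr => j _; rewrite mulrA. Qed.

Lemma eq_bernE n f g u : f =1 g -> bernE n f u = bernE n g u.
Proof. by move=> fg; apply: eq_bigr => j _; rewrite fg. Qed.

Lemma bernE0 f u : bernE 0 f u = f 0%N.
Proof. by rewrite /bernE big_ord1 /bernw bin0 expr0 subn0 expr0 !mulr1. Qed.

Lemma bernE_cst n u : bernE n (fun=> 1) u = 1.
Proof. by elim: n => [|n IH]; rewrite ?bernE0// bernES /comp IH; ring. Qed.

Lemma bernE_id n u : bernE n (fun j => j%:R) u = n%:R * u.
Proof.
elim: n => [|n IH]; first by rewrite bernE0 mul0r.
rewrite bernES IH (@eq_bernE _ _ (fun j => j%:R + 1)); last by move=> j; rewrite /= -natr1.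
by rewrite bernED IH bernE_cst -natr1; ring.
Qed.

Lemma bernE_sqr n u : bernE n (fun j => j%:R ^+ 2) u = n%:R * u * (1 - u) + (n%:R * u) ^+ 2.
Proof.
elim: n => [|n IH]; first by rewrite bernE0 !mul0r; ring.
rewrite bernES IH (@eq_bernE _ _ (fun j => j%:R ^+ 2 + (2 * j%:R + 1))).
  by rewrite !bernED bernEZ IH bernE_id bernE_cst -natr1; ring.
by move=> j; rewrite /= -natr1; ring.
Qed.

Lemma bernE_var n u : (0 < n)%N ->
  bernE n (fun j => (u - j%:R / n%:R) ^+ 2) u = u * (1 - u) / n%:R.
Proof.
move=> n0; have nn : n%:R != 0 :> R by rewrite pnatr_eq0 -lt0n.
rewrite (@eq_bernE _ _ (fun j => n%:R ^- 2 * j%:R ^+ 2 +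
   (- (2 * u / n%:R) * j%:R + u ^+ 2 * 1))); last by move=> j; field.
by rewrite !bernED !bernEZ bernE_sqr bernE_id bernE_cst; field.
Qed.

Lemma bernw_ge0 n j u : 0 <= u <= 1 -> 0 <= bernw n j u.
Proof.
by move=> /andP[u0 u1]; rewrite !mulr_ge0// exprn_ge0// subr_ge0.
Qed.

Definition bernp (L : R) (n j : nat) : {poly R} :=
  let U := (2 * L)^-1 *: ('X + L%:P) in ('C(n, j)%:R)%:P * (U ^+ j * (1 - U) ^+ (n - j)).

Lemma bernpE L n j y : (bernp L n j).[y] = bernw n j ((y + L) / (2 * L)).
Proof. by rewrite /bernp /bernw !hornerE [_^-1 * _]mulrC. Qed.

End Bernstein.

(** * Boxes, norms and moduli of continuity *)

Section RowVectors.
Variables (R : realType) (N : nat).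
Local Notation V := 'rV[R]_N.

Lemma ler_coord_norm (y : V) i : `|y ord0 i| <= `|y|.
Proof.
rewrite [leRHS]/Num.norm /= mx_normrE; apply/bigmax_geP; right => /=.
by exists (ord0, i).
Qed.

Lemma ler_norm_coord (y : V) M : 0 <= M -> (forall i, `|y ord0 i| <= M) -> `|y| <= M.
Proof.
move=> M0 yM; rewrite [leLHS]/Num.norm /= mx_normrE; apply/bigmax_leP; split => //.
by move=> [a i] _ /=; rewrite ord1.
Qed.

Lemma psum2_ge0 (y : V) : 0 <= psum 2 y.
Proof. by apply: sumr_ge0 => i _; rewrite sqr_ge0. Qed.

Lemma ler_sqr_psum2 (y : V) i : y ord0 i ^+ 2 <= psum 2 y.
Proof. by rewrite /psum (bigD1 i)//= lerDl; apply: sumr_ge0 => j _; rewrite sqr_ge0. Qed.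

Lemma ler_norm_psum2 (y : V) : `|y| ^+ 2 <= psum 2 y.
Proof.
rewrite -[leRHS]sqr_sqrtr ?psum2_ge0// ler_sqr ?nnegrE ?sqrtr_ge0//.
apply: ler_norm_coord; first exact: sqrtr_ge0.
by move=> i; rewrite -sqrtr_sqr ler_sqrt ?psum2_ge0// ler_sqr_psum2.
Qed.

Definition box (L : R) : set V := [set u | forall i, `|u ord0 i| <= L].

Lemma box_compact L : compact (box L).
Proof.
have -> : box L = [set u : V | forall i, `[- L, L]%classic (u ord0 i)].
  by apply/seteqP; split=> u /= h i; move: (h i); rewrite /= in_itv/= ler_norml.
apply: (@rV_compact _ _ (fun=> `[- L, L]%classic)) => i.
exact: segment_compact.
Qed.

(** Only [u] is confined to the box: in the final comparison [v] is the shifted vector, for which no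
    bound is known beforehand. *)
Lemma unif_continuous_box (G : V -> R) (L e : R) : continuous G -> 0 < e ->
  exists2 d : R, 0 < d & forall u v, box L u -> `|u - v| < d -> `|G u - G v| < e.
Proof.
move=> cG e0; have /compact_near_coveringP := @box_compact L.
move=> /(_ R (0 : R)^'+ (fun d u => forall v, `|u - v| < d -> `|G u - G v| < e) _).
have H x : box L x -> \forall x' \near x & d \near (0 : R)^'+,
    forall v, `|x' - v| < d -> `|G x' - G v| < e.
  move=> _; have e2 : 0 < e / 2 by rewrite divr_gt0.
  have /(cvgrPdist_lt _ _).1 /(_ _ e2) := cG x.
  move=> /nbhs_ballP[r r0 hr].
  have r2 : 0 < r / 2 by rewrite divr_gt0.
  exists (ball x (r / 2), [set d | d < r / 2]) => /=.
    split; first by apply: nbhsx_ballx.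
    by near=> d; near: d; exact: nbhs_right_lt.
  move=> [x' d] /= [xx' dr] v vd.
  have h1 := hr x' _; have h2 := hr v _.
  have -> : G x' - G v = (G x - G v) - (G x - G x') by ring.
  rewrite (le_lt_trans (ler_normB _ _))// [ltRHS]splitr ltrD//.
    apply: h2; rewrite -ball_normE /=.
    rewrite -ball_normE /= in xx'.
    have -> : x - v = (x - x') + (x' - v) by rewrite addrA subrK.
    rewrite (le_lt_trans (ler_normD _ _))// [ltRHS]splitr ltrD//.
    exact: lt_trans vd dr.
  apply: h1; rewrite -ball_normE /=; rewrite -ball_normE /= in xx'.
  by apply: lt_le_trans xx' _; rewrite ler_pdivrMr// ler_peMr ?ler1n// ltW.
move=> /(_ H); rewrite near_withinE => /nbhs_ballP[d /= d0 hd].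
exists (d / 2); first by rewrite divr_gt0.
have dd : ball (0 : R) d (d / 2).
  rewrite -ball_normE /= sub0r normrN gtr0_norm ?divr_gt0//.
  by rewrite ltr_pdivrMr// ltr_pMr// ltr1n.
by move=> u v bu; apply: (hd _ dd) => //=; rewrite divr_gt0.
Unshelve. all: by end_near.
Qed.

Lemma continuous_box_bounded (G : V -> R) (L : R) : continuous G ->
  exists2 B : R, 0 <= B & forall u, box L u -> `|G u| <= B.
Proof.
move=> cG; have : compact (G @` box L).
  by apply: continuous_compact => //; [exact/continuous_subspaceT|exact: box_compact].
move=> /compact_bounded[M [_ hM]]; exists (`|M| + 1); first by rewrite addr_ge0.
move=> u bu; apply: (hM (`|M| + 1)); last by exists u.
by rewrite (le_lt_trans (ler_norm M))// ltrDl.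
Qed.

(** Points closer than the modulus [d] account for [e]. For the others [psum 2 (u - v) >= d ^ 2],
    and the oscillation [2 * B] is at most [2 * B / d ^ 2] times that. A quadratic error is exactly
    what the variance of the Bernstein weights controls. *)
Lemma continuous_box_quadratic (G : V -> R) (L e : R) : continuous G -> 0 < e ->
  exists2 K : R, 0 <= K & forall u v, box L u -> box L v ->
    `|G u - G v| <= e + K * psum 2 (u - v).
Proof.
move=> cG e0.
have [d d0 hd] := unif_continuous_box L cG e0.
have [B B0 hB] := continuous_box_bounded L cG.
have K0 : 0 <= 2 * B / d ^+ 2 by rewrite divr_ge0 ?sqr_ge0// mulr_ge0.
exists (2 * B / d ^+ 2) => // u v bu bv; have [uvd|duv] := ltP `|u - v| d.
  by rewrite (le_trans (ltW (hd _ _ bu uvd)))// lerDl mulr_ge0 ?psum2_ge0.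
apply: (@le_trans _ _ (2 * B)).
  by rewrite (le_trans (ler_normB _ _))// mulr_natl mulr2n lerD// hB.
rewrite (@le_trans _ _ (2 * B / d ^+ 2 * d ^+ 2))//.
  by rewrite divfK// expf_neq0// gt_eqF.
apply: (@le_trans _ _ (2 * B / d ^+ 2 * psum 2 (u - v))); last by rewrite lerDr ltW.
rewrite ler_wpM2l//.
by rewrite (le_trans _ (ler_norm_psum2 _))// lerXn2r ?nnegrE// ltW.
Qed.

End RowVectors.

(** * Weierstrass approximation by symmetric polynomials on the chamber *)

Section Approximation.
Variables (R : realType) (N : nat).
Local Notation V := 'rV[R]_N.

Definition bern_node (L : R) n (J : {ffun 'I_N -> 'I_n.+1}) : V :=
  \row_i (2 * L * ((J i)%:R / n%:R) - L).

Definition bernV (L : R) n (J : {ffun 'I_N -> 'I_n.+1}) (y : V) : R :=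
  \prod_(i < N) (bernp L n (J i)).[y ord0 i].

Lemma bern_node_box (L : R) n J : 0 < L -> (0 < n)%N -> box L (@bern_node L n J).
Proof.
move=> L0 n0 i; rewrite mxE ler_norml.
have h1 : 0 <= (J i)%:R / n%:R :> R by rewrite divr_ge0.
have h2 : (J i)%:R / n%:R <= 1 :> R.
  by rewrite ler_pdivrMr ?ltr0n// mul1r ler_nat -ltnS.
by apply/andP; split; nra.
Qed.

Lemma box_unit (L : R) (y : V) i : 0 < L -> box L y -> 0 <= (y ord0 i + L) / (2 * L) <= 1.
Proof.
move=> L0 /(_ i); rewrite ler_norml => /andP[h1 h2].
by rewrite divr_ge0 ?ler_pdivrMr ?mulr_gt0 ?mul1r//=; lra.
Qed.

Lemma bernV_ge0 (L : R) n J (y : V) : 0 < L -> box L y -> 0 <= @bernV L n J y.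
Proof.
by move=> L0 bY; apply: prodr_ge0 => i _; rewrite bernpE bernw_ge0// box_unit.
Qed.

Lemma sum_bernV (L : R) n (y : V) : \sum_J @bernV L n J y = 1.
Proof.
rewrite /bernV -(bigA_distr_bigA (fun i (j : 'I_n.+1) => (bernp L n j).[y ord0 i])).
rewrite big1// => i _; rewrite -[RHS](bernE_cst n ((y ord0 i + L) / (2 * L))).
by apply: eq_bigr => j _; rewrite mul1r bernpE.
Qed.

Lemma sum_bernV_var (L : R) n (y : V) : 0 < L -> (0 < n)%N -> box L y ->
  \sum_J psum 2 (y - @bern_node L n J) * @bernV L n J y <= N%:R * (4 * L ^+ 2) / n%:R.
Proof.
move=> L0 n0 bY.
under eq_bigr do rewrite /psum mulr_suml.
rewrite exchange_big/=.
have -> : N%:R * (4 * L ^+ 2) / n%:R = \sum_(l < N) (4 * L ^+ 2 / n%:R).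
  by rewrite sumr_const card_ord -[RHS]mulr_natl -!mulrA.
apply: ler_sum => l _.
pose u i := (y ord0 i + L) / (2 * L).
pose F (i : 'I_N) (j : 'I_n.+1) := (if i == l then (2 * L) ^+ 2 * (u i - j%:R / n%:R) ^+ 2 else 1) *
   bernw n j (u i).
have Ln : L != 0 by rewrite gt_eqF.
have nn : n%:R != 0 :> R by rewrite pnatr_eq0 -lt0n.
have -> : \sum_(J : {ffun 'I_N -> 'I_n.+1}) (y - @bern_node L n J) ord0 l ^+ 2 * bernV L J y =
    \sum_(J : {ffun 'I_N -> 'I_n.+1}) \prod_(i < N) F i (J i).
  apply: eq_bigr => J _; rewrite /F big_split/= -big_mkcond big_pred1_eq.
  congr (_ * _); last by apply: eq_bigr => i _; rewrite bernpE.
  by rewrite -exprMn; congr (_ ^+ 2); rewrite !mxE /u; field; rewrite nn Ln.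
rewrite -(bigA_distr_bigA F) (bigD1 l)//= [X in _ * X]big1 ?mulr1; last first.
  move=> i /negbTE il; rewrite /F il -[RHS](bernE_cst n (u i)).
  by apply: eq_bigr.
have -> : \sum_(j < n.+1) F l j = (2 * L) ^+ 2 * bernE n (fun j => (u l - j%:R / n%:R) ^+ 2) (u l).
  by rewrite mulr_sumr; apply: eq_bigr => j _; rewrite /F eqxx -mulrA.
rewrite bernE_var// mulrA ler_pM2r ?invr_gt0 ?ltr0n// exprMn -natrX.
have /andP[h1 h2] := box_unit l L0 bY; rewrite -/(u l) in h1 h2.
have LL : 0 <= 4 * L ^+ 2 by rewrite mulr_ge0 ?sqr_ge0.
by rewrite natrX in LL *; rewrite ler_piMr//; nra.
Qed.

(** The sampling points [v J] and the target [y0] may differ from the nodes and from [y], provided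
    their coordinates are no farther apart than [y] is from the node. Measurability of continuous
    functions uses the nodes themselves, the chamber version uses sorted nodes. *)
Lemma bernV_approx (G : V -> R) (L e : R) : continuous G -> 0 < L -> 0 < e ->
  exists n, (0 < n)%N /\ forall (y0 y : V) (v : {ffun 'I_N -> 'I_n.+1} -> V),
    box L y0 -> box L y -> (forall J, box L (v J)) ->
    (forall J i, (y0 ord0 i - v J ord0 i) ^+ 2 <= psum 2 (y - bern_node L J)) ->
    `|G y0 - \sum_J G (v J) * bernV L J y| <= e.
Proof.
move=> cG L0 e0; have e2 : 0 < e / 2 by rewrite divr_gt0.
have [K K0 hK] := continuous_box_quadratic L cG e2.
(* [K] comes from the quadratic modulus, the first [N%:R] from summing the coordinate bounds, the
   last factor from the variance of the weights. *)
pose C := K * N%:R * (N%:R * (4 * L ^+ 2)).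
have C0 : 0 <= C by rewrite !mulr_ge0 ?sqr_ge0// ltW.
have [n hn] : exists n, 2 * C / e <= n%:R.
  by exists (Num.trunc (2 * C / e)).+1; rewrite ltW// truncnS_gt.
exists n.+1; split=> // y0 y v by0 bY bv hv.
rewrite -[G y0]mulr1 -(sum_bernV L n.+1 y) mulr_sumr -sumrB.
under eq_bigr do rewrite -mulrBl.
apply: le_trans (ler_norm_sum _ _ _) _.
apply: (@le_trans _ _ (\sum_J (e / 2 * bernV L J y + K * N%:R * (psum 2 (y - bern_node L J) * @bernV L n.+1 J y)))).
  apply: ler_sum => J _; rewrite normrM (ger0_norm (bernV_ge0 _ _ _))// mulrA -mulrDl.
  rewrite ler_wpM2r ?bernV_ge0//; apply: le_trans (hK _ _ by0 (bv J)) _.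
  rewrite lerD2l -mulrA ler_wpM2l//.
  rewrite [X in X <= _](_ : _ = \sum_(i < N) (y0 ord0 i - v J ord0 i) ^+ 2); last first.
    by apply: eq_bigr => i _; rewrite !mxE.
  apply: le_trans (ler_sum _ (fun i _ => hv J i)) _.
  by rewrite sumr_const card_ord mulr_natl.
rewrite big_split/= -!mulr_sumr sum_bernV mulr1 [leRHS]splitr lerD2l.
apply: le_trans (ler_wpM2l _ (sum_bernV_var _ _ _)) _ => //; first by rewrite mulr_ge0.
rewrite [leLHS]mulrA -/C ler_pdivrMr ?ltr0n//.
by move: hn; rewrite ler_pdivrMr// -[n.+1%:R]natr1; clearbody C => hn; nra.
Qed.

(** [F] averages over all permutations a Bernstein sum in which [G] is sampled at the sorted nodes,
    so [G] is evaluated only inside the chamber, where its lack of symmetry is harmless. By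
    [chamberA_rearrange], each coordinate of the sorted [u] is as close to the sorted node as some
    coordinate of a permuted [u] is to the unsorted node. *)
Lemma chamberA_weierstrass (G : V -> R) (L e : R) : continuous G -> 0 < L -> 0 < e ->
  exists F, sympoly xpredT F /\
    forall u, chamberA u -> box L u -> `|G u - F u| <= e.
Proof.
move=> cG L0 e0; have [n [n0 hn]] := bernV_approx cG L0 e0.
have /choice[s hs] : forall J : {ffun 'I_N -> 'I_n.+1}, exists s : 'S_N,
    chamberA (\row_i (bern_node L J) ord0 (s i)) by move=> J; exact: chamberA_sort.
pose v J : V := \row_i (bern_node L J) ord0 (s J i).
pose F y := #|'S_N|%:R^-1 * \sum_J G (v J) * permprod (fun i => bernp L n (J i)) y.
exists F; split.
  apply: sympolyZ; apply: sympoly_sum => J _; apply: sympolyZ.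
  exact: sympoly_permprod.
move=> u cu bu.
have FE : F u = #|'S_N|%:R^-1 * \sum_(t : 'S_N)
    \sum_J G (v J) * bernV L J (\row_i u ord0 (t i)).
  rewrite /F; congr (_ * _); rewrite exchange_big/=; apply: eq_bigr => J _.
  rewrite /permprod mulr_sumr; apply: eq_bigr => t _; congr (_ * _).
  by apply: eq_bigr => i _; rewrite mxE.
have S0 : #|'S_N|%:R != 0 :> R by rewrite pnatr_eq0 -lt0n; apply/card_gt0P; exists 1%g.
have -> : G u = #|'S_N|%:R^-1 * \sum_(t : 'S_N) G u.
  by rewrite sumr_const -[G u *+ _]mulr_natl mulrA mulVf// mul1r.
rewrite FE -mulrBr -sumrB normrM normfV normr_nat ler_pdivrMl ?lt0r ?S0 ?ler0n//.
apply: le_trans (ler_norm_sum _ _ _) _.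
rewrite mulr_natl -sumr_const; apply: ler_sum => t _; apply: hn => //.
- by move=> i; rewrite mxE.
- by move=> J i; rewrite mxE; exact: bern_node_box.
(* With this permutation the pair compared at [l] consists of the coordinates of index [t^-1 l] of
   the permuted [u] and of the unsorted node. *)
move=> J i; have [l hl] := @chamberA_rearrange _ _ u (v J) (t^-1 * (s J)^-1)%g i cu (hs J).
rewrite -[leLHS]real_normK ?num_real//.
apply: (@le_trans _ _ (`|u ord0 l - v J ord0 ((t^-1 * (s J)^-1)%g l)| ^+ 2)).
  by rewrite lerXn2r// nnegrE.
rewrite real_normK ?num_real//.
apply: le_trans (ler_sqr_psum2 _ ((t^-1)%g l)).
by rewrite /v !mxE permM !permKV.
Qed.

End Approximation.

(** * Explicit gradients and Hessians *)

Section C2Calculus.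
Variables (R : realType) (N : nat).
Local Notation V := 'rV[R]_N.

(** Differentiability in the strong sense supports the chain rule, which existence of partial
    derivatives would not. The derivatives are given as explicit functions, so that the generator
    can be computed by rewriting. *)
Definition jet1 (f : V -> R) (g : 'I_N -> V -> R) : Prop :=
  (forall y, differentiable f y) /\ forall i y, 'D_(evec R i) f y = g i y.

Definition jet2 (f : V -> R) (g : 'I_N -> V -> R) (h : 'I_N -> 'I_N -> V -> R) : Prop :=
  [/\ jet1 f g, forall i, jet1 (g i) (h i) & forall i j, continuous (h i j)].

Lemma jet1_continuous f g : jet1 f g -> continuous f.
Proof. by move=> [df _] y; exact: differentiable_continuous. Qed.

Lemma jet1_derivable f g : jet1 f g -> forall v y, derivable f y v.
Proof. by move=> [df _] v y; exact: diff_derivable. Qed.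

Lemma jet2_C2 f g h : jet2 f g h -> C2 f.
Proof.
move=> [j1 j2 ch]; split; first exact: jet1_continuous j1.
have ph i j : partial j (g i) = h i j by apply/funext => y; rewrite /partial (j2 i).2.
have pg i : partial i f = g i by apply/funext => y; rewrite /partial j1.2.
move=> i j; rewrite pg ph; split; first by move=> y; exact: (jet1_derivable j1).
split; first exact: jet1_continuous (j2 i).
by split=> // y; exact: (jet1_derivable (j2 i)).
Qed.

Lemma jet2_partial f g h i : jet2 f g h -> partial i f = g i.
Proof. by move=> [j1 _ _]; apply/funext => y; rewrite /partial j1.2. Qed.

Lemma jet2_partial2 f g h i j : jet2 f g h -> partial j (partial i f) = h i j.
Proof.
move=> jf; rewrite (jet2_partial i jf); case: jf => [_ j2 _].
by apply/funext => y; rewrite /partial (j2 i).2.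
Qed.

Lemma jet1_cst a : jet1 (fun=> a) (fun _ _ => 0).
Proof. by split=> [y|i y]; [exact: differentiable_cst|exact: derive_cst]. Qed.

Lemma jet1_coord i : jet1 (fun y => y ord0 i) (fun j _ => (i == j)%:R).
Proof.
split=> [y|j y]; first exact: differentiable_coord.
have @f : {linear V -> R}.
  by exists (fun y : V => y ord0 i); do 2![eexists]; do ?[constructor];
     rewrite ?mxE// => ? *; rewrite ?mxE//; move=> ?; rewrite !mxE.
rewrite (_ : (fun _ => _) = f)// deriveE; last exact/linear_differentiable/coord_continuous.
by rewrite diff_lin; [rewrite /= /evec mxE eqxx|exact: coord_continuous].
Qed.

Lemma jet1D f g f' g' : jet1 f g -> jet1 f' g' ->
  jet1 (fun y => f y + f' y) (fun i y => g i y + g' i y).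
Proof.
move=> j1 j2; have -> : (fun y => f y + f' y) = f + f' by [].
split=> [y|i y]; first exact: differentiableD (j1.1 y) (j2.1 y).
by rewrite deriveD ?j1.2 ?j2.2//; apply: jet1_derivable; eassumption.
Qed.

Lemma jet1M f g f' g' : jet1 f g -> jet1 f' g' ->
  jet1 (fun y => f y * f' y) (fun i y => f y * g' i y + f' y * g i y).
Proof.
move=> j1 j2; have -> : (fun y => f y * f' y) = f * f' by [].
split=> [y|i y]; first exact: differentiableM (j1.1 y) (j2.1 y).
by rewrite deriveM ?j1.2 ?j2.2//; apply: jet1_derivable; eassumption.
Qed.

Lemma jet1_comp f g (phi dphi : R -> R) : jet1 f g ->
  (forall x : R, is_derive x 1 phi (dphi x)) ->
  jet1 (fun y => phi (f y)) (fun i y => dphi (f y) * g i y).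
Proof.
move=> j1 dp; have -> : (fun y => phi (f y)) = phi \o f by [].
have dphid (x : R) : differentiable phi x by apply/derivable1_diffP; case: (dp x).
have dc y : differentiable (phi \o f) y by apply: differentiable_comp; [exact: j1.1|].
split=> [//|i y].
rewrite deriveE// diff_comp//=; last exact: j1.1.
have -> : 'd f y (evec R i) = g i y by rewrite -deriveE ?j1.2//; exact: j1.1.
rewrite -[X in 'd _ _ X]mulr1 -[_ * 1]/(_ *: 1) linearZ/= mulrC.
by rewrite -deriveE// derive_val.
Qed.

Lemma jet1_ext f g f' g' : f =1 f' -> (forall i, g i =1 g' i) -> jet1 f g -> jet1 f' g'.
Proof.
move=> /funext <- gg' [j1 j2]; split=> // i y.
by rewrite j2 gg'.
Qed.

Lemma jet2_ext f g h f' g' h' : f =1 f' -> (forall i, g i =1 g' i) ->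
  (forall i j, h i j =1 h' i j) -> jet2 f g h -> jet2 f' g' h'.
Proof.
move=> ff gg hh [j1 j2 c]; split; first exact: jet1_ext j1.
  by move=> i; exact: jet1_ext (j2 i).
by move=> i j; rewrite -(_ : h i j = h' i j)//; apply/funext => y; exact: hh.
Qed.

Lemma jet2_cst a : jet2 (fun=> a) (fun _ _ => 0) (fun _ _ _ => 0).
Proof.
by split=> [|i|i j y]; [exact: jet1_cst|exact: jet1_cst|exact: cst_continuous].
Qed.

Lemma jet2_coord i : jet2 (fun y => y ord0 i) (fun j _ => (i == j)%:R) (fun _ _ _ => 0).
Proof.
by split=> [|j|j l y]; [exact: jet1_coord|exact: jet1_cst|exact: cst_continuous].
Qed.

Lemma jet2D f g h f' g' h' : jet2 f g h -> jet2 f' g' h' ->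
  jet2 (fun y => f y + f' y) (fun i y => g i y + g' i y)
       (fun i j y => h i j y + h' i j y).
Proof.
move=> [a1 a2 a3] [b1 b2 b3]; split; first exact: jet1D.
  by move=> i; exact: jet1D.
by move=> i j y; apply: continuousD; [exact: a3|exact: b3].
Qed.

Lemma jet2M f g h f' g' h' : jet2 f g h -> jet2 f' g' h' ->
  jet2 (fun y => f y * f' y) (fun i y => f y * g' i y + f' y * g i y)
       (fun i j y => f y * h' i j y + f' y * h i j y + (g j y * g' i y + g i y * g' j y)).
Proof.
move=> [a1 a2 a3] [b1 b2 b3]; split; first exact: jet1M.
  move=> i; apply: jet1_ext (jet1D (jet1M a1 (b2 i)) (jet1M b1 (a2 i))) => //.
  by move=> j y; ring.
move=> i j y.
have c1 := jet1_continuous a1; have c2 := jet1_continuous b1.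
have c3 k := jet1_continuous (a2 k); have c4 k := jet1_continuous (b2 k).
apply: (@continuousD _ _ _ (fun y => f y * h' i j y + f' y * h i j y)).
  apply: (@continuousD _ _ _ (fun y => f y * h' i j y)).
    by apply: continuousM; [exact: c1|exact: b3].
  by apply: continuousM; [exact: c2|exact: a3].
apply: (@continuousD _ _ _ (fun y => g j y * g' i y)).
  by apply: continuousM; [exact: c3|exact: c4].
by apply: continuousM; [exact: c3|exact: c4].
Qed.

Lemma jet2_comp f g h (phi dphi ddphi : R -> R) : jet2 f g h ->
  (forall x : R, is_derive x 1 phi (dphi x)) -> (forall x : R, is_derive x 1 dphi (ddphi x)) ->
  continuous ddphi ->
  jet2 (fun y => phi (f y)) (fun i y => dphi (f y) * g i y)
       (fun i j y => dphi (f y) * h i j y + g i y * (ddphi (f y) * g j y)).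
Proof.
move=> [a1 a2 a3] d1 d2 cdd; split; first exact: jet1_comp.
  by move=> i; apply: jet1M => //; exact: jet1_comp.
move=> i j y.
have c1 := jet1_continuous a1; have c3 k := jet1_continuous (a2 k).
have cd : continuous (fun y => dphi (f y)) by exact: jet1_continuous (jet1_comp a1 d2).
apply: (@continuousD _ _ _ (fun y => dphi (f y) * h i j y)).
  by apply: continuousM; [exact: cd|exact: a3].
apply: continuousM; first exact: c3.
apply: continuousM; last exact: c3.
by apply: continuous_comp; [exact: c1|exact: cdd].
Qed.

Lemma jet2_sum I (r : seq I) (P : pred I) (f : I -> V -> R) g h :
  (forall k, P k -> jet2 (f k) (g k) (h k)) ->
  jet2 (fun y => \sum_(k <- r | P k) f k y) (fun i y => \sum_(k <- r | P k) g k i y)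
       (fun i j y => \sum_(k <- r | P k) h k i j y).
Proof.
move=> jf; elim: r => [|k r IH].
  by apply: jet2_ext (jet2_cst 0) => [y|i y|i j y]; rewrite big_nil.
have [Pk|nPk] := boolP (P k).
  by apply: jet2_ext (jet2D (jf _ Pk) IH) => [y|i y|i j y]; rewrite big_cons Pk.
by apply: jet2_ext IH => [y|i y|i j y]; rewrite big_cons (negbTE nPk).
Qed.

Lemma jet2Z a f g h : jet2 f g h ->
  jet2 (fun y => a * f y) (fun i y => a * g i y) (fun i j y => a * h i j y).
Proof.
move=> jf; apply: jet2_ext (jet2M (jet2_cst a) jf) => //.
  by move=> i y; rewrite mulr0 addr0.
by move=> i j y; rewrite mulr0 !mul0r !addr0.
Qed.

End C2Calculus.

(** * Powers of the positive part *)

Section PositivePart.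
Variable R : realType.

Definition pos (u : R) : R := Num.max 0 u.

Lemma pos_ge0 u : 0 <= pos u. Proof. by rewrite /pos le_max lexx. Qed.

Lemma pos_id u : 0 <= u -> pos u = u. Proof. by move=> u0; apply/max_idPr. Qed.

Lemma pos_0 u : u <= 0 -> pos u = 0. Proof. by move=> u0; apply/max_idPl. Qed.

Lemma pos_continuous : continuous pos.
Proof. by move=> x; apply: continuous_max; [exact: cvg_cst|exact: cvg_id]. Qed.

(** The exponent is at least 2: at the origin the difference quotient is [pos h ^+ n.+1], which
    tends to 0. Hence the cube, on which the cutoffs are built, is twice continuously
    differentiable. *)
Lemma is_derive_posX n (x : R) :
  is_derive x 1 (fun u => pos u ^+ n.+2) (n.+2%:R * pos x ^+ n.+1).
Proof.
have dX : is_derive x 1 (fun u : R => u ^+ n.+2) (n.+2%:R * x ^+ n.+1).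
  apply: DeriveDef; first exact: exprn_derivable.
  by rewrite exp_derive -[_ *: 1]/(_ * 1) mulr1.
have [x0|x0|->] := ltgtP x 0.
- rewrite pos_0 ?(ltW x0)// expr0n mulr0.
  apply: near_eq_is_derive (is_derive_cst (0 : R) x 1).
  by near=> u; rewrite pos_0 ?expr0n// ltW//; near: u; exact: lt_nbhsl.
- rewrite pos_id ?(ltW x0)//; apply: near_eq_is_derive dX.
  by near=> u; rewrite pos_id// ltW//; near: u; exact: lt_nbhsr.
have -> : n.+2%:R * pos 0 ^+ n.+1 = 0 by rewrite pos_0// expr0n mulr0.
have H : (fun h : R => h^-1 *: (pos (h *: (1 : R) + 0) ^+ n.+2 - pos 0 ^+ n.+2)) @ 0^' --> (0 : R).
  have c : (fun h : R => pos h ^+ n.+1) @ 0^' --> (0 : R).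
    apply: cvg_within_filter.
    have c0 : (fun h : R => pos h ^+ n.+1) @ (0 : R) --> pos 0 ^+ n.+1.
      apply: (@continuous_comp _ _ _ pos (fun u => u ^+ n.+1)); first exact: pos_continuous.
      exact: exprn_continuous.
    by rewrite pos_0// expr0n in c0.
  apply: cvg_trans c; apply: near_eq_cvg; near=> h.
  have hn0 : h != 0 by near: h; exact: nbhs_dnbhs_neq.
  have -> : pos (0 : R) = 0 by rewrite pos_0.
  rewrite addr0 expr0n subr0 -[h *: (1 : R)]/(_ * _) mulr1 -[RHS]/(_ * _).
  have [h0|h0] := leP h 0; first by rewrite pos_0// !expr0n mulr0.
  by rewrite pos_id ?ltW// [in RHS]exprS mulKf.
apply: DeriveDef; first by apply/cvg_ex; exists 0.
exact/cvg_lim.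
Unshelve. all: by end_near.
Qed.

End PositivePart.

(** * First derivatives of invariant functions near the walls *)

Section PartialDerivatives.
Variables (R : realType) (N : nat).
Local Notation V := 'rV[R]_N.

Lemma row_ext (u v : V) : (forall l, u ord0 l = v ord0 l) -> u = v.
Proof. by move=> uv; apply/rowP. Qed.

Lemma lipschitz_line (phi : V -> R) (v : V) (H : R) :
  (forall y, derivable phi y v) -> (forall y, `|'D_v phi y| <= H) ->
  forall y (t : R), `|phi (y + t *: v) - phi y| <= H * `|t|.
Proof.
move=> dphi bphi y t.
have d (s : R) : is_derive s 1 (fun u : R => phi (y + u *: v)) ('D_v phi (y + s *: v)).
  have E : (fun h : R => h^-1 *: (phi (y + (h *: (1 : R) + s) *: v) - phi (y + s *: v))) =
    (fun h : R => h^-1 *: (phi (h *: v + (y + s *: v)) - phi (y + s *: v))).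
    apply/funext => h; congr (_ *: (phi _ - _)).
    by rewrite -[h *: 1]/(h * 1) mulr1 scalerDl addrCA.
  by apply: DeriveDef; rewrite /derivable /derive E//; exact: dphi.
have c : continuous (fun u : R => phi (y + u *: v)).
  by move=> s; apply: differentiable_continuous; apply/derivable1_diffP; case: (d s).
have [t0|t0] := leP 0 t.
  have [z _] := MVT_segment t0 (fun s _ => d s) (continuous_subspaceT c).
  rewrite scale0r addr0 subr0 => ->; rewrite normrM ler_wpM2r//.
have [z _] := MVT_segment (ltW t0) (fun s _ => d s) (continuous_subspaceT c).
rewrite scale0r addr0 sub0r distrC => ->; rewrite normrM normrN ler_wpM2r//.
Qed.

Lemma eq_derive_increment (f g : V -> R) (v w a b : V) :
  (forall h : R, f (h *: v + a) = g (h *: w + b)) -> 'D_v f a = 'D_w g b.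
Proof.
move=> fg; rewrite /derive.
have -> : (fun h : R => h^-1 *: ((f \o shift a) (h *: v) - f a)) =
  (fun h : R => h^-1 *: ((g \o shift b) (h *: w) - g b)); last by [].
apply/funext => h; rewrite /= fg; congr (_ *: (_ - _)).
by have := fg 0; rewrite !scale0r !add0r.
Qed.

Lemma deriveN_dir (f : V -> R) (v a : V) : derivable f a v -> 'D_(- v) f a = - 'D_v f a.
Proof.
move=> /cvg_ex[l /= fl]; rewrite /derive (cvg_lim _ fl)//; apply: cvg_lim => //.
pose q (h : R) := h^-1 *: (f (h *: v + a) - f a).
have -> : (fun h : R => h^-1 *: (f (h *: - v + a) - f a)) = (fun h => - q (- h)).
  by apply/funext => h; rewrite /q invrN scaleNr opprK scalerN -scaleNr.
apply: (@cvgN _ _ _ _ _ (fun h => q (- h)) l).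
have NN : -%R @ (0 : R)^' --> (0 : R)^'.
  move=> A [e /= e0 eA]; exists e => // x /= xe xn0; apply: eA; last by rewrite oppr_eq0.
  by move: xe; rewrite /= !sub0r !normrN.
exact: cvg_comp NN fl.
Qed.

Definition swap (i j : 'I_N) (y : V) : V := \row_l y ord0 (tperm i j l).

Definition flip (i : 'I_N) (y : V) : V := \row_l ((-1) ^+ (l == i) * y ord0 l).

Lemma partial_swap (f : V -> R) i j y : perm_invariant f ->
  partial j f y = partial i f (swap i j y).
Proof.
move=> pf; apply: eq_derive_increment => h.
rewrite -(pf (tperm i j) (h *: _ + y)); congr (f _).
apply: row_ext => l; rewrite !mxE !eqxx/=; congr (_ * _%:R + _).
by rewrite -[X in _ == X](tpermL i j) (inj_eq (@perm_inj _ _)).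
Qed.

Lemma partial_flip (f : V -> R) i y : sign_invariant f -> (forall y, derivable f y (evec R i)) ->
  partial i f y = - partial i f (flip i y).
Proof.
move=> sf df; rewrite /partial -deriveN_dir//; apply: eq_derive_increment => h.
rewrite -(sf (fun l => l == i) (h *: _ + y)); congr (f _).
apply: row_ext => l; rewrite !mxE eqxx/=.
by case: eqVneq => _ /=; rewrite ?expr1 ?expr0 /=; ring.
Qed.

Lemma swapE i j y : i != j ->
  swap i j y = y + (y ord0 j - y ord0 i) *: evec R i + (y ord0 i - y ord0 j) *: evec R j.
Proof.
move=> ij; apply: row_ext => l; rewrite !mxE !eqxx/=.
case: tpermP => [->|->|/eqP/negbTE li /eqP/negbTE lj].
- by rewrite eqxx (negbTE ij) /=; ring.
- by rewrite eqxx eq_sym (negbTE ij) /=; ring.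
- by rewrite li lj /=; ring.
Qed.

Lemma flipE i y : flip i y = y + (- 2 * y ord0 i) *: evec R i.
Proof.
apply: row_ext => l; rewrite !mxE eqxx/=; case: eqVneq => [->|_]; rewrite ?expr1 ?expr0 /=; ring.
Qed.

Section Reflections.
Variables (f : V -> R) (H : R).
Hypotheses (fC2 : C2 f) (bH : forall i j y, `|partial j (partial i f) y| <= H).

Let H0 (i : 'I_N) : 0 <= H. Proof. exact: le_trans (normr_ge0 _) (bH i i 0). Qed.

Let dpartial i j y : derivable (partial i f) y (evec R j).
Proof. by have [_ /(_ i j)[_ [_ []]]] := fC2. Qed.

Let d1 i y : derivable f y (evec R i).
Proof. by have [_ /(_ i i)[]] := fC2. Qed.

(** [partial j f y] is [partial i f] at the reflected point, which is reached from [y] by two moves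
    of length [|y_i - y_j|] along coordinate axes. Each move costs [H] times its length, whence the
    factor 2. *)
Lemma partial_sub_bound i j y : perm_invariant f ->
  `|partial i f y - partial j f y| <= 2 * H * `|y ord0 i - y ord0 j|.
Proof.
move=> pf; have [->|ij] := eqVneq i j; first by rewrite !subrr normr0 mulr0.
rewrite (partial_swap i j _ pf) swapE//.
set y1 := y + _ *: evec R i.
have -> : partial i f y - partial i f (y1 + (y ord0 i - y ord0 j) *: evec R j) =
  - (partial i f (y1 + (y ord0 i - y ord0 j) *: evec R j) - partial i f y1)
  - (partial i f y1 - partial i f y) by ring.
have h1 := lipschitz_line (@dpartial i j) (bH i j) y1 (y ord0 i - y ord0 j).
have h2 := lipschitz_line (@dpartial i i) (bH i i) y (y ord0 j - y ord0 i).
rewrite (distrC (y ord0 j)) in h2.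
have -> : 2 * H * `|y ord0 i - y ord0 j| = H * `|y ord0 i - y ord0 j| + H * `|y ord0 i - y ord0 j|.
  by ring.
by rewrite (le_trans (ler_normB _ _))// normrN lerD.
Qed.

(** The reflection changes the sign of [partial i f], so its increment over a segment of length
    [2 |y_i|] is twice the derivative itself. *)
Lemma partial_flip_bound i y : sign_invariant f ->
  `|partial i f y| <= H * `|y ord0 i|.
Proof.
move=> sf; have := partial_flip y sf (@d1 i); rewrite flipE => e.
have : `|partial i f (y + (- 2 * y ord0 i) *: evec R i) - partial i f y| <= H * `|- 2 * y ord0 i|.
  exact: lipschitz_line (@dpartial i i) (bH i i) _ _.
have -> : partial i f (y + (- 2 * y ord0 i) *: evec R i) - partial i f y = - 2 * partial i f y.
  by rewrite -[partial i f (_ + _)]opprK -e; ring.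
by rewrite !normrM mulrCA ler_pM2l// normr_gt0 oppr_eq0 pnatr_eq0.
Qed.

(** Changing the sign of [y_j] reduces this to the estimate for the difference. *)
Lemma partial_add_bound i j y : perm_invariant f -> sign_invariant f -> i != j ->
  `|partial i f y + partial j f y| <= 2 * H * `|y ord0 i + y ord0 j|.
Proof.
move=> pf sf ij; have := partial_sub_bound i j (flip j y) pf.
have -> : partial i f (flip j y) = partial i f y.
  apply: eq_derive_increment => h.
  rewrite -[RHS](sf (fun l => l == j)); congr (f _); apply: row_ext => l; rewrite !mxE eqxx/=.
  case: (eqVneq l j) => [->|_]; rewrite ?expr1 ?expr0 ?mul1r//.
  by rewrite eq_sym (negbTE ij)/=; ring.
rewrite (partial_flip y sf (@d1 j)) !mxE (negbTE ij) eqxx expr1 expr0 !mul1r mulN1r opprK.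
done.
Qed.

End Reflections.

End PartialDerivatives.

(** * The generator and its regularizations *)

Section Generator.
Variables (R : realType) (N : nat).
Local Notation V := 'rV[R]_N.

Lemma continuous_add (T : topologicalType) (F G : T -> R) :
  continuous F -> continuous G -> continuous (fun y => F y + G y).
Proof. by move=> cF cG y; apply: cvgD; [exact: cF|exact: cG]. Qed.

Lemma continuous_sub (T : topologicalType) (F G : T -> R) :
  continuous F -> continuous G -> continuous (fun y => F y - G y).
Proof. by move=> cF cG y; apply: cvgB; [exact: cF|exact: cG]. Qed.

Lemma continuous_mul (T : topologicalType) (F G : T -> R) :
  continuous F -> continuous G -> continuous (fun y => F y * G y).
Proof. by move=> cF cG y; apply: cvgM; [exact: cF|exact: cG]. Qed.

Lemma continuous_fcomp (T : topologicalType) (F : R -> R) (G : T -> R) :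
  continuous F -> continuous G -> continuous (fun y => F (G y)).
Proof. by move=> cF cG y; apply: continuous_comp; [exact: cG|exact: cF]. Qed.

Lemma continuous_bigsum (T : topologicalType) I (r : seq I) (P : pred I) (F : I -> T -> R) :
  (forall i, P i -> continuous (F i)) -> continuous (fun y => \sum_(i <- r | P i) F i y).
Proof.
move=> cF; elim: r => [|i r IH].
  rewrite [X in continuous X](_ : _ = fun=> 0); first exact: cst_continuous.
  by apply/funext => y; rewrite big_nil.
have [Pi|/negbTE nPi] := boolP (P i); last by under eq_fun do rewrite big_cons nPi.
under eq_fun do rewrite big_cons Pi.
by move=> y; apply: continuousD; [exact: cF|exact: IH].
Qed.

Lemma cvg_bigsum T (G : set_system T) {FG : Filter G} I (r : seq I) (P : pred I)
    (F : I -> T -> R) (l : I -> R) :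
  (forall i, P i -> F i @ G --> l i) ->
  (fun t => \sum_(i <- r | P i) F i t) @ G --> \sum_(i <- r | P i) l i.
Proof.
move=> cF; elim: r => [|i r IH].
  rewrite big_nil; under eq_fun do rewrite big_nil.
  exact: cvg_cst.
rewrite big_cons; have [Pi|/negbTE nPi] := boolP (P i).
  under eq_fun do rewrite big_cons Pi.
  by apply: cvgD; [exact: cF|exact: IH].
by under eq_fun do rewrite big_cons nPi.
Qed.

(* The parameter [ker] is the inverse, or a continuous approximation of it. The
   boolean selects type B ([true]) or type A ([false], where [k1] plays no role). *)
Definition drift (ker : R -> R) (b : bool) (k1 k2 : R) (a : 'I_N -> R) (y : V) : R :=
  k2 * \sum_(i < N) \sum_(j < N | j != i)
     (ker (y ord0 i - y ord0 j) + b%:R * ker (y ord0 i + y ord0 j)) * a i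
  + b%:R * k1 * \sum_(i < N) ker (y ord0 i) * a i.

Definition gen ker b k1 k2 (f : V -> R) (y : V) : R :=
  2^-1 * laplacian f y + drift ker b k1 k2 (fun i => partial i f y) y.

Lemma genB_gen k1 k2 : @genB R N k1 k2 = gen GRing.inv true k1 k2.
Proof.
apply/funext => f; apply/funext => y; rewrite /genB /gen /drift mul1r -addrA.
congr (_ + (_ * _ + _)); apply: eq_bigr => i _; apply: eq_bigr => j _.
by rewrite mul1r.
Qed.

Lemma genA_gen k : @genA R N k = gen GRing.inv false 0 k.
Proof.
apply/funext => f; apply/funext => y; rewrite /genA /gen /drift mulr0 mul0r addr0.
congr (_ + (_ * _)); apply: eq_bigr => i _; apply: eq_bigr => j _.
by rewrite mul0r addr0.
Qed.

Definition dom (b : bool) (f : V -> R) : Prop :=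
  [/\ C2 f, compact_support f, perm_invariant f & b -> sign_invariant f].

Lemma domB_dom f : dom true f -> domB f.
Proof. by move=> [? ? ? s]; split=> //; split=> //; split=> //; exact: s. Qed.

Lemma domA_dom f : dom false f -> domA f.
Proof. by move=> [? ? ? _]; split=> //; split. Qed.

Definition chamber (b : bool) : set V := if b then @chamberB R N else @chamberA R N.

Lemma sum_offdiagC (c : 'I_N -> 'I_N -> R) (a : 'I_N -> R) :
  \sum_(i < N) \sum_(j < N | j != i) c i j * a i =
  2^-1 * \sum_(i < N) \sum_(j < N | j != i) (c i j * a i + c j i * a j).
Proof.
set S := LHS; under eq_bigr do rewrite big_split; rewrite big_split/= -/S.
have -> : \sum_(i < N) \sum_(j < N | j != i) c j i * a j = S.
  rewrite (exchange_big_dep xpredT)//=; apply: eq_bigr => i _.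
  by apply: eq_bigl => j; rewrite eq_sym.
by field.
Qed.

(** The two properties of [u^-1] on which the drift estimates rest. The continuous approximations
    [rker d] share them, which makes the estimates uniform in [d]. For the inverse the bound holds
    at 0 because [0^-1 = 0]. *)
Definition odd_ker (ker : R -> R) :=
  (forall u, ker (- u) = - ker u) /\ forall u, `|ker u * u| <= 1.

Lemma odd_ker_inv : odd_ker GRing.inv.
Proof.
split=> u; first by rewrite invrN.
have [->|u0] := eqVneq u 0; first by rewrite mulr0 normr0.
by rewrite mulVf// normr1.
Qed.

Definition rker (d u : R) : R := u / (u ^+ 2 + d).

Lemma odd_ker_rker (d : R) : 0 < d -> odd_ker (rker d).
Proof.
move=> d0; split=> u; rewrite /rker; first by rewrite sqrrN mulNr.
have h : 0 < u ^+ 2 + d by rewrite ltr_wpDl// sqr_ge0.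
rewrite mulrAC normrM normfV (gtr0_norm h) ler_pdivrMr// mul1r -expr2.
by rewrite ger0_norm ?sqr_ge0// lerDl ltW.
Qed.

Lemma rker_continuous (d : R) : 0 < d -> continuous (rker d).
Proof.
move=> d0 u; apply: cvgM; first exact: cvg_id.
apply: cvgV; first by rewrite gt_eqF// ltr_wpDl// sqr_ge0.
by apply: cvgD; [exact: exprn_continuous|exact: cvg_cst].
Qed.

(* At [u = 0] this uses [0^-1 = 0]. *)
Lemma cvg_rker (u : R) : (fun n => rker n.+1%:R^-1 u) @ \oo --> u^-1.
Proof.
rewrite /rker; have [->|u0] := eqVneq u 0.
  by under eq_fun do rewrite mul0r; rewrite invr0; exact: cvg_cst.
have -> : u^-1 = u * (u ^+ 2 + 0)^-1 by rewrite addr0; field.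
apply: cvgM; first exact: cvg_cst.
apply: cvgV; first by rewrite addr0 sqrf_eq0.
apply: cvgD; first exact: cvg_cst.
exact: cvg_harmonic.
Qed.

(** Pairing [(i, j)] with [(j, i)] replaces [a i] by [a i - a j] and [a i + a j]. For the gradient
    of an invariant function these vanish on the walls where the kernel is singular. *)
Lemma drift_sym ker (b : bool) k1 k2 a (y : V) : odd_ker ker -> drift ker b k1 k2 a y =
  k2 / 2 * \sum_(i < N) \sum_(j < N | j != i)
     (ker (y ord0 i - y ord0 j) * (a i - a j) +
      b%:R * (ker (y ord0 i + y ord0 j) * (a i + a j)))
  + b%:R * k1 * \sum_(i < N) ker (y ord0 i) * a i.
Proof.
move=> [ok _]; rewrite /drift sum_offdiagC mulrA; congr (_ * _ + _).
apply: eq_bigr => i _; apply: eq_bigr => j _.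
by rewrite -[y ord0 j - y ord0 i]opprB ok [y ord0 j + _]addrC; ring.
Qed.

Lemma drift_bound ker (b : bool) k1 k2 (a : 'I_N -> R) (y : V) (A : R) : odd_ker ker -> 0 <= A ->
  (forall i j, `|a i - a j| <= A * `|y ord0 i - y ord0 j|) ->
  (b -> forall i j, i != j -> `|a i + a j| <= A * `|y ord0 i + y ord0 j|) ->
  (b -> forall i, `|a i| <= A * `|y ord0 i|) ->
  `|drift ker b k1 k2 a y| <= (`|k2| * N%:R ^+ 2 + `|k1| * N%:R) * A.
Proof.
move=> kk A0 h1 h2 h3; rewrite drift_sym//.
have kb u d : `|d| <= A * `|u| -> `|ker u * d| <= A.
  move=> du; rewrite normrM; apply: (le_trans (ler_wpM2l (normr_ge0 _) du)).
  by rewrite mulrCA -normrM ler_piMr// kk.2.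
rewrite (le_trans (ler_normD _ _))// mulrDl lerD//.
  rewrite normrM.
  apply: (@le_trans _ _ (`|k2 / 2| * \sum_(i < N) \sum_(j < N) (A + A))); last first.
    rewrite !sumr_const !card_ord normrM (@ger0_norm _ 2^-1)//.
    rewrite -[X in _ * X <= _]mulr_natl -[X in _ * (_ * X) <= _]mulr_natl.
    by rewrite [leLHS](_ : _ = `|k2| * N%:R ^+ 2 * A)//; field.
  rewrite ler_wpM2l//; apply: le_trans (ler_norm_sum _ _ _) _; apply: ler_sum => i _.
  apply: le_trans (ler_norm_sum _ _ _) _; rewrite big_mkcond; apply: ler_sum => j _.
  case: ifPn => [ji|_]; last by rewrite addr_ge0.
  rewrite (le_trans (ler_normD _ _))// lerD//; first exact: kb.
  case: b h2 h3 => h2 h3; last by rewrite mul0r normr0.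
  by rewrite mul1r; apply: kb; apply: h2; rewrite // eq_sym.
case: b h2 h3 => h2 h3; last by rewrite !mul0r normr0 !mulr_ge0.
rewrite mul1r normrM -mulrA ler_wpM2l//; apply: le_trans (ler_norm_sum _ _ _) _.
rewrite mulr_natl -[leRHS](_ : \sum_(i < N) A = _); last by rewrite sumr_const card_ord.
by apply: ler_sum => i _; apply: kb; exact: h3.
Qed.

(** [N%:R / 2] accounts for the Laplacian; the factor 2 in front of the drift is the one of
    [partial_sub_bound] and [partial_add_bound]. *)
Definition gen_cst (k1 k2 : R) : R := N%:R / 2 + 2 * (`|k2| * N%:R ^+ 2 + `|k1| * N%:R).

(** One constant for all odd kernels: this is the domination under which the regularized generators
    converge to the singular one. *)
Lemma gen_bound ker (b : bool) k1 k2 (f : V -> R) (H : R) y : odd_ker ker -> dom b f -> 0 <= H ->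
  (forall i j y, `|partial j (partial i f) y| <= H) ->
  `|gen ker b k1 k2 f y| <= gen_cst k1 k2 * H.
Proof.
move=> kk [fC2 _ pf sf] H0 bH; rewrite /gen (le_trans (ler_normD _ _))// mulrDl lerD//.
  rewrite normrM (@ger0_norm _ 2^-1)// mulrAC mulrC ler_pM2r ?invr_gt0//.
  rewrite mulr_natl -[leRHS](_ : \sum_(i < N) H = _); last by rewrite sumr_const card_ord.
  by apply: le_trans (ler_norm_sum _ _ _) _; apply: ler_sum => i _.
rewrite mulrC mulrA mulrC [H * 2]mulrC; apply: drift_bound => //.
- by rewrite mulr_ge0.
- by move=> i j; apply: partial_sub_bound.
- by move=> bt i j ij; apply: partial_add_bound => //; exact: sf.
move=> bt i; apply: le_trans (partial_flip_bound fC2 bH _ _ (sf bt)) _.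
by rewrite ler_wpM2r// ler_peMl// ler1n.
Qed.

Lemma compact_support_bounded (f : V -> R) : continuous f -> compact_support f ->
  exists2 K : R, 0 <= K & forall y, `|f y| <= K.
Proof.
move=> cf [M hM]; have [K K0 hK] := continuous_box_bounded M cf.
exists K => // y; have [/hM ->|yM] := ltP M `|y|; first by rewrite normr0.
by apply: hK => i; exact: le_trans (ler_coord_norm _ _) yM.
Qed.

Lemma partial_compact_support (f : V -> R) i (M : R) :
  (forall y, M < `|y| -> f y = 0) -> forall y, M < `|y| -> partial i f y = 0.
Proof.
move=> hM y My; rewrite /partial (@near_eq_derive _ _ _ _ (fun=> 0)).
  exact: derive_cst.
near=> z; apply: hM; near: z.
by move: My; apply: (cvgr_gt (f := fun z : V => `|z|)); exact: (@norm_continuous R V y).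
Unshelve. all: by end_near.
Qed.

Lemma dom_hessian_bounded b f : dom b f ->
  exists2 H : R, 0 <= H & forall i j y, `|partial j (partial i f) y| <= H.
Proof.
move=> [fC2 [M hM] _ _].
have /choice[K hK] (p : 'I_N * 'I_N) : exists K : R,
    0 <= K /\ forall y, `|partial p.2 (partial p.1 f) y| <= K.
  have [||K K0 hK] := @compact_support_bounded (partial p.2 (partial p.1 f)).
  - by have [_ /(_ p.1 p.2)[_ [_ []]]] := fC2.
  - by exists M; do 2 apply: partial_compact_support.
  - by exists K.
exists (\sum_p K p); first by apply: sumr_ge0 => p _; exact: (hK p).1.
move=> i j y; apply: le_trans ((hK (i, j)).2 y) _.
by rewrite (bigD1 (i, j))//= lerDl; apply: sumr_ge0 => p _; exact: (hK p).1.
Qed.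

Lemma continuous_coord i : continuous (fun y : V => y ord0 i).
Proof. by move=> y; exact: coord_continuous. Qed.

Lemma gen_continuous ker b k1 k2 f : C2 f -> continuous ker ->
  continuous (gen ker b k1 k2 f).
Proof.
move=> [_ fC2] ck; rewrite /gen.
have c1 i : continuous (partial i f) by have [_ []] := fC2 i i.
have c2 i : continuous (partial i (partial i f)) by have [_ [_ []]] := fC2 i i.
have cc (i : 'I_N) : continuous (fun y : V => y ord0 i) by exact: continuous_coord.
have cst (a : R) : continuous (fun _ : V => a) by exact: cst_continuous.
apply: continuous_add; first by apply: (continuous_mul (cst _)); apply: continuous_bigsum.
apply: continuous_add; apply: (continuous_mul (cst _)).
  apply: continuous_bigsum => i _; apply: continuous_bigsum => j _.
  apply: continuous_mul => //; apply: continuous_add.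
    by apply: continuous_fcomp => //; exact: continuous_sub.
  apply: (continuous_mul (cst _)).
  by apply: continuous_fcomp => //; exact: continuous_add.
apply: continuous_bigsum => i _; apply: continuous_mul => //.
exact: continuous_fcomp.
Qed.

Lemma gen_compact_support ker b k1 k2 f : compact_support f ->
  compact_support (gen ker b k1 k2 f).
Proof.
move=> [M hM]; exists M => y My.
have p1 i : partial i f y = 0 by exact: partial_compact_support My.
have p2 i : partial i (partial i f) y = 0.
  by apply: (@partial_compact_support _ i M) => // z; exact: partial_compact_support.
rewrite /gen /drift /laplacian big1 ?mulr0 ?add0r// !big1 ?mulr0 ?addr0// => i _.
  by rewrite p1 mulr0.
by rewrite big1// => j _; rewrite p1 mulr0.
Qed.

Lemma cvg_gen_rker b k1 k2 f y :
  (fun n => gen (rker n.+1%:R^-1) b k1 k2 f y) @ \oo --> gen GRing.inv b k1 k2 f y.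
Proof.
apply: cvgD; first exact: cvg_cst.
apply: cvgD; apply: cvgM; try exact: cvg_cst.
  apply: cvg_bigsum => i _; apply: cvg_bigsum => j _.
  apply: cvgM; last exact: cvg_cst.
  apply: cvgD; first exact: cvg_rker.
  by apply: cvgM; [exact: cvg_cst|exact: cvg_rker].
by apply: cvg_bigsum => i _; apply: cvgM; [exact: cvg_rker|exact: cvg_cst].
Qed.

End Generator.

(** * Measurability for the coordinate sigma-algebra *)

Section Measurability.
Variables (R : realType) (N : nat).
Local Notation V := 'rV[R]_N.

Lemma measurable_coord i : measurable_fun [set: V] (fun y : V => y ord0 i).
Proof.
move=> _ Y mY; rewrite setTI; apply: sub_sigma_algebra => /=.
rewrite -bigcup_seq/=; exists i => /=; first by rewrite mem_index_enum.
by exists Y => //; rewrite setTI.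
Qed.

Lemma measurable_hornerV (p : {poly R}) i :
  measurable_fun [set: V] (fun y : V => p.[y ord0 i]).
Proof.
under eq_fun do rewrite horner_coef.
apply: measurable_sum => j; apply: measurable_funM; first exact: measurable_cst.
exact: measurable_funX (measurable_coord i).
Qed.

Lemma measurable_bernV (L : R) n J : measurable_fun [set: V] (@bernV R N L n J).
Proof. by apply: measurable_prod => i _; exact: measurable_hornerV. Qed.

(** The sigma-algebra is generated by the coordinates and not by the open sets. A continuous
    function is the pointwise limit of its Bernstein polynomials on growing boxes, and these are
    polynomials in the coordinates. *)
Lemma measurable_continuous (h : V -> R) : continuous h -> measurable_fun [set: V] h.
Proof.
move=> ch.
have /choice[n hn] (k : nat) : exists n, (0 < n)%N /\ forall (y0 y : V) (v : {ffun 'I_N -> 'I_n.+1} -> V),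
    box k.+1%:R y0 -> box k.+1%:R y -> (forall J, box k.+1%:R (v J)) ->
    (forall J i, (y0 ord0 i - v J ord0 i) ^+ 2 <= psum 2 (y - bern_node k.+1%:R J)) ->
    `|h y0 - \sum_J h (v J) * bernV k.+1%:R J y| <= k.+1%:R^-1.
  by apply: bernV_approx.
pose F k y := \sum_(J : {ffun 'I_N -> 'I_(n k).+1}) h (bern_node k.+1%:R J) * bernV k.+1%:R J y.
apply: (@measurable_fun_cvg _ _ _ _ F) => [k|y _].
  apply: measurable_sum => J; apply: measurable_funM; first exact: measurable_cst.
  exact: measurable_bernV.
apply/cvgrPdist_le => e e0; near=> k.
have [n0 /(_ y y (@bern_node _ _ k.+1%:R (n k)))] := hn k.
have bk : box k.+1%:R y.
  move=> i; apply: le_trans (ler_coord_norm _ _) _; rewrite -natr1 ler_wpDr//.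
  by near: k; exact: nbhs_infty_ger.
move=> /(_ bk bk) h1; apply: le_trans (h1 _ _) _.
- by move=> J; exact: bern_node_box.
- by move=> J i; apply: le_trans (ler_sqr_psum2 _ i); rewrite !mxE.
near: k; have := @cvg_harmonic R => /cvgrPdist_le/(_ _ e0).
apply: filterS => k; rewrite sub0r normrN ger0_norm//; exact: harmonic_ge0.
Unshelve. all: by end_near.
Qed.

Lemma measurable_chamber b : measurable (@chamber R N b).
Proof.
have mle (f g : V -> R) : measurable_fun setT f -> measurable_fun setT g ->
    measurable [set y : V | f y <= g y].
  move=> mf mg; have := measurable_fun_ler mf mg.
  move=> /(_ measurableT [set true]); rewrite setTI; apply.
  by [].
have E (A : 'I_N -> 'I_N -> set V) : (forall i j, measurable (A i j)) ->
    measurable [set y : V | forall i j : 'I_N, (i <= j)%N -> A i j y].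
  move=> mA; pose B (p : 'I_N * 'I_N) := if (p.1 <= p.2)%N then A p.1 p.2 else setT.
  rewrite (_ : [set y | _] = \bigcap_(p in [set: 'I_N * 'I_N]) B p).
    apply: fin_bigcap_measurable; first exact: finite_finset.
    by move=> p _; rewrite /B; case: ifP.
  apply/seteqP; split=> y /= hy.
    by move=> [i j] _; rewrite /B/=; case: ifP => // ij; exact: hy.
  by move=> i j ij; have := hy (i, j) I; rewrite /B/= ij.
have m1 i j : measurable [set y : V | y ord0 j <= y ord0 i].
  by apply: mle; exact: measurable_coord.
case: b; last exact: (E (fun i j => [set y : V | y ord0 j <= y ord0 i])).
apply: (E (fun i j => [set y : V | y ord0 j <= y ord0 i /\ 0 <= y ord0 j])) => i j.
rewrite (_ : [set y | _] = [set y : V | y ord0 j <= y ord0 i] `&` [set y : V | 0 <= y ord0 j])//.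
apply: measurableI => //; apply: mle; [exact: measurable_cst|exact: measurable_coord].
Qed.

End Measurability.

(** * Expectations under a law carried by a set *)

Section Expectation.
Context d (T : measurableType d) (R : realType) (P : probability T R) (S : set T).
Hypotheses (mS : measurable S) (PS : P (~` S) = 0%E).
Implicit Types h : T -> R.

Lemma eintegrable_le h q : measurable_fun setT h -> P.-integrable setT (EFin \o q) ->
  (forall y, S y -> `|h y| <= q y) -> P.-integrable setT (EFin \o h).
Proof.
move=> mh iq hq; have mC : measurable (~` S) by exact: measurableC.
apply/(negligible_integrable mC) => //; first exact/measurable_EFinP.
have mD : measurable ([set: T] `\` ~` S) by exact: measurableD.
apply: (le_integrable mD _ _ (integrableS measurableT mD (@subsetT _ _) iq)) => //.
  by apply/measurable_EFinP; exact: measurable_funS mh.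
move=> y [_ /contrapT Sy] /=; rewrite lee_fin.
by apply: le_trans (hq _ Sy) _; exact: ler_norm.
Qed.

Lemma eRintegralE h : P.-integrable setT (EFin \o h) ->
  Rintegral P setT h = Rintegral P S h.
Proof.
move=> ih; rewrite /Rintegral (negligible_integral (measurableC mS))//.
by rewrite setDE setCK setTI.
Qed.

Lemma eintegrable_cst (K : R) : P.-integrable setT (EFin \o (fun=> K)).
Proof. exact: finite_measure_integrable_cst. Qed.

Lemma eintegrable_bounded h K : measurable_fun setT h ->
  (forall y, S y -> `|h y| <= K) -> P.-integrable setT (EFin \o h).
Proof. by move=> mh hK; apply: eintegrable_le hK => //; exact: eintegrable_cst. Qed.

Lemma expect_cst (K : R) : Rintegral P setT (fun=> K) = K.
Proof. by rewrite Rintegral_cst//= probability_setT mulr1. Qed.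

Lemma expect_le f g : P.-integrable setT (EFin \o f) -> P.-integrable setT (EFin \o g) ->
  (forall y, S y -> f y <= g y) -> Rintegral P setT f <= Rintegral P setT g.
Proof.
move=> i1 i2 fg; rewrite !eRintegralE//; apply: le_Rintegral => //.
- exact: integrableS i1.
- exact: integrableS i2.
Qed.

Lemma expect_normr_le f g : P.-integrable setT (EFin \o f) -> P.-integrable setT (EFin \o g) ->
  (forall y, S y -> `|f y| <= g y) -> `|Rintegral P setT f| <= Rintegral P setT g.
Proof.
move=> i1 i2 fg; rewrite ler_norml; apply/andP; split.
  have -> : - Rintegral P setT g = Rintegral P setT (fun y => (-1) * g y).
    by rewrite RintegralZl// mulN1r.
  apply: expect_le => //; last by move=> y /fg; rewrite ler_norml mulN1r => /andP[].
  by have := integrableZl measurableT (-1) i2; apply: eq_integrable.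
by apply: expect_le => // y /fg; rewrite ler_norml => /andP[].
Qed.

(** Convergence and domination are asked on the carrier only, because the polynomial approximation
    of test functions is available only on the chamber. *)
Lemma expect_dominated (h_ : nat -> T -> R) h q :
  (forall n, measurable_fun setT (h_ n)) -> measurable_fun setT h ->
  (forall y, S y -> (fun n => h_ n y) @ \oo --> h y) ->
  P.-integrable setT (EFin \o q) -> (forall n y, S y -> `|h_ n y| <= q y) ->
  P.-integrable setT (EFin \o h) /\
  (fun n => Rintegral P setT (h_ n)) @ \oo --> Rintegral P setT h.
Proof.
move=> mh_ mh ch iq hq.
have iS f : P.-integrable setT (EFin \o f) -> P.-integrable S (EFin \o f).
  by move=> i1; exact: integrableS i1.
have [] := @dominated_convergence _ _ _ P S mS (fun n => EFin \o h_ n) (EFin \o h) (EFin \o q).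
- by move=> n; apply/measurable_EFinP; exact: measurable_funS (mh_ n).
- by apply/measurable_EFinP; exact: measurable_funS mh.
- by apply: aeW => y Sy; apply: cvg_EFin; [exact: nearW|exact: ch].
- exact: iS.
- by apply: aeW => y n Sy; rewrite /= lee_fin hq.
move=> i1 _ c.
have hq' y : S y -> `|h y| <= q y.
  move=> Sy; have := ch _ Sy => /cvg_norm c'.
  rewrite -(cvg_lim _ c')//; apply: limr_le; first by apply/cvg_ex; eexists; exact: c'.
  by apply: nearW => n; exact: hq.
have i2 : P.-integrable setT (EFin \o h) by exact: eintegrable_le hq'.
have i3 n : P.-integrable setT (EFin \o h_ n) by apply: eintegrable_le (hq n).
split=> //; rewrite eRintegralE//.
under eq_fun do rewrite eRintegralE//.
apply: fine_cvg; rewrite fineK//.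
by apply: integrable_fin_num => //; exact: iS.
Qed.

(** Serves to remove the cutoff from bounds on truncated moments, at a stage where no integrable
    dominating function is known. *)
Lemma expect_fatou (h_ : nat -> T -> R) h (C : R) :
  (forall n, P.-integrable setT (EFin \o h_ n)) -> (forall n y, 0 <= h_ n y) ->
  measurable_fun setT h -> (forall y, (fun n => h_ n y) @ \oo --> h y) ->
  (forall n, Rintegral P setT (h_ n) <= C) ->
  P.-integrable setT (EFin \o h) /\ Rintegral P setT h <= C.
Proof.
move=> ih h0 mh ch hC.
have hh0 y : 0 <= h y.
  rewrite -(cvg_lim _ (ch y))//; apply: limr_ge; first by apply/cvg_ex; eexists; exact: ch.
  exact: nearW.
have key : (\int[P]_y (h y)%:E <= C%:E)%E.
  have h_0 n y : setT y -> (0 <= (EFin \o h_ n) y)%E by rewrite /= lee_fin.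
  have := @fatou _ _ _ P setT measurableT (fun n => EFin \o h_ n) (fun n => measurable_int P (ih n)) h_0.
  have -> : (\int[P]_y limn_einf (fun n => (h_ n y)%:E) = \int[P]_y (h y)%:E)%E.
    apply: eq_integral => y _; apply: (@cvg_limn_einf_sup _ _ (h y)%:E _).1.
    by apply: cvg_EFin; [exact: nearW|exact: ch].
  move=> /le_trans; apply; rewrite limn_einf_lim; apply: lime_le; first exact: is_cvg_einfs.
  apply: nearW => n; apply: (@le_trans _ _ (\int[P]_y (h_ n y)%:E)%E).
    by apply: ereal_inf_lbound; exists n => //=.
  have := hC n; rewrite /Rintegral -lee_fin fineK//.
  exact: (integrable_fin_num measurableT (ih n)).
have ih' : P.-integrable setT (EFin \o h).
  apply/integrableP; split; first exact/measurable_EFinP.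
  rewrite (eq_integral (fun y => (h y)%:E)); first exact: le_lt_trans key (ltry _).
  by move=> y _; rewrite /= ger0_norm.
split=> //; rewrite -lee_fin /Rintegral fineK//.
exact: (integrable_fin_num measurableT ih').
Qed.

End Expectation.

(** * Measurability in time *)

Section TimeMeasurability.
Variable R : realType.
Local Notation leb := (@lebesgue_measure R).

Lemma emeasurable_nondecreasing (D : set R) (A : R -> \bar R) : measurable D ->
  {homo A : s t / s <= t >-> (s <= t)%E} -> measurable_fun D A.
Proof.
move=> mD hA; apply: (measurability (@ErealGenCInfty.G R)) => [|/= _ [_] [r] -> <-].
  exact: ErealGenCInfty.measurableE.
apply: measurableI => //; apply: is_interval_measurable => s t/=.
rewrite !in_itv/= !andbT => fs ft u /andP[su ut].
by rewrite in_itv/= andbT (le_trans fs)// hA.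
Qed.

(* The integrand [u] need not be measurable: its integral is then a difference of
   suprema of integrals of simple functions, each of which is monotone in [t]. *)
Lemma measurable_Rintegral_itv (u : R -> R) (D : set R) : measurable D ->
  measurable_fun D (fun t => Rintegral leb `[0, t]%classic u).
Proof.
move=> mD.
have mono (v : R -> \bar R) : (forall x, 0 <= v x)%E ->
    measurable_fun D (fun t => \int[leb]_(x in `[0%R, t]) v x)%E.
  move=> v0; apply: emeasurable_nondecreasing => // s t st.
  rewrite [leLHS]integral_mkcond [leRHS]integral_mkcond !ge0_integralTE; last 2 first.
  - by move=> x; rewrite patchE; case: ifP.
  - by move=> x; rewrite patchE; case: ifP.
  apply: le_ereal_sup => _ [h /= hv <-]; exists h => //= x.
  apply: le_trans (hv x) _; rewrite !patchE; case: ifPn => [|_]; last by case: ifP.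
  rewrite inE /= in_itv/= => /andP[x0 xs]; rewrite mem_set//=.
  by rewrite in_itv/= x0 (le_trans xs).
apply: measurableT_comp; first exact: fine_measurable.
under eq_fun do rewrite integralE.
by apply: emeasurable_funB; apply: mono => x.
Qed.

End TimeMeasurability.

(** * Derivatives of power sums and the degree-lowering operators *)

Section PowerSumCalculus.
Variables (R : realType) (N : nat).
Local Notation V := 'rV[R]_N.

Definition mapw (w : R -> R) (y : V) : V := \row_i w (y ord0 i).

(** The gradient of [pprod s], by the product rule along the list. The truncated exponent [m.-1] is
    harmless at [m = 0], where its coefficient is 0. *)
Fixpoint gpp (s : seq nat) (i : 'I_N) (y : V) : R :=
  if s is m :: s' then psum m y * gpp s' i y + pprod s' y * (m%:R * y ord0 i ^+ m.-1)
  else 0.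

(** The Hessian of [pprod s]; truncated exponents again come with a vanishing coefficient. *)
Fixpoint hpp (s : seq nat) (i j : 'I_N) (y : V) : R :=
  if s is m :: s' then
    psum m y * hpp s' i j y
    + pprod s' y * ((i == j)%:R * (m%:R * (m.-1%:R * y ord0 i ^+ m.-2)))
    + (m%:R * y ord0 j ^+ m.-1 * gpp s' i y + m%:R * y ord0 i ^+ m.-1 * gpp s' j y)
  else 0.

Lemma is_derive_exprn m (x : R) : is_derive x 1 (fun x : R => x ^+ m) (m%:R * x ^+ m.-1).
Proof.
apply: DeriveDef; first exact: exprn_derivable.
by rewrite exp_derive -[_ *: 1]/(_ * 1) mulr1.
Qed.

Lemma is_derive_mul (f g : R -> R) (x df dg : R) : is_derive x 1 f df -> is_derive x 1 g dg ->
  is_derive x 1 (fun u => f u * g u) (f x * dg + g x * df).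
Proof.
move=> h1 h2; have -> : (fun u => f u * g u) = f * g by [].
exact: is_deriveM.
Qed.

Lemma is_derive_mulr (f : R -> R) (x c d : R) : is_derive x 1 f d ->
  is_derive x 1 (fun u => c * f u) (c * d).
Proof.
move=> fd; apply: is_derive_eq (is_derive_mul (is_derive_cst c x 1) fd) _.
by rewrite mulr0 addr0.
Qed.

Lemma is_derive_comp (f g : R -> R) (x a b : R) :
  is_derive (g x) 1 f a -> is_derive x 1 g b -> is_derive x 1 (fun u => f (g u)) (a * b).
Proof. by move=> h1 h2; exact: (@is_derive1_comp R f g). Qed.

Section CoordinateChange.
Variables (w dw ddw : R -> R).
Hypotheses (hw : forall x : R, is_derive x 1 w (dw x))
  (hdw : forall x : R, is_derive x 1 dw (ddw x)) (cddw : continuous ddw).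

Let cw : continuous w.
Proof. by move=> x; apply: differentiable_continuous; apply/derivable1_diffP; case: (hw x). Qed.

Let cdw : continuous dw.
Proof. by move=> x; apply: differentiable_continuous; apply/derivable1_diffP; case: (hdw x). Qed.

Lemma jet2_psum_mapw m : jet2 (fun y : V => psum m (mapw w y))
  (fun i y => m%:R * w (y ord0 i) ^+ m.-1 * dw (y ord0 i))
  (fun i j y => (i == j)%:R * (m%:R * (m.-1%:R * w (y ord0 i) ^+ m.-2) * dw (y ord0 i) ^+ 2
                  + m%:R * w (y ord0 i) ^+ m.-1 * ddw (y ord0 i))).
Proof.
have dwX n (x : R) : is_derive x 1 (fun u => w u ^+ n) (n%:R * w x ^+ n.-1 * dw x).
  exact: (is_derive_comp (is_derive_exprn n (w x)) (hw x)).
have cX n : continuous (fun u => w u ^+ n).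
  by move=> x; apply: (@continuous_comp _ _ _ w (fun v => v ^+ n)); [exact: cw|exact: exprn_continuous].
have jk (k : 'I_N) := jet2_comp (jet2_coord R k) (phi := fun u => w u ^+ m)
   (dphi := fun u => m%:R * (w u ^+ m.-1 * dw u))
   (ddphi := fun u => m%:R * (w u ^+ m.-1 * ddw u + dw u * (m.-1%:R * w u ^+ m.-2 * dw u))).
have cst (a : R) : continuous (fun _ : R => a) by exact: cst_continuous.
have jk' k := jk k _ _ _.
have {jk jk'}jk (k : 'I_N) : jet2 (fun y : V => w (y ord0 k) ^+ m)
    (fun i y => m%:R * (w (y ord0 k) ^+ m.-1 * dw (y ord0 k)) * (k == i)%:R)
    (fun i j y => (k == i)%:R * (m%:R * (w (y ord0 k) ^+ m.-1 * ddw (y ord0 k) +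
       dw (y ord0 k) * (m.-1%:R * w (y ord0 k) ^+ m.-2 * dw (y ord0 k))) * (k == j)%:R)).
  apply: jet2_ext (jk k _ _ _) => //.
  - by move=> i j y; rewrite mulr0 add0r.
  - by move=> x; apply: is_derive_eq (dwX m x) _; ring.
  - move=> x; apply: is_derive_mulr.
    exact: (is_derive_mul (dwX m.-1 x) (hdw x)).
  apply: (continuous_mul (cst _)); apply: continuous_add; apply: continuous_mul => //.
  by apply: continuous_mul => //; apply: (continuous_mul (cst _)).
apply: jet2_ext (jet2_sum (index_enum 'I_N) (fun k _ => jk k)) => [y|i y|i j y].
- by apply: eq_bigr => k _; rewrite mxE.
- rewrite (bigD1 i)//= eqxx big1 ?addr0 ?mulr1 ?mulrA// => k /negbTE ->.
  by rewrite mulr0.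
rewrite (bigD1 i)//= eqxx big1 ?addr0; last by move=> k /negbTE ->; rewrite mul0r.
by rewrite mul1r; ring.
Qed.

Lemma jet2_pprod_mapw s : jet2 (fun y : V => pprod s (mapw w y))
  (fun i y => gpp s i (mapw w y) * dw (y ord0 i))
  (fun i j y => hpp s i j (mapw w y) * (dw (y ord0 i) * dw (y ord0 j))
              + (i == j)%:R * (gpp s i (mapw w y) * ddw (y ord0 i))).
Proof.
elim: s => [|m s IH].
  apply: jet2_ext (jet2_cst N 1) => [y|i y|i j y] /=; first by rewrite pprod_nil.
    by rewrite mul0r.
  by rewrite !mul0r mulr0 addr0.
apply: jet2_ext (jet2M (jet2_psum_mapw m) IH) => [y|i y|i j y] /=.
- by rewrite pprod_cons.
- by rewrite !mxE; ring.
rewrite !mxE; case: eqVneq => [->|_] /=; ring.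
Qed.

End CoordinateChange.

Lemma mapw_id y : mapw id y = y.
Proof. by apply: row_ext => l; rewrite mxE. Qed.

Lemma jet2_pprod s : jet2 (@pprod R N s) (gpp s) (hpp s).
Proof.
have d1 (x : R) : is_derive x 1 id ((fun=> 1 : R) x) by exact: is_derive_id.
have d2 (x : R) : is_derive x 1 (fun _ : R => 1 : R) ((fun=> 0 : R) x) by exact: is_derive_cst.
have c : continuous (fun _ : R => 0 : R) by exact: cst_continuous.
apply: jet2_ext (jet2_pprod_mapw d1 d2 c s) => [y|i y|i j y]; rewrite mapw_id//.
  by rewrite mulr1.
by rewrite mulr0 mulr0 addr0 !mulr1.
Qed.

Definition wlt d (s : seq nat) := (sumn s < d)%N.

Lemma sympoly_mulp d s F : sympoly (wlt d) F ->
  sympoly (wlt (sumn s + d)) (fun y : V => pprod s y * F y).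
Proof.
apply: (@sympolyM _ _ _ (fun t => t == s)) => [_ t /eqP -> |]; last exact: sympoly_pprod.
by rewrite /wlt sumn_cat ltn_add2l.
Qed.

Lemma sympoly_wle d d' (F : V -> R) : (d <= d')%N -> sympoly (wlt d) F -> sympoly (wlt d') F.
Proof. by move=> dd; apply: sympoly_sub => s sd; exact: leq_trans dd. Qed.

Lemma pprod1 m (y : V) : pprod [:: m] y = psum m y.
Proof. by rewrite pprod_cons pprod_nil mulr1. Qed.

Lemma sympoly_psum d m : (m < d)%N -> sympoly (wlt d) (@psum R N m).
Proof.
move=> md; apply: sympoly_ext (pprod1 m) _; apply: sympoly_pprod.
by rewrite /wlt /= addn0.
Qed.

(** Differentiation lowers the weight by one, whence the strict inequality in [wlt]. *)
Lemma sympoly_gpp q s :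
  sympoly (wlt (q + sumn s)) (fun y : V => \sum_(i < N) y ord0 i ^+ q * gpp s i y).
Proof.
elim: s => [|n s IH].
  by apply: sympoly_ext (sympoly0 _ _ _) => y; rewrite big1// => i _; rewrite /= mulr0.
apply: (@sympoly_ext _ _ _ (fun y => pprod [:: n] y * \sum_(i < N) y ord0 i ^+ q * gpp s i y +
    n%:R * (pprod s y * psum (q + n.-1) y))).
  move=> y; rewrite pprod1 [psum (q + _) y]/psum !mulr_sumr -big_split/=.
  by apply: eq_bigr => i _; rewrite exprD; ring.
apply: sympolyD.
  by apply: sympoly_sub (sympoly_mulp [:: n] IH) => t; rewrite /wlt/= addn0 addnCA.
case: n => [|n]; first by apply: sympoly_ext (sympoly0 _ _ _) => y; rewrite mul0r.
apply: sympolyZ; apply: sympoly_sub (sympoly_mulp s (sympoly_psum (ltnSn _))) => t.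
by rewrite /wlt/= -addnS addnC -addnA.
Qed.

Definition distinct (y : V) := forall i j : 'I_N, i != j -> y ord0 i != y ord0 j.

(** Symmetrization turns the quotient into half of [(y_i ^ n - y_j ^ n) / (y_i - y_j)], a geometric
    sum of weight [n - 1]. The missing diagonal terms are added to form products of power sums, then
    subtracted. *)
Lemma sympoly_quotient n : exists F, sympoly (wlt n) F /\ forall y : V, distinct y ->
  \sum_(i < N) \sum_(j < N | j != i) y ord0 i ^+ n / (y ord0 i - y ord0 j) = F y.
Proof.
case: n => [|n].
  exists (fun=> 0); split; first exact: sympoly0.
  move=> y dy; have := @sum_offdiagC R N (fun i j => (y ord0 i - y ord0 j)^-1) (fun=> 1).
  under eq_bigr do under eq_bigr do rewrite mulr1 -[_^-1]mul1r.
  under [X in _ = _ * X]eq_bigr => i _.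
    under eq_bigr => j ij do rewrite !mulr1 -[y ord0 j - _]opprB invrN subrr.
    rewrite big1//; over.
  rewrite [X in 2^-1 * X]big1 ?mulr0// => <-; apply: eq_bigr => i _; apply: eq_bigr => j _.
exists (fun y => 2^-1 * \sum_(l < n.+1) (pprod [:: (n - l)%N; l : nat] y + (-1) * psum n y)).
split.
  apply: sympolyZ; apply: sympoly_sum => l _; apply: sympolyD.
    by apply: sympoly_pprod; rewrite /wlt/= addn0 subnK// -ltnS.
  by apply: sympolyZ; apply: sympoly_psum.
move=> y dy.
transitivity (2^-1 * \sum_(i < N) \sum_(j < N | j != i)
    ((y ord0 i - y ord0 j)^-1 * y ord0 i ^+ n.+1 + (y ord0 j - y ord0 i)^-1 * y ord0 j ^+ n.+1)).
  rewrite -(sum_offdiagC (fun i j => (y ord0 i - y ord0 j)^-1) (fun i => y ord0 i ^+ n.+1)).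
  by apply: eq_bigr => i _; apply: eq_bigr => j _; rewrite mulrC.
congr (_ * _).
transitivity (\sum_(i < N) \sum_(j < N | j != i) \sum_(l < n.+1) (y ord0 i ^+ (n - l) * y ord0 j ^+ l)).
  apply: eq_bigr => i _; apply: eq_bigr => j ji.
  have nz : y ord0 i - y ord0 j != 0 by rewrite subr_eq0 dy// eq_sym.
  rewrite -[y ord0 j - _]opprB invrN mulNr -mulrBr subrXX mulKf//.
have E i : \sum_(j < N | j != i) \sum_(l < n.+1) (y ord0 i ^+ (n - l) * y ord0 j ^+ l) =
   \sum_(j < N) \sum_(l < n.+1) (y ord0 i ^+ (n - l) * y ord0 j ^+ l) -
   \sum_(l < n.+1) y ord0 i ^+ n.
  rewrite [in RHS](bigD1 i)//= addrAC; set B := \sum_(l < _) _; set C := \sum_(l < _) _.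
  suff -> : B = C by rewrite subrr add0r.
  by apply: eq_bigr => l _; rewrite -exprD subnK// -ltnS.
under eq_bigr do rewrite E.
rewrite sumrB big_split/= -[X in _ + X]mulN1r; congr (_ + _).
  under eq_bigr do rewrite exchange_big/=.
  rewrite exchange_big/=; apply: eq_bigr => l _.
  by rewrite pprod_cons pprod1 /psum mulr_suml; apply: eq_bigr => i _; rewrite mulr_sumr.
by rewrite exchange_big/= -mulr_sumr.
Qed.

(* [opO] covers, for suitable [a], [e] and [beta], the three homogeneous parts of the
   type B generator in the variables [(y_i ^ 2 - b) / c]. *)
Definition opO (a : R) (e : nat) (beta k : R) (s : seq nat) (y : V) : R :=
  \sum_(i < N) a * y ord0 i ^+ e * hpp s i i y + beta * \sum_(i < N) gpp s i y +
  2 * k * \sum_(i < N) \sum_(j < N | j != i)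
     a * y ord0 i ^+ e * gpp s i y / (y ord0 i - y ord0 j).

(** Product rule for a second-order operator: the last term pairs the gradients of the two factors.
    Its factor [2 * a] reflects that [opO] has second-order coefficient [a], without one half. *)
Lemma opO_cons a e beta k m s y : opO a e beta k (m :: s) y =
  psum m y * opO a e beta k s y + pprod s y * opO a e beta k [:: m] y +
  2 * a * m%:R * \sum_(i < N) y ord0 i ^+ (e + m.-1) * gpp s i y.
Proof.
rewrite /opO /= pprod_nil.
set S1 := \sum_(i < N) _ * _ * hpp s i i y; set S2 := \sum_(i < N) gpp s i y.
set S3 := \sum_(i < N) \sum_(j < N | _) _ * gpp s i y / _.
set S4 := \sum_(i < N) y ord0 i ^+ _ * _.
have -> : \sum_(i < N) a * y ord0 i ^+ e * (psum m y * hpp s i i y +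
    pprod s y * ((i == i)%:R * (m%:R * (m.-1%:R * y ord0 i ^+ m.-2))) +
    (m%:R * y ord0 i ^+ m.-1 * gpp s i y + m%:R * y ord0 i ^+ m.-1 * gpp s i y)) =
  psum m y * S1 + pprod s y * (\sum_(i < N) a * y ord0 i ^+ e *
    (psum m y * 0 + 1 * ((i == i)%:R * (m%:R * (m.-1%:R * y ord0 i ^+ m.-2))) +
    (m%:R * y ord0 i ^+ m.-1 * 0 + m%:R * y ord0 i ^+ m.-1 * 0))) + 2 * a * m%:R * S4.
  rewrite /S1 /S4 !mulr_sumr -!big_split/=; apply: eq_bigr => i _.
  by rewrite exprD; ring.
have -> : \sum_(i < N) (psum m y * gpp s i y + pprod s y * (m%:R * y ord0 i ^+ m.-1)) =
  psum m y * S2 + pprod s y * \sum_(i < N) (psum m y * 0 + 1 * (m%:R * y ord0 i ^+ m.-1)).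
  rewrite /S2 !mulr_sumr -!big_split/=; apply: eq_bigr => i _; ring.
have -> : \sum_(i < N) \sum_(j < N | j != i) a * y ord0 i ^+ e *
    (psum m y * gpp s i y + pprod s y * (m%:R * y ord0 i ^+ m.-1)) / (y ord0 i - y ord0 j) =
  psum m y * S3 + pprod s y * \sum_(i < N) \sum_(j < N | j != i) a * y ord0 i ^+ e *
    (psum m y * 0 + 1 * (m%:R * y ord0 i ^+ m.-1)) / (y ord0 i - y ord0 j).
  rewrite /S3 !mulr_sumr -!big_split/=; apply: eq_bigr => i _.
  rewrite !mulr_sumr -!big_split/=; apply: eq_bigr => j _; ring.
ring.
Qed.

(** The second-order and quotient terms change the weight by [e - 2], the gradient term by [-1], so
    for [e <= 1] it strictly decreases. This makes the system of moment equations triangular. *)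
Lemma sympoly_opO a e beta k s : (e <= 1)%N -> exists F, sympoly (wlt (sumn s)) F /\
  forall y : V, distinct y -> opO a e beta k s y = F y.
Proof.
move=> e1; elim: s => [|m s [F [sF hF]]].
  exists (fun=> 0); split; first exact: sympoly0.
  move=> y _; rewrite /opO /= !big1 ?mulr0 ?addr0// => i _; rewrite ?mulr0//.
  by rewrite big1// => j _; rewrite mul0r.
have [G [sG hG]] : exists F, sympoly (wlt m) F /\
    forall y : V, distinct y -> opO a e beta k [:: m] y = F y.
  case: m => [|m].
    exists (fun=> 0); split; first exact: sympoly0.
    move=> y _; rewrite /opO /= pprod_nil.
    rewrite !big1 ?mulr0 ?addr0// => i _; last by rewrite !mul0r !mulr0; ring.
      by rewrite big1// => j _; ring.
    by ring.
  have [F1 [sF1 hF1]] := sympoly_quotient (e + m).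
  exists (fun y => a * m.+1%:R * m%:R * psum (e + m.-1) y + beta * m.+1%:R * psum m y +
     2 * k * a * m.+1%:R * F1 y); split.
    have em : (e + m <= m.+1)%N by rewrite -add1n leq_add2r.
    apply: sympolyD; last by apply: sympolyZ; exact: sympoly_wle sF1.
    apply: sympolyD; last by apply: sympolyZ; exact: sympoly_psum.
    case: m {sF1 hF1} em => [|m] em.
      by apply: sympoly_ext (sympoly0 _ _ _) => y; rewrite mulr0 mul0r.
    by apply: sympolyZ; apply: sympoly_psum; rewrite -addnS.
  move=> y dy; rewrite -hF1// /opO /= pprod_nil; congr (_ + _ + _).
  - rewrite /psum mulr_sumr; apply: eq_bigr => i _; rewrite eqxx exprD /=; ring.
  - rewrite /psum -mulrA; congr (_ * _); rewrite mulr_sumr; apply: eq_bigr => i _; ring.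
  rewrite -!mulrA; congr (_ * (_ * _)); rewrite !mulr_sumr; apply: eq_bigr => i _.
  rewrite !mulr_sumr; apply: eq_bigr => j _; rewrite exprD; ring.
exists (fun y => pprod [:: m] y * F y + pprod s y * G y +
  2 * a * m%:R * \sum_(i < N) y ord0 i ^+ (e + m.-1) * gpp s i y); split; last first.
  by move=> y dy; rewrite opO_cons hF// hG// pprod1.
apply: sympolyD; first apply: sympolyD.
- by apply: sympoly_sub (sympoly_mulp [:: m] sF) => t; rewrite /wlt/= addn0.
- by apply: sympoly_sub (sympoly_mulp s sG) => t; rewrite /wlt/= addnC.
case: m {sG hG G} => [|m]; first by apply: sympoly_ext (sympoly0 _ _ _) => y; rewrite mulr0 mul0r.
apply: sympolyZ; apply: sympoly_wle (sympoly_gpp _ _) => /=.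
by rewrite leq_add2r -add1n leq_add2r.
Qed.

End PowerSumCalculus.

(** * Cutoffs, and the generator on power sums *)

Section Cutoff.
Variables (R : realType) (N : nat).
Local Notation V := 'rV[R]_N.

Definition regular (b : bool) (y : V) : Prop :=
  distinct y /\ (b -> (forall i j : 'I_N, i != j -> y ord0 i + y ord0 j != 0) /\
                      forall i : 'I_N, y ord0 i != 0).

Lemma gen_jet2 ker b k1 k2 (f : V -> R) g h y : jet2 f g h ->
  gen ker b k1 k2 f y = 2^-1 * \sum_(i < N) h i i y + drift ker b k1 k2 (g^~ y) y.
Proof.
move=> jf; rewrite /gen /laplacian; congr (_ * _ + _).
  by apply: eq_bigr => i _; rewrite (jet2_partial2 i i jf).
by rewrite /drift; congr (_ * _ + _ * _); apply: eq_bigr => i _;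
  rewrite ?(jet2_partial i jf)//; apply: eq_bigr => j _.
Qed.

Lemma driftD ker b k1 k2 (a a' : 'I_N -> R) (y : V) :
  drift ker b k1 k2 (fun i => a i + a' i) y = drift ker b k1 k2 a y + drift ker b k1 k2 a' y.
Proof.
rewrite /drift addrACA -!mulrDr -!big_split/=; congr (_ * _ + _ * _); apply: eq_bigr => i _.
  by rewrite -big_split/=; apply: eq_bigr => j _; rewrite mulrDr.
by rewrite mulrDr.
Qed.

Lemma driftZ ker b k1 k2 c (a : 'I_N -> R) (y : V) :
  drift ker b k1 k2 (fun i => c * a i) y = c * drift ker b k1 k2 a y.
Proof.
rewrite /drift mulrDr; congr (_ + _); rewrite [RHS]mulrCA; congr (_ * _).
  rewrite mulr_sumr; apply: eq_bigr => i _; rewrite mulr_sumr; apply: eq_bigr => j _.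
  by ring.
by rewrite mulr_sumr; apply: eq_bigr => i _; ring.
Qed.

Lemma sum_ord_cst (a : R) : \sum_(i < N) a = N%:R * a.
Proof. by rewrite sumr_const card_ord mulr_natl. Qed.

Lemma gen_mul ker b k1 k2 (f f' : V -> R) g g' h h' y : jet2 f g h -> jet2 f' g' h' ->
  gen ker b k1 k2 (fun y => f y * f' y) y =
  f y * gen ker b k1 k2 f' y + f' y * gen ker b k1 k2 f y + \sum_(i < N) g i y * g' i y.
Proof.
move=> j1 j2; rewrite (gen_jet2 _ _ _ _ _ (jet2M j1 j2)) (gen_jet2 _ _ _ _ _ j1).
rewrite (gen_jet2 _ _ _ _ _ j2) driftD !driftZ.
have -> : \sum_(i < N) (f y * h' i i y + f' y * h i i y + (g i y * g' i y + g i y * g' i y)) =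
  f y * \sum_(i < N) h' i i y + f' y * \sum_(i < N) h i i y + 2 * \sum_(i < N) g i y * g' i y.
  by rewrite !mulr_sumr -!big_split/=; apply: eq_bigr => i _; ring.
by field.
Qed.

Definition radial (phi : R -> R) (y : V) : R := phi (psum 2 y).

Lemma jet2_psum2 : jet2 (@psum R N 2) (fun i y => 2 * y ord0 i) (fun i j y => (i == j)%:R * 2).
Proof.
apply: jet2_ext (jet2_pprod R N [:: 2%N]) => [y|i y|i j y]; first exact: pprod1.
  by rewrite /= pprod_nil expr1; ring.
by rewrite /= pprod_nil expr0; ring.
Qed.

Lemma jet2_radial (phi dphi ddphi : R -> R) :
  (forall x : R, is_derive x 1 phi (dphi x)) -> (forall x : R, is_derive x 1 dphi (ddphi x)) ->
  continuous ddphi ->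
  jet2 (radial phi) (fun i y => dphi (psum 2 y) * (2 * y ord0 i))
    (fun i j y => dphi (psum 2 y) * ((i == j)%:R * 2) +
                  2 * y ord0 i * (ddphi (psum 2 y) * (2 * y ord0 j))).
Proof. by move=> h1 h2 c; exact: jet2_comp jet2_psum2 h1 h2 c. Qed.

Lemma gen_radial ker b k1 k2 (phi dphi ddphi : R -> R) y :
  (forall x : R, is_derive x 1 phi (dphi x)) -> (forall x : R, is_derive x 1 dphi (ddphi x)) ->
  continuous ddphi ->
  gen ker b k1 k2 (radial phi) y =
  N%:R * dphi (psum 2 y) + 2 * psum 2 y * ddphi (psum 2 y)
  + 2 * dphi (psum 2 y) * drift ker b k1 k2 (fun i => y ord0 i) y.
Proof.
move=> h1 h2 c; rewrite (gen_jet2 _ _ _ _ _ (jet2_radial h1 h2 c)).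
rewrite driftZ driftZ; set dd := ddphi _; set d := dphi _; set D := drift _ _ _ _ _ _.
have -> : \sum_(i < N) (d * ((i == i)%:R * 2) + 2 * y ord0 i * (dd * (2 * y ord0 i))) =
    N%:R * (2 * d) + 4 * dd * psum 2 y.
  rewrite /psum mulr_sumr -sum_ord_cst -big_split/=.
  by apply: eq_bigr => i _; rewrite eqxx /=; ring.
by field.
Qed.

(** The drift is homogeneous of degree -1, so its pairing with the position is constant off the
    walls: each unordered pair contributes [k2], twice in type B, where each coordinate also
    contributes [k1]. *)
Definition drift_cst (b : bool) (k1 k2 : R) : R :=
  k2 / 2 * (N%:R * N.-1%:R) * (1 + b%:R) + b%:R * k1 * N%:R.

Lemma drift_coord b k1 k2 y : regular b y ->
  drift GRing.inv b k1 k2 (fun i => y ord0 i) y = drift_cst b k1 k2.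
Proof.
move=> [dy rb]; rewrite drift_sym; last exact: odd_ker_inv.
rewrite /drift_cst -[k2 / 2 * _ * _]mulrA; congr (_ * _ + _).
  rewrite -[N in N%:R * _ * _]card_ord -sum1_card natr_sum !mulr_suml; apply: eq_bigr => i _.
  rewrite -[N in N.-1](card_ord N) -(cardC1 i) -sum1_card natr_sum mulr_sumr mulr_suml.
  apply: eq_big => [j|j ji]; first by rewrite inE.
  rewrite mulVf ?subr_eq0 ?dy//; last by rewrite eq_sym.
  case: b rb => rb /=; last by rewrite mul0r; ring.
  by rewrite mulVf ?(rb isT).1//; [ring|rewrite eq_sym].
case: b rb => rb; last by rewrite !mul0r.
congr (_ * _); rewrite -[RHS]mulr1 -sum_ord_cst.
by apply: eq_bigr => i _; rewrite mulVf// (rb isT).2.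
Qed.

Definition drift_max (k1 k2 : R) : R := `|k2| * N%:R ^+ 2 + `|k1| * N%:R.

Lemma drift_coord_bound ker b k1 k2 (y : V) : odd_ker ker ->
  `|drift ker b k1 k2 (fun i => y ord0 i) y| <= drift_max k1 k2.
Proof.
move=> ok; rewrite -[drift_max _ _]mulr1; apply: drift_bound => // [i j|_ i j _|_ i];
  by rewrite mul1r.
Qed.

Lemma psum_perm m (s : 'S_N) (y : V) : psum m (\row_i y ord0 (s i)) = psum m y.
Proof.
rewrite /psum [RHS](reindex_inj (@perm_inj _ s))/=; apply: eq_bigr => i _.
by rewrite mxE.
Qed.

Lemma pprod_perm t (s : 'S_N) (y : V) : pprod t (\row_i y ord0 (s i)) = pprod t y.
Proof. by apply: eq_bigr => m _; rewrite psum_perm. Qed.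

Lemma psum_sign m (c : 'I_N -> bool) (y : V) : ~~ odd m ->
  psum m (\row_i ((-1) ^+ c i * y ord0 i)) = psum m y.
Proof.
move=> om; apply: eq_bigr => i _; rewrite mxE exprMn -exprM mulnC exprM.
by rewrite -[(-1) ^+ m]signr_odd (negbTE om) expr0 expr1n mul1r.
Qed.

Definition evens := all (fun m => ~~ odd m).

Lemma pprod_sign t (c : 'I_N -> bool) (y : V) : evens t ->
  pprod t (\row_i ((-1) ^+ c i * y ord0 i)) = pprod t y.
Proof.
elim: t => [|m t IH]; first by rewrite !pprod_nil.
by move=> /= /andP[om et]; rewrite !pprod_cons psum_sign// IH.
Qed.

(** A cutoff in [r = psum 2 y], not identically 1 on any interval but tending to 1 as [M] grows. On
    [0 <= r] its explicit form makes [dcut M r] and [r * ddcut M r] of order [1 / M]. *)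
Definition cut (M r : R) := pos (1 - r / M) ^+ 3.
Definition dcut (M r : R) := - (3 / M) * pos (1 - r / M) ^+ 2.
Definition ddcut (M r : R) := 6 / M ^+ 2 * pos (1 - r / M).

Lemma is_derive_affine (M x : R) : is_derive x 1 (fun r => 1 - r / M) (- M^-1).
Proof.
have h := is_derive_mulr M^-1 (is_derive_id x 1).
have -> : (fun r => 1 - r / M) = cst 1 - (fun u => M^-1 * id u).
  by apply/funext => r /=; rewrite mulrC.
by apply: is_derive_eq; rewrite mulr1 sub0r.
Qed.

Lemma is_derive_cut (M x : R) : is_derive x 1 (cut M) (dcut M x).
Proof.
apply: is_derive_eq (@is_derive_comp R (fun u => pos u ^+ 3) _ x _ _
  (is_derive_posX 1 _) (is_derive_affine M x)) _.
by rewrite /dcut; ring.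
Qed.

Lemma is_derive_dcut (M x : R) : is_derive x 1 (dcut M) (ddcut M x).
Proof.
apply: is_derive_eq (is_derive_mulr _ (@is_derive_comp R (fun u => pos u ^+ 2) _ x _ _
  (is_derive_posX 0 _) (is_derive_affine M x))) _.
by rewrite /ddcut expr1 -exprVn; ring.
Qed.

Lemma continuous_ddcut (M : R) : continuous (ddcut M).
Proof.
apply: continuous_mul; first exact: cst_continuous.
apply: continuous_fcomp; first exact: pos_continuous.
apply: continuous_sub; first exact: cst_continuous.
by apply: continuous_mul; [move=> x; exact: cvg_id|exact: cst_continuous].
Qed.

Section CutoffBounds.
Variables (M r : R).
Hypotheses (M0 : 0 < M) (r0 : 0 <= r).

Let rM : 0 <= r / M. Proof. by rewrite divr_ge0// ltW. Qed.

Let pos_le1 : pos (1 - r / M) <= 1.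
Proof. by rewrite /pos ge_max ler01 lerBlDr lerDl. Qed.

Lemma cut_ge0 : 0 <= cut M r. Proof. by rewrite exprn_ge0// pos_ge0. Qed.

Lemma cut_le1 : cut M r <= 1. Proof. by rewrite exprn_ile1// pos_ge0. Qed.

Lemma pos_cut_0 : M <= r -> pos (1 - r / M) = 0.
Proof. by move=> Mr; rewrite pos_0// subr_le0 ler_pdivlMr// mul1r. Qed.

Lemma dcut_bound : `|dcut M r| <= 3 / M.
Proof.
have M3 : 0 <= 3 / M by rewrite divr_ge0// ltW.
rewrite /dcut normrM normrN (ger0_norm M3) ler_piMr//.
by rewrite ger0_norm ?exprn_ge0 ?exprn_ile1 ?pos_ge0.
Qed.

Lemma ddcut_bound : `|r * ddcut M r| <= 6 / M.
Proof.
have [Mr|Mr] := leP M r.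
  by rewrite /ddcut pos_cut_0// !mulr0 normr0 divr_ge0// ltW.
rewrite /ddcut ger0_norm; last by rewrite !mulr_ge0// ?pos_ge0// invr_ge0 sqr_ge0.
have -> : r * (6 / M ^+ 2 * pos (1 - r / M)) = (6 / M) * ((r / M) * pos (1 - r / M)).
  by field; rewrite gt_eqF.
have M6 : 0 <= 6 / M by rewrite divr_ge0// ltW.
rewrite ler_piMr// mulr_ile1 ?pos_ge0// ler_pdivrMr// mul1r.
exact: ltW.
Qed.

Lemma cut_ge_eighth : r <= M / 2 -> 8^-1 <= cut M r.
Proof.
move=> rM2; have h : 2^-1 <= 1 - r / M.
  by rewrite lerBrDr addrC -lerBrDr ler_pdivrMr//; lra.
have -> : 8^-1 = (2^-1 : R) ^+ 3 by field.
by rewrite /cut pos_id ?lerXn2r ?nnegrE//; exact: le_trans h.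
Qed.

End CutoffBounds.

Lemma cvg_cut (r : R) : (fun n => cut n.+1%:R r) @ \oo --> (1 : R).
Proof.
have h : (fun n => 1 - r / n.+1%:R) @ \oo --> (1 : R).
  rewrite -[X in _ --> X]subr0 -(mulr0 r); apply: cvgB; first exact: cvg_cst.
  by apply: cvgM; [exact: cvg_cst|exact: cvg_harmonic].
have c : continuous (fun u : R => pos u ^+ 3).
  move=> u; apply: (@continuous_comp _ _ _ (@pos R) (fun v => v ^+ 3)).
    exact: pos_continuous.
  exact: exprn_continuous.
have c1 : (fun n => cut n.+1%:R r) @ \oo --> pos 1 ^+ 3.
  by have := @continuous_cvg _ _ _ _ _ _ _ _ (c 1) h; apply.
by rewrite pos_id// expr1n in c1.
Qed.

Definition theta (M : R) : V -> R := radial (cut M).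

Definition pprod_cut s M (y : V) : R := pprod s y * theta M y.

Lemma jet2_theta M : jet2 (theta M) (fun i y => dcut M (psum 2 y) * (2 * y ord0 i))
    (fun i j y => dcut M (psum 2 y) * ((i == j)%:R * 2) +
                  2 * y ord0 i * (ddcut M (psum 2 y) * (2 * y ord0 j))).
Proof.
exact: jet2_radial (is_derive_cut M) (is_derive_dcut M) (@continuous_ddcut M).
Qed.

(** The [+ 1] ensures [1 <= |y|], hence [|y| ^ 2 >= |y| >= M]. *)
Lemma theta_support M y : 0 < M -> M + 1 < `|y| -> theta M y = 0.
Proof.
move=> M0 My; rewrite /theta /radial /cut pos_cut_0 ?psum2_ge0// ?expr0n//.
apply: le_trans (ler_norm_psum2 _); have y1 : 1 <= `|y| by lra.
by rewrite expr2 (le_trans _ (ler_peMl _ y1))//; lra.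
Qed.

Lemma dom_mul_theta (b : bool) (M : R) f g h : 0 < M -> jet2 f g h -> perm_invariant f ->
  (b -> sign_invariant f) -> dom b (fun y => f y * theta M y).
Proof.
move=> M0 jf pf sf; split.
- exact: jet2_C2 (jet2M jf (jet2_theta M)).
- by exists (M + 1) => y My; rewrite theta_support// mulr0.
- by move=> s y; rewrite pf /theta /radial psum_perm.
by move=> bt c y; rewrite sf// /theta /radial psum_sign.
Qed.

Lemma dom_pprod_cut (b : bool) s (M : R) : 0 < M -> (b -> evens s) -> dom b (pprod_cut s M).
Proof.
move=> M0 es; apply: dom_mul_theta M0 (jet2_pprod R N s) _ _.
  by move=> p y; exact: pprod_perm.
by move=> /es et c y; exact: pprod_sign.
Qed.

Lemma genA_pprod k s y : distinct y ->
  gen GRing.inv false 0 k (@pprod R N s) y = opO 2^-1 0 0 k s y.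
Proof.
move=> dy; rewrite (gen_jet2 _ _ _ _ _ (jet2_pprod R N s)) /drift /opO !mul0r !addr0.
congr (_ + _); first by rewrite mulr_sumr; apply: eq_bigr => i _; rewrite expr0 mulr1.
rewrite !mulr_sumr; apply: eq_bigr => i _; rewrite !mulr_sumr; apply: eq_bigr => j ji.
by rewrite mul0r addr0 expr0; field; rewrite subr_eq0 dy// eq_sym.
Qed.

Definition wq (b c x : R) : R := (x ^+ 2 - b) / c.

Lemma jet2_pprod_wq b c s : jet2 (fun y : V => pprod s (mapw (wq b c) y))
  (fun i y => gpp s i (mapw (wq b c) y) * (2 / c * y ord0 i))
  (fun i j y => hpp s i j (mapw (wq b c) y) * (2 / c * y ord0 i * (2 / c * y ord0 j))
              + (i == j)%:R * (gpp s i (mapw (wq b c) y) * (2 / c))).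
Proof.
apply: (@jet2_pprod_mapw R N (wq b c) (fun x => 2 / c * x) (fun=> 2 / c)).
- move=> x; have -> : wq b c = (fun u => c^-1 * u ^+ 2) - cst (b / c).
    by apply/funext => u; rewrite /wq /= mulrBl mulrC.
  have h := is_derive_mulr c^-1 (is_derive_exprn 2 x).
  by apply: is_derive_eq; rewrite /= expr1; ring.
- by move=> x; apply: is_derive_eq (is_derive_mulr _ (is_derive_id x 1)) _; rewrite mulr1.
- exact: cst_continuous.
Qed.

(** Since [w_i - w_j = (y_i - y_j)(y_i + y_j) / c], the two kernels combine into the type A kernel
    in [w], with coefficient proportional to [y_i^2]. Expanding [y_i^2 = b + c w_i] separates the
    part of order [b / c^2], which is type A, from the part of order [1 / c]. In the [k1] term the
    singularity [1 / y_i] cancels against the derivative of the square. *)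
Lemma genB_pprod_wq k1 k2 b c s y : c != 0 -> regular true y ->
  let w := mapw (wq b c) y in
  gen GRing.inv true k1 k2 (fun y => pprod s (mapw (wq b c) y)) y =
  4 * b / c ^+ 2 * opO 2^-1 0 0 k2 s w + c^-1 * opO 2 1 1 k2 s w
  + 2 * k1 / c * opO 0 0 1 k2 s w.
Proof.
move=> c0 [dy /(_ isT)[sy ny]] /=; set w := mapw _ _.
rewrite (gen_jet2 _ _ _ _ _ (jet2_pprod_wq b c s)) -/w /drift /opO.
have yw i : y ord0 i ^+ 2 = b + c * w ord0 i by rewrite mxE /wq; field.
have -> : 2^-1 * \sum_(i < N) (hpp s i i w * (2 / c * y ord0 i * (2 / c * y ord0 i)) +
     (i == i)%:R * (gpp s i w * (2 / c))) =
   4 * b / c ^+ 2 * (\sum_(i < N) 2^-1 * w ord0 i ^+ 0 * hpp s i i w) +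
   c^-1 * (\sum_(i < N) 2 * w ord0 i ^+ 1 * hpp s i i w) + c^-1 * \sum_(i < N) gpp s i w.
  rewrite !mulr_sumr -!big_split/=; apply: eq_bigr => i _.
  have -> : 2 / c * y ord0 i * (2 / c * y ord0 i) = 4 / c ^+ 2 * y ord0 i ^+ 2 by field.
  by rewrite yw eqxx expr0 expr1 /=; field.
have -> : \sum_(i < N) (y ord0 i)^-1 * (gpp s i w * (2 / c * y ord0 i)) =
    2 / c * \sum_(i < N) gpp s i w.
  by rewrite mulr_sumr; apply: eq_bigr => i _; field; rewrite c0 ny.
have -> : \sum_(i < N) \sum_(j < N | j != i)
    ((y ord0 i - y ord0 j)^-1 + 1%:R * (y ord0 i + y ord0 j)^-1) *
    (gpp s i w * (2 / c * y ord0 i)) =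
  4 * b / c ^+ 2 * (2 * \sum_(i < N) \sum_(j < N | j != i)
     2^-1 * w ord0 i ^+ 0 * gpp s i w / (w ord0 i - w ord0 j)) +
  c^-1 * (2 * \sum_(i < N) \sum_(j < N | j != i)
     2 * w ord0 i ^+ 1 * gpp s i w / (w ord0 i - w ord0 j)).
  rewrite !mulr_sumr -!big_split/=; apply: eq_bigr => i _.
  rewrite !mulr_sumr -!big_split/=; apply: eq_bigr => j ji.
  have n1 : y ord0 i - y ord0 j != 0 by rewrite subr_eq0 dy// eq_sym.
  have n2 : y ord0 i + y ord0 j != 0 by rewrite sy// eq_sym.
  have wE : w ord0 i - w ord0 j = (y ord0 i - y ord0 j) * (y ord0 i + y ord0 j) / c.
    by rewrite !mxE /wq; field.
  rewrite wE expr0 expr1 mul1r.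
  transitivity (4 * y ord0 i ^+ 2 / c * gpp s i w / ((y ord0 i - y ord0 j) * (y ord0 i + y ord0 j))).
    by field; rewrite c0 n1 n2.
  by rewrite yw; field; rewrite c0 n1 n2.
have z1 : \sum_(i < N) 0 * w ord0 i ^+ 0 * hpp s i i w = 0.
  by apply: big1 => i _; rewrite !mul0r.
have z2 : \sum_(i < N) \sum_(j < N | j != i) 0 * w ord0 i ^+ 0 * gpp s i w / (w ord0 i - w ord0 j) = 0.
  by apply: big1 => i _; apply: big1 => j _; rewrite !mul0r.
by rewrite z1 z2 /=; field.
Qed.

End Cutoff.

(** * Integrals over a time interval *)

Section RealIntegral.
Variable R : realType.
Local Notation leb := (@lebesgue_measure R).

Lemma leb_itv0 (t : R) : 0 <= t -> leb `[0, t]%classic = t%:E.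
Proof.
move=> t0; rewrite lebesgue_measure_itv/= lte_fin; case: ltP => [_|t0'].
  by rewrite sube0.
by have -> : t = 0 by apply/eqP; rewrite eq_le t0'.
Qed.

Lemma integrable_itv_bounded (u : R -> R) (t K : R) : measurable_fun `[0, t]%classic u ->
  (forall s, 0 <= s <= t -> `|u s| <= K) -> leb.-integrable `[0, t]%classic (EFin \o u).
Proof.
move=> mu uK; have [t0|t0] := leP 0 t; last first.
  rewrite (_ : `[0, t]%classic = set0); first exact: integrable_set0.
  by rewrite set_itv_ge// bnd_simp -ltNge.
apply: measurable_bounded_integrable => //.
  by rewrite [ltLHS](leb_itv0 t0) ltry.
exists K; split; first exact: num_real.
by move=> M KM s /=; rewrite in_itv/= => /uK /le_trans; apply; exact: ltW.
Qed.

Lemma Rintegral_itv_bound (u : R -> R) (t K : R) : 0 <= t -> measurable_fun `[0, t]%classic u ->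
  (forall s, 0 <= s <= t -> `|u s| <= K) -> `|Rintegral leb `[0, t]%classic u| <= K * t.
Proof.
move=> t0 mu uK; have iu := integrable_itv_bounded mu uK.
apply: le_trans (le_normr_Rintegral _ iu) _ => //.
have -> : K * t = Rintegral leb `[0, t]%classic (fun=> K).
  by rewrite Rintegral_cst//= (leb_itv0 t0).
apply: le_Rintegral => //.
- apply: (@integrable_itv_bounded (fun s => `|u s|) t K).
    by apply: measurableT_comp => //; exact: normr_measurable.
  by move=> s /uK; rewrite normr_id.
by apply: (@integrable_itv_bounded (fun=> K) t `|K|).
Qed.

Lemma Rintegral_itv_dominated (u_ : nat -> R -> R) (u : R -> R) (t K : R) :
  (forall n, measurable_fun `[0, t]%classic (u_ n)) ->
  (forall n s, 0 <= s <= t -> `|u_ n s| <= K) ->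
  (forall s, 0 <= s <= t -> (fun n => u_ n s) @ \oo --> u s) ->
  measurable_fun `[0, t]%classic u /\
  (fun n => Rintegral leb `[0, t]%classic (u_ n)) @ \oo --> Rintegral leb `[0, t]%classic u.
Proof.
move=> mu_ uK cu.
have mu : measurable_fun `[0, t]%classic u.
  by apply: measurable_fun_cvg mu_ _ => s /=; rewrite in_itv/=; exact: cu.
split=> //.
have [] := @dominated_convergence _ _ _ leb `[0, t]%classic (measurable_itv _)
  (fun n => EFin \o u_ n) (EFin \o u) (EFin \o (fun=> K)).
- by move=> n; apply/measurable_EFinP; exact: mu_.
- by apply/measurable_EFinP; exact: mu.
- apply: aeW => s /=; rewrite in_itv/= => st.
  by apply: cvg_EFin; [exact: nearW|exact: cu].
- by apply: (@integrable_itv_bounded (fun=> K) t `|K|).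
- by apply: aeW => s n /=; rewrite in_itv/= lee_fin => /uK.
move=> iu _ c; apply: fine_cvg; rewrite fineK//.
by apply: (integrable_fin_num _ iu).
Qed.

Lemma Rintegral_deriv (P : {poly R}) (t : R) : 0 <= t ->
  Rintegral leb `[0, t]%classic (fun s => (deriv P).[s]) = P.[t] - P.[0].
Proof.
rewrite le_eqVlt => /predU1P[<-|t0]; first by rewrite set_itv1 Rintegral_set1 subrr.
have cp (p : {poly R}) : continuous (fun s => p.[s]) by exact: continuous_horner.
rewrite /Rintegral (@continuous_FTC2 _ (fun s => (deriv P).[s]) (fun s => P.[s]) 0 t t0)//.
- exact: continuous_subspaceT.
- split.
  + by move=> s _; exact: derivable_horner.
  + by apply: cvg_at_right_filter; exact: cp.
  + by apply: cvg_at_left_filter; exact: cp.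
by move=> s _; rewrite -derivE.
Qed.

Lemma poly_antiderivative (q : {poly R}) (a : R) : exists Q : {poly R}, deriv Q = q /\ Q.[0] = a.
Proof.
exists (\sum_(i < size q) (q`_i / i.+1%:R) *: 'X^(i.+1) + a%:P); split.
  rewrite derivD derivC addr0 raddf_sum -[RHS]coefK poly_def; apply: eq_bigr => i _.
  by rewrite /= derivZ derivXn /= -scalerMnr scalerMnl -[_ *+ _]mulr_natr divfK// pnatr_eq0.
rewrite hornerD hornerC horner_sum big1 ?add0r// => i _.
by rewrite hornerZ hornerXn expr0n mulr0.
Qed.

End RealIntegral.

Lemma mapw_continuous (R : realType) N (w : R -> R) : continuous w ->
  continuous (@mapw R N w).
Proof.
move=> cw z A [P hP PA]; exists (fun i j u => P i j (w u)) => [i j|y hy].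
  by have := hP i j; rewrite mxE (ord1 i); exact: cw.
by apply: PA => i j; rewrite mxE (ord1 i); exact: hy.
Qed.

(** * Bump functions that detect a wall *)

Section Bump.
Variable R : realType.

(* [bump e] is at most [e], but its second derivative at [0] is [2], so that Dynkin's formula
   for functions [bump e (y_i - y_j)] as [e] tends to [0] measures the time spent at [y_i = y_j]. *)
Definition bump (e u : R) := e / 3 * (1 - cut e (u ^+ 2)).
Definition dbump (e u : R) := 2 * u * pos (1 - u ^+ 2 / e) ^+ 2.
Definition ddbump (e u : R) :=
  2 * pos (1 - u ^+ 2 / e) ^+ 2 - 8 * (u ^+ 2 / e) * pos (1 - u ^+ 2 / e).

Section BumpBounds.
Variable e : R.
Hypothesis e0 : 0 < e.

Lemma is_derive_bump (u : R) : is_derive u 1 (bump e) (dbump e u).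
Proof.
have h := @is_derive_comp R (cut e) _ u _ _ (is_derive_cut e _) (is_derive_exprn 2 u).
have h' := is_derive_mulr (- (e / 3)) h.
have -> : bump e = cst (e / 3) + (fun u => - (e / 3) * cut e (u ^+ 2)).
  by apply/funext => v; rewrite -[RHS]/(e / 3 + - (e / 3) * cut e (v ^+ 2)) /bump; ring.
by apply: is_derive_eq; rewrite add0r /dcut /dbump expr1; field; rewrite gt_eqF.
Qed.

Lemma is_derive_dbump (u : R) : is_derive u 1 (dbump e) (ddbump e u).
Proof.
have h1 : is_derive u 1 (fun u => 1 - u ^+ 2 / e) (- e^-1 * (2 * u ^+ 1)).
  exact: (@is_derive_comp R (fun r => 1 - r / e) _ u _ _ (is_derive_affine e _) (is_derive_exprn 2 u)).
have h2 := @is_derive_comp R (fun v => pos v ^+ 2) _ u _ _ (is_derive_posX 0 _) h1.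
have h3 := is_derive_mul (is_derive_mulr 2 (is_derive_id u 1)) h2.
apply: is_derive_eq h3 _; rewrite /ddbump !expr1; field; rewrite gt_eqF//.
Qed.

Lemma continuous_ddbump : continuous (ddbump e).
Proof.
have cX n : continuous (fun u : R => u ^+ n) by move=> u; exact: exprn_continuous.
have cst (a : R) : continuous (fun _ : R => a) by exact: cst_continuous.
have c1 : continuous (fun u : R => u ^+ 2 / e) by apply: continuous_mul (cX 2%N) (cst _).
have c2 : continuous (fun u : R => pos (1 - u ^+ 2 / e)).
  by apply: continuous_fcomp; [exact: pos_continuous|exact: continuous_sub (cst _) c1].
apply: continuous_sub.
  by apply: continuous_mul (cst _) _; apply: (continuous_fcomp (cX 2%N) c2).
by apply: continuous_mul c2; exact: continuous_mul (cst _) c1.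
Qed.

Let pos_le1 u : pos (1 - u ^+ 2 / e) <= 1.
Proof. by rewrite /pos ge_max ler01 lerBlDr lerDl divr_ge0 ?sqr_ge0// ltW. Qed.

Lemma bumpN u : bump e (- u) = bump e u. Proof. by rewrite /bump sqrrN. Qed.

Lemma bump_bound u : `|bump e u| <= e.
Proof.
have c0 := cut_ge0 e (u ^+ 2); have c1 := cut_le1 e0 (sqr_ge0 u).
have e3 : 0 <= e / 3 by rewrite divr_ge0// ltW.
rewrite /bump normrM (ger0_norm e3) ger0_norm ?subr_ge0//.
apply: (@le_trans _ _ (e / 3)); first by rewrite ler_piMr// lerBlDr lerDl.
by rewrite ler_pdivrMr// ler_peMr ?ltW// ltr1n.
Qed.

Lemma bump_far u : e <= u ^+ 2 -> pos (1 - u ^+ 2 / e) = 0.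
Proof. by move=> eu; rewrite pos_0// subr_le0 ler_pdivlMr// mul1r. Qed.

Lemma dbump_bound u : e <= 1 -> `|dbump e u| <= 2.
Proof.
move=> e1; have [eu|ue] := leP e (u ^+ 2).
  by rewrite /dbump bump_far// expr0n mulr0 normr0.
rewrite /dbump !normrM (@ger0_norm _ 2)// -mulrA ler_piMr// mulr_ile1 ?normr_ge0//.
  by rewrite -(@ler_pXn2r _ 2)// ?nnegrE// real_normK ?num_real// expr1n ltW// (lt_le_trans ue).
by rewrite mulr_ile1 ?normr_ge0// ger0_norm ?pos_ge0.
Qed.

(** The two terms are at most 2 and 8, for every [e]; this uniformity permits dominated convergence
    as [e] tends to 0. *)
Lemma ddbump_bound u : `|ddbump e u| <= 10.
Proof.
have [eu|ue] := leP e (u ^+ 2).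
  by rewrite /ddbump bump_far// expr0n !mulr0 subr0 normr0.
have h1 : 0 <= u ^+ 2 / e <= 1.
  by rewrite divr_ge0 ?sqr_ge0 ?(ltW e0)//= ler_pdivrMr// mul1r ltW.
have h2 := pos_le1 u; have h3 := pos_ge0 (1 - u ^+ 2 / e).
rewrite /ddbump; set p := pos _ in h2 h3 *; set v := u ^+ 2 / e in h1 *.
have [h4 h5] := andP h1.
have h6 : 0 <= p ^+ 2 <= 1 by rewrite exprn_ge0// exprn_ile1.
have h7 : 0 <= v * p <= 1 by rewrite mulr_ge0// mulr_ile1.
by rewrite ler_norml; move: h6 h7 => /andP[? ?] /andP[? ?]; apply/andP; split; lra.
Qed.

End BumpBounds.

Let eps n : R := n.+1%:R^-1.

Let eps_gt0 n : 0 < eps n. Proof. by rewrite invr_gt0 ltr0n. Qed.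

Lemma cvg_bump (u : R) : (fun n => bump (eps n) u) @ \oo --> (0 : R).
Proof.
apply/cvgrPdist_le => d d0; near=> n; rewrite sub0r normrN.
apply: le_trans (bump_bound (eps_gt0 n) u) _; near: n.
have := @cvg_harmonic R => /cvgrPdist_le/(_ _ d0).
by apply: filterS => n; rewrite sub0r normrN ger0_norm//; exact: harmonic_ge0.
Unshelve. all: by end_near.
Qed.

Let eps_small (u : R) : u != 0 -> \forall n \near \oo, eps n <= u ^+ 2.
Proof.
move=> u0; have u2 : 0 < u ^+ 2 by rewrite exprn_even_gt0.
have := @cvg_harmonic R => /cvgrPdist_le/(_ _ u2).
by apply: filterS => n; rewrite sub0r normrN ger0_norm//; exact: harmonic_ge0.
Qed.

Lemma cvg_dbump (u : R) : (fun n => dbump (eps n) u) @ \oo --> (0 : R).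
Proof.
have [->|u0] := eqVneq u 0.
  by under eq_fun do rewrite /dbump mulr0 mul0r; exact: cvg_cst.
apply: cvg_near_cst; apply: filterS (eps_small u0) => n en.
by rewrite /dbump bump_far// expr0n mulr0.
Qed.

Definition zero_ind (u : R) : R := if u == 0 then 2 else 0.

Lemma cvg_ddbump (u : R) : (fun n => ddbump (eps n) u) @ \oo --> zero_ind u.
Proof.
rewrite /zero_ind; have [->|u0] := eqVneq u 0.
  have -> : (fun n => ddbump (eps n) 0) = (fun=> 2 : R).
    apply/funext => n; rewrite /ddbump expr0n mul0r subr0 pos_id// expr1n; ring.
  exact: cvg_cst.
apply: cvg_near_cst; apply: filterS (eps_small u0) => n en.
by rewrite /ddbump bump_far// expr0n !mulr0 subr0.
Qed.

End Bump.

(** * The test function for the time spent on the walls *)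

Section CollisionFunction.
Variables (R : realType) (N : nat) (b : bool).
Local Notation V := 'rV[R]_N.

(** The derivative of [y_i + a y_j] in the coordinate [l]. For [i = j] it vanishes when [a = -1],
    and equals 2 at [l = i] when [a = 1]. *)
Definition pairc (a : R) (i j l : 'I_N) : R := (i == l)%:R + a * (j == l)%:R.

Lemma pairc_bound a i j l : `|a| <= 1 -> `|pairc a i j l| <= 2.
Proof.
move=> a1; rewrite /pairc (le_trans (ler_normD _ _))// -[leRHS]/(1 + 1) lerD//.
  by rewrite normr_nat lern1 leq_b1.
by rewrite normrM normr_nat mulr_ile1// lern1 leq_b1.
Qed.

Lemma jet2_bump (e a : R) i j : 0 < e ->
  jet2 (fun y : V => bump e (y ord0 i + a * y ord0 j))
    (fun l y => dbump e (y ord0 i + a * y ord0 j) * pairc a i j l)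
    (fun l l' y => pairc a i j l * (ddbump e (y ord0 i + a * y ord0 j) * pairc a i j l')).
Proof.
move=> e0; have jl := jet2D (jet2_coord R i) (jet2Z a (jet2_coord R j)).
have j2 := jet2_comp jl (is_derive_bump e0) (is_derive_dbump e0) (@continuous_ddbump R e).
apply: jet2_ext j2 => // l l' y.
by rewrite mulr0 addr0 mulr0 add0r.
Qed.

(** The diagonal is kept on purpose: in type B the plus term with [i = j] is a bump in [2 y_i] and
    detects the wall [y_i = 0], while the minus term is [bump e 0 = 0]. *)
Definition collf (e : R) (y : V) : R := \sum_(i < N) \sum_(j < N)
  (bump e (y ord0 i + (-1) * y ord0 j) + b%:R * bump e (y ord0 i + 1 * y ord0 j)).

Definition collg (e : R) l (y : V) : R := \sum_(i < N) \sum_(j < N)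
  (dbump e (y ord0 i + (-1) * y ord0 j) * pairc (-1) i j l
   + b%:R * (dbump e (y ord0 i + 1 * y ord0 j) * pairc 1 i j l)).

Definition collh (e : R) l l' (y : V) : R := \sum_(i < N) \sum_(j < N)
  (pairc (-1) i j l * (ddbump e (y ord0 i + (-1) * y ord0 j) * pairc (-1) i j l')
   + b%:R * (pairc 1 i j l * (ddbump e (y ord0 i + 1 * y ord0 j) * pairc 1 i j l'))).

Lemma jet2_coll e : 0 < e -> jet2 (collf e) (collg e) (collh e).
Proof.
move=> e0; apply: jet2_sum => i _; apply: jet2_sum => j _; apply: jet2D.
  exact: jet2_bump.
by apply: jet2Z; exact: jet2_bump.
Qed.

Lemma collf_perm e : perm_invariant (collf e).
Proof.
move=> s y; rewrite /collf [RHS](reindex_inj (@perm_inj _ s))/=; apply: eq_bigr => i _.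
by rewrite [RHS](reindex_inj (@perm_inj _ s))/=; apply: eq_bigr => j _; rewrite !mxE.
Qed.

Lemma collf_sign e : b -> sign_invariant (collf e).
Proof.
move=> bt c y; rewrite /collf bt; apply: eq_bigr => i _; apply: eq_bigr => j _.
rewrite !mxE !mul1r !mulN1r.
case: (c i); case: (c j); rewrite ?expr1 ?expr0 ?mulN1r ?mul1r ?opprK //.
- rewrite -[bump e (- y ord0 i + y ord0 j)]bumpN -[bump e (- y ord0 i - y ord0 j)]bumpN.
  by rewrite !opprD !opprK.
- rewrite -[bump e (- y ord0 i + y ord0 j)]bumpN -[bump e (- y ord0 i - y ord0 j)]bumpN.
  by rewrite !opprD !opprK addrC.
- by rewrite addrC.
Qed.

Let b1 : 0 <= (b%:R : R) <= 1. Proof. by rewrite ler0n lern1 leq_b1. Qed.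

Lemma sum2_bound (F : 'I_N -> 'I_N -> R) K : (forall i j, `|F i j| <= K) ->
  `|\sum_(i < N) \sum_(j < N) F i j| <= N%:R * (N%:R * K).
Proof.
move=> FK; apply: le_trans (ler_norm_sum _ _ _) _.
rewrite -sum_ord_cst; apply: ler_sum => i _.
apply: le_trans (ler_norm_sum _ _ _) _.
by rewrite -sum_ord_cst; apply: ler_sum => j _.
Qed.

Lemma add_b_bound (u v K : R) : `|u| <= K -> `|v| <= K -> `|u + b%:R * v| <= 2 * K.
Proof.
move=> uK vK; have [b0 b1'] := andP b1; rewrite (le_trans (ler_normD _ _))//.
rewrite [2 * K]mulr_natl mulr2n lerD// normrM (ger0_norm b0) (le_trans _ vK)//.
by rewrite ler_piMl.
Qed.

Lemma collf_bound e y : 0 < e -> `|collf e y| <= N%:R * (N%:R * (2 * e)).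
Proof. by move=> e0; apply: sum2_bound => i j; apply: add_b_bound; exact: bump_bound. Qed.

Let n1 : `|(-1) : R| <= 1. Proof. by rewrite normrN normr1. Qed.
Let p1 : `|1 : R| <= 1. Proof. by rewrite normr1. Qed.

Lemma collg_bound e l y : 0 < e -> e <= 1 -> `|collg e l y| <= N%:R * (N%:R * 8).
Proof.
move=> e0 e1; have -> : 8 = 2 * (2 * 2) :> R by ring.
apply: sum2_bound => i j; apply: add_b_bound; rewrite normrM ler_pM//.
- exact: dbump_bound. - exact: pairc_bound.
- exact: dbump_bound. - exact: pairc_bound.
Qed.

Lemma collh_bound e l l' y : 0 < e -> `|collh e l l' y| <= N%:R * (N%:R * 80).
Proof.
move=> e0; have -> : 80 = 2 * (2 * (10 * 2)) :> R by ring.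
apply: sum2_bound => i j; apply: add_b_bound; rewrite !normrM !ler_pM// ?mulr_ge0//;
  by [exact: ddbump_bound|exact: pairc_bound].
Qed.

(** The limit of half the Laplacian of [collf e] as [e] tends to 0 along [n.+1%:R^-1]. *)
Definition collisions (y : V) : R := 2^-1 * \sum_(l < N) \sum_(i < N) \sum_(j < N)
  (pairc (-1) i j l * (zero_ind (y ord0 i + (-1) * y ord0 j) * pairc (-1) i j l)
   + b%:R * (pairc 1 i j l * (zero_ind (y ord0 i + 1 * y ord0 j) * pairc 1 i j l))).

Let term_ge0 a u i j l : 0 <= pairc a i j l * (zero_ind u * pairc a i j l).
Proof.
rewrite mulrCA -expr2 mulr_ge0 ?sqr_ge0// /zero_ind.
by case: ifP.
Qed.

Lemma collisions_ge0 y : 0 <= collisions y.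
Proof.
rewrite mulr_ge0//; apply: sumr_ge0 => l _; apply: sumr_ge0 => i _.
by apply: sumr_ge0 => j _; rewrite addr_ge0// mulr_ge0.
Qed.

Lemma ler_sum3 (F : 'I_N -> 'I_N -> 'I_N -> R) l i j : (forall l i j, 0 <= F l i j) ->
  F l i j <= \sum_(l < N) \sum_(i < N) \sum_(j < N) F l i j.
Proof.
move=> F0; rewrite (bigD1 l)//= (bigD1 i)//= (bigD1 j)//= -!addrA lerDl.
rewrite !addr_ge0//; do ?[by apply: sumr_ge0 => k _].
  by apply: sumr_ge0 => k _; apply: sumr_ge0.
by apply: sumr_ge0 => k _; apply: sumr_ge0 => k' _; apply: sumr_ge0.
Qed.

Lemma collisions_ge1 y : ~ regular b y -> 1 <= collisions y.
Proof.
move=> nr; set T := fun l i j : 'I_N =>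
  (pairc (-1) i j l * (zero_ind (y ord0 i + (-1) * y ord0 j) * pairc (-1) i j l)
   + b%:R * (pairc 1 i j l * (zero_ind (y ord0 i + 1 * y ord0 j) * pairc 1 i j l))).
have T0 l i j : 0 <= T l i j by rewrite addr_ge0// mulr_ge0.
suff [i [j h]] : exists i j, 2 <= T i i j.
  rewrite /collisions -[leLHS](mulVf (_ : 2 != 0 :> R))// ler_wpM2l//.
  exact: le_trans h (ler_sum3 _ _ _ T0).
apply: contrapT => hn; apply: nr.
have H i j : T i i j < 2.
  by rewrite ltNge; apply/negP => h; apply: hn; exists i, j.
have t1 i j : i != j -> y ord0 i = y ord0 j -> 2 <= T i i j.
  move=> ij yy; rewrite /T /pairc eqxx eq_sym (negbTE ij) yy mulN1r subrr /zero_ind eqxx.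
  case: ifP => _; case: (b) => /=; lra.
split.
  by move=> i j ij; apply/negP => /eqP yy; have := H i j; rewrite ltNge (t1 i j ij yy).
move=> bt; split.
  move=> i j ij; apply/negP => /eqP yy; have := H i j; rewrite ltNge => /negP; apply.
  rewrite /T bt !mul1r yy /zero_ind eqxx /pairc eqxx eq_sym (negbTE ij) /=.
  by rewrite !mulr0 !addr0 !mul1r !mulr1 lerDr; case: ifP.
move=> i; apply/negP => /eqP yy; have := H i i; rewrite ltNge => /negP; apply.
rewrite /T bt !mul1r yy addr0 mulr0 addr0 /zero_ind eqxx /pairc eqxx /=.
by rewrite !mulN1r !mul1r subrr !mul0r add0r; lra.
Qed.

Let eps n : R := n.+1%:R^-1.

Lemma cvg_collf y : (fun n => collf (eps n) y) @ \oo --> (0 : R).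
Proof.
rewrite -[X in _ --> X](_ : \sum_(i < N) \sum_(j < N) (0 + b%:R * 0) = 0); last first.
  by rewrite big1// => i _; rewrite big1// => j _; rewrite mulr0 addr0.
apply: cvg_bigsum => i _; apply: cvg_bigsum => j _; apply: cvgD; first exact: cvg_bump.
by apply: cvgM; [exact: cvg_cst|exact: cvg_bump].
Qed.

Lemma cvg_collg l y : (fun n => collg (eps n) l y) @ \oo --> (0 : R).
Proof.
rewrite -[X in _ --> X](_ : \sum_(i < N) \sum_(j < N) (0 * pairc (-1) i j l +
   b%:R * (0 * pairc 1 i j l)) = 0); last first.
  by rewrite big1// => i _; rewrite big1// => j _; rewrite !mul0r mulr0 addr0.
apply: cvg_bigsum => i _; apply: cvg_bigsum => j _; apply: cvgD.
  by apply: cvgM; [exact: cvg_dbump|exact: cvg_cst].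
apply: cvgM; first exact: cvg_cst.
by apply: cvgM; [exact: cvg_dbump|exact: cvg_cst].
Qed.

(** At a fixed point the kernel values are fixed numbers, [0^-1 = 0] included, while [collf] and its
    gradient tend to 0. Only the second derivatives of [collf] survive. *)
Lemma cvg_gen_coll k1 k2 (M : R) y :
  (fun n => gen GRing.inv b k1 k2 (fun y => collf (eps n) y * theta M y) y) @ \oo -->
  theta M y * collisions y.
Proof.
have e0 n : 0 < eps n by rewrite invr_gt0 ltr0n.
under eq_fun do rewrite (gen_mul _ _ _ _ _ (jet2_coll (e0 _)) (jet2_theta N M)).
under eq_fun do rewrite (gen_jet2 _ _ _ _ _ (jet2_coll (e0 _))).
have -> : theta M y * collisions y =
  0 * gen GRing.inv b k1 k2 (theta M) y + theta M y * (collisions y + (k2 * (\sum_(i < N) \sum_(j < N | j != i)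
     ((y ord0 i - y ord0 j)^-1 + b%:R * (y ord0 i + y ord0 j)^-1) * 0)
  + b%:R * k1 * \sum_(i < N) (y ord0 i)^-1 * 0)) +
  \sum_(i < N) 0 * (dcut M (psum 2 y) * (2 * y ord0 i)).
  rewrite mul0r add0r !big1 ?mulr0 ?addr0// => i _; rewrite ?mul0r ?mulr0//.
  by rewrite big1// => j _; rewrite mulr0.
apply: cvgD; last first.
  by apply: cvg_bigsum => i _; apply: cvgM; [exact: cvg_collg|exact: cvg_cst].
apply: cvgD; first by apply: cvgM; [exact: cvg_collf|exact: cvg_cst].
apply: cvgM; first exact: cvg_cst.
apply: cvgD.
  apply: cvgM; first exact: cvg_cst.
  apply: cvg_bigsum => l _; apply: cvg_bigsum => i _; apply: cvg_bigsum => j _.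
  apply: cvgD.
    apply: cvgM; first exact: cvg_cst.
    by apply: cvgM; [exact: cvg_ddbump|exact: cvg_cst].
  apply: cvgM; first exact: cvg_cst.
  apply: cvgM; first exact: cvg_cst.
  by apply: cvgM; [exact: cvg_ddbump|exact: cvg_cst].
apply: cvgD; apply: cvgM; try exact: cvg_cst.
  apply: cvg_bigsum => i _; apply: cvg_bigsum => j _.
  by apply: cvgM; [exact: cvg_cst|exact: cvg_collg].
by apply: cvg_bigsum => i _; apply: cvgM; [exact: cvg_cst|exact: cvg_collg].
Qed.

Lemma theta_partials_bounded (M : R) : 0 < M -> exists2 K : R, 0 <= K &
  (forall i (y : V), `|dcut M (psum 2 y) * (2 * y ord0 i)| <= K) /\
  (forall i j (y : V), `|dcut M (psum 2 y) * ((i == j)%:R * 2) +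
     2 * y ord0 i * (ddcut M (psum 2 y) * (2 * y ord0 j))| <= K).
Proof.
move=> M0; have [[_ j1] j2 j3] := jet2_theta N M.
have cs (f : V -> R) : continuous f -> (forall y, M <= psum 2 y -> f y = 0) ->
    exists2 K : R, 0 <= K & forall y, `|f y| <= K.
  move=> cf f0; apply: compact_support_bounded => //; exists (M + 1) => y My.
  apply: f0; apply: le_trans (ler_norm_psum2 _); have y1 : 1 <= `|y| by lra.
  by rewrite expr2 (le_trans _ (ler_peMl _ y1))//; lra.
have d0 (y : V) : M <= psum 2 y -> dcut M (psum 2 y) = 0.
  by move=> h; rewrite /dcut pos_cut_0 ?psum2_ge0// expr0n mulr0.
have dd0 (y : V) : M <= psum 2 y -> ddcut M (psum 2 y) = 0.
  by move=> h; rewrite /ddcut pos_cut_0 ?psum2_ge0// mulr0.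
have /choice[K1 h1] i : exists K : R, 0 <= K /\ forall y : V, `|dcut M (psum 2 y) * (2 * y ord0 i)| <= K.
  have [||K K0 hK] := cs (fun y : V => dcut M (psum 2 y) * (2 * y ord0 i)).
  - exact: jet1_continuous (j2 i).
  - by move=> y h; rewrite d0// mul0r.
  - by exists K.
have /choice[K2 h2] (p : 'I_N * 'I_N) : exists K : R, 0 <= K /\ forall y : V,
    `|dcut M (psum 2 y) * ((p.1 == p.2)%:R * 2) +
     2 * y ord0 p.1 * (ddcut M (psum 2 y) * (2 * y ord0 p.2))| <= K.
  have [||K K0 hK] := cs (fun y : V => dcut M (psum 2 y) * ((p.1 == p.2)%:R * 2) +
     2 * y ord0 p.1 * (ddcut M (psum 2 y) * (2 * y ord0 p.2))).
  - exact: j3.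
  - by move=> y h; rewrite d0// dd0// !mul0r mulr0 addr0.
  - by exists K.
have S1 : 0 <= \sum_i K1 i by apply: sumr_ge0 => i _; exact: (h1 i).1.
have S2 : 0 <= \sum_p K2 p by apply: sumr_ge0 => i _; exact: (h2 i).1.
exists (\sum_i K1 i + \sum_p K2 p); first exact: addr_ge0.
split=> [i y|i j y].
  apply: le_trans ((h1 i).2 y) _; apply: (@le_trans _ _ (\sum_i K1 i)); last by rewrite lerDl.
  by rewrite (bigD1 i)//= lerDl; apply: sumr_ge0 => p _; exact: (h1 p).1.
apply: le_trans ((h2 (i, j)).2 y) _; apply: (@le_trans _ _ (\sum_p K2 p)); last by rewrite lerDr.
by rewrite (bigD1 (i, j))//= lerDl; apply: sumr_ge0 => p _; exact: (h2 p).1.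
Qed.

Lemma dom_coll (M e : R) : 0 < M -> 0 < e -> dom b (fun y => collf e y * theta M y).
Proof.
move=> M0 e0; apply: dom_mul_theta M0 (jet2_coll e0) (@collf_perm e) _.
exact: collf_sign.
Qed.

(** Uniformity in [e] yields, through [gen_bound], a single constant that dominates the generator
    along the whole limit. *)
Lemma coll_hessian_bounded (M : R) : 0 < M -> exists2 H : R, 0 <= H &
  forall e, 0 < e -> e <= 1 -> forall i j (y : V),
    `|partial j (partial i (fun y => collf e y * theta M y)) y| <= H.
Proof.
move=> M0; have [K K0 [h1 h2]] := theta_partials_bounded M0.
pose A : R := N%:R * (N%:R * 80).
have A0 : 0 <= A by rewrite !mulr_ge0.
have A2 e : e <= 1 -> N%:R * (N%:R * (2 * e)) <= A.
  by move=> e1; rewrite /A !ler_wpM2l//; lra.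
have A8 : N%:R * (N%:R * 8) <= A by rewrite /A !ler_wpM2l//; lra.
exists (A * K + A + (A * K + A * K)); first by rewrite !addr_ge0// mulr_ge0.
move=> e e0 e1 i j y.
rewrite (jet2_partial2 i j (jet2M (jet2_coll e0) (jet2_theta N M))).
have /andP[t0 t1] : 0 <= theta M y <= 1 by rewrite cut_ge0 ?cut_le1 ?psum2_ge0.
have bf := le_trans (collf_bound y e0) (A2 e e1).
have bg l := le_trans (collg_bound l y e0 e1) A8.
have bh := collh_bound i j y e0.
rewrite (le_trans (ler_normD _ _))// lerD// (le_trans (ler_normD _ _))// lerD//.
- by rewrite normrM ler_pM.
- by rewrite normrM (ger0_norm t0) (le_trans _ bh)// ler_piMl.
- by rewrite normrM ler_pM.
- by rewrite normrM ler_pM.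
Qed.

End CollisionFunction.

(** * Radial powers under the generator *)

Section RadialPowers.
Variables (R : realType) (N : nat).
Local Notation V := 'rV[R]_N.

Lemma pprod_nseq2 m (y : V) : pprod (nseq m 2%N) y = psum 2 y ^+ m.
Proof. by elim: m => [|m IH]; rewrite ?pprod_nil//= pprod_cons IH exprS. Qed.

Section Bounds.
Variables (M r : R).
Hypotheses (M0 : 0 < M) (r0 : 0 <= r).

Lemma mul_dcut_bound : `|r * dcut M r| <= 3.
Proof.
have [Mr|Mr] := leP M r.
  by rewrite /dcut pos_cut_0// expr0n !mulr0 normr0.
rewrite normrM (ger0_norm r0) (le_trans (ler_wpM2l r0 (dcut_bound M0 r0)))//.
by rewrite mulrCA ler_piMr// ler_pdivrMr// mul1r ltW.
Qed.

Lemma mul2_ddcut_bound : `|r ^+ 2 * ddcut M r| <= 6.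
Proof.
have [Mr|Mr] := leP M r.
  by rewrite /ddcut pos_cut_0// !mulr0 normr0.
rewrite expr2 -mulrA normrM (ger0_norm r0) (le_trans (ler_wpM2l r0 (ddcut_bound M0 r0)))//.
by rewrite mulrCA ler_piMr// ler_pdivrMr// mul1r ltW.
Qed.

End Bounds.

(** With 4 bounding the first radial derivative and 13 bounding [r] times the second, [gen_radial]
    gives [N * 4 + 2 * 13 + 2 * 4 * drift_max]. *)
Definition moment_cst (k1 k2 : R) : R := 4 * (N%:R + 2 * drift_max N k1 k2) + 26.

Lemma drift_max_ge0 (k1 k2 : R) : 0 <= drift_max N k1 k2.
Proof. by rewrite addr_ge0// mulr_ge0// exprn_ge0. Qed.

Lemma moment_cst_gt0 (k1 k2 : R) : 0 < moment_cst k1 k2.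
Proof. by rewrite ltr_wpDl// mulr_ge0// addr_ge0// mulr_ge0// drift_max_ge0. Qed.

(** Uniform in the cutoff level [M]. The square of [m.+1] stems from the second derivative of the
    power, and produces the factorial in [moment_bound]. *)
Lemma gen_pow_cut_bound ker (b : bool) k1 k2 (M : R) m (y : V) : odd_ker ker -> 0 < M ->
  `|gen ker b k1 k2 (fun y => psum 2 y ^+ m.+1 * theta M y) y|
    <= moment_cst k1 k2 * m.+1%:R ^+ 2 * psum 2 y ^+ m.
Proof.
move=> ok M0.
pose dphi u := u ^+ m.+1 * dcut M u + cut M u * (m.+1%:R * u ^+ m).
pose ddphi u := u ^+ m.+1 * ddcut M u + dcut M u * (m.+1%:R * u ^+ m) +
   (cut M u * (m.+1%:R * (m%:R * u ^+ m.-1)) + m.+1%:R * u ^+ m * dcut M u).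
have d1 (u : R) : is_derive u 1 (fun u => u ^+ m.+1 * cut M u) (dphi u).
  exact: is_derive_mul (is_derive_exprn m.+1 u) (is_derive_cut M u).
have d2 (u : R) : is_derive u 1 dphi (ddphi u).
  apply: is_deriveD; first exact: is_derive_mul (is_derive_exprn m.+1 u) (is_derive_dcut M u).
  exact: is_derive_mul (is_derive_cut M u) (is_derive_mulr _ (is_derive_exprn m u)).
have cX n : continuous (fun u : R => u ^+ n) by move=> u; exact: exprn_continuous.
have cst (a : R) : continuous (fun _ : R => a) by exact: cst_continuous.
have cd (f df : R -> R) : (forall u : R, is_derive u 1 f (df u)) -> continuous f.
  by move=> h u; apply: differentiable_continuous; apply/derivable1_diffP; case: (h u).
have c0 := cd _ _ (is_derive_cut M); have c1 := cd _ _ (is_derive_dcut M).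
have cdd : continuous ddphi.
  have c2 : continuous (fun u : R => m.+1%:R * u ^+ m) by exact: continuous_mul.
  apply: continuous_add; apply: continuous_add; apply: continuous_mul => //.
    exact: continuous_ddcut.
  by apply: continuous_mul => //; exact: continuous_mul.
rewrite (gen_radial ker b k1 k2 y d1 d2 cdd); set r := psum 2 y.
have r0 : 0 <= r by exact: psum2_ge0.
have rm : 0 <= r ^+ m by rewrite exprn_ge0.
have b1 := mul_dcut_bound M0 r0; have b2 := mul2_ddcut_bound M0 r0.
have bc0 := cut_ge0 M r; have bc1 := cut_le1 M0 r0.
pose n : R := m.+1%:R; have n1 : 1 <= n by rewrite ler1n.
have B1 : `|dphi r| <= 4 * n ^+ 2 * r ^+ m.
  have -> : dphi r = (r * dcut M r + n * cut M r) * r ^+ m by rewrite /dphi exprS -/n; ring.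
  rewrite normrM (ger0_norm rm) ler_wpM2r// (le_trans (ler_normD _ _))//.
  rewrite [X in _ + X]ger0_norm; last by rewrite mulr_ge0// (le_trans ler01).
  by apply: (@le_trans _ _ (3 + n)); [rewrite lerD// ler_piMr// (le_trans ler01)|nra].
have B2 : `|r * ddphi r| <= 13 * n ^+ 2 * r ^+ m.
  have -> : r * ddphi r = (r ^+ 2 * ddcut M r + 2 * n * (r * dcut M r) + n * m%:R * cut M r) * r ^+ m.
    rewrite /ddphi -/n exprS; case: m @n n1 {d1 d2 cdd dphi ddphi rm B1} => [|m'] n n1; last by rewrite exprS /=; ring.
    by rewrite /= expr0; ring.
  rewrite normrM (ger0_norm rm) ler_wpM2r// (le_trans (ler_normD _ _))//.
  have h1 : `|n * m%:R * cut M r| <= n * n.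
    have n0 : 0 <= n := le_trans ler01 n1.
    have mn : m%:R <= n by rewrite ler_nat.
    rewrite ger0_norm; last exact: mulr_ge0 (mulr_ge0 n0 (ler0n R m)) bc0.
    by rewrite -mulrA ler_wpM2l// (le_trans _ mn)// ler_piMr.
  have h2 : `|2 * n * (r * dcut M r)| <= 2 * n * 3.
    by rewrite normrM ger0_norm ?ler_wpM2l// mulr_ge0.
  apply: (@le_trans _ _ (6 + 2 * n * 3 + n * n)); last by nra.
  by rewrite lerD// (le_trans (ler_normD _ _))// lerD.
have B3 := drift_coord_bound b k1 k2 y ok; set D := drift _ _ _ _ _ _ in B3 *.
set A := n ^+ 2 * r ^+ m; have A0 : 0 <= A by rewrite mulr_ge0// exprn_ge0// (le_trans ler01).
have -> : moment_cst k1 k2 * n ^+ 2 * r ^+ m =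
   N%:R * (4 * A) + 2 * (13 * A) + 2 * (4 * A) * drift_max N k1 k2.
  by rewrite /moment_cst /A; ring.
move: B1 B2; rewrite -![_ * n ^+ 2 * _]mulrA -/A => B1 B2.
rewrite (le_trans (ler_normD _ _))// lerD//; last first.
  by rewrite !normrM (@ger0_norm _ 2)// ler_pM// ?mulr_ge0// ler_wpM2l.
rewrite (le_trans (ler_normD _ _))// lerD//.
  by rewrite normrM normr_nat ler_wpM2l.
by rewrite -mulrA normrM (@ger0_norm _ 2)// ler_wpM2l.
Qed.

End RadialPowers.

(** * Functions of polynomial growth *)

Section PolynomialGrowth.
Variables (R : realType) (N : nat).
Local Notation V := 'rV[R]_N.

Definition polyb (F : V -> R) := exists2 p : R * nat, 0 <= p.1 &
  forall y, `|F y| <= p.1 * (1 + psum 2 y) ^+ p.2.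

Lemma p1_ge1 (y : V) : 1 <= 1 + psum 2 y. Proof. by rewrite lerDl psum2_ge0. Qed.

Lemma polyb_cst (a : R) : polyb (fun=> a).
Proof. by exists (`|a|, 0%N) => /= [|y]; rewrite ?expr0 ?mulr1. Qed.

Lemma polyb_coord i : polyb (fun y => y ord0 i).
Proof.
exists (1, 1%N) => //= y; rewrite mul1r expr1.
have h : `|y ord0 i| ^+ 2 <= psum 2 y by rewrite real_normK ?num_real// ler_sqr_psum2.
apply: (@le_trans _ _ (1 + `|y ord0 i| ^+ 2)); last by rewrite lerD2l.
by have := sqr_ge0 (`|y ord0 i| - 2^-1); rewrite sqrrB; lra.
Qed.

Lemma polybD F G : polyb F -> polyb G -> polyb (fun y => F y + G y).
Proof.
move=> [[C k] /= C0 hF] [[D l] /= D0 hG]; exists (C + D, maxn k l) => [|y] /=.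
  exact: addr_ge0.
rewrite mulrDl (le_trans (ler_normD _ _))// lerD//.
  by rewrite (le_trans (hF y))// ler_wpM2l// ler_weXn2l ?p1_ge1// leq_maxl.
by rewrite (le_trans (hG y))// ler_wpM2l// ler_weXn2l ?p1_ge1// leq_maxr.
Qed.

Lemma polybM F G : polyb F -> polyb G -> polyb (fun y => F y * G y).
Proof.
move=> [[C k] /= C0 hF] [[D l] /= D0 hG]; exists (C * D, (k + l)%N) => [|y] /=.
  exact: mulr_ge0.
by rewrite exprD mulrACA normrM ler_pM.
Qed.

Lemma polybX F n : polyb F -> polyb (fun y => F y ^+ n).
Proof.
move=> pF; elim: n => [|n IH]; first exact: polyb_cst.
have -> : (fun y => F y ^+ n.+1) = (fun y => F y * F y ^+ n) by apply/funext => y; rewrite exprS.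
exact: polybM.
Qed.

Lemma polyb_sum I (r : seq I) (F : I -> V -> R) : (forall i, polyb (F i)) ->
  polyb (fun y => \sum_(i <- r) F i y).
Proof.
move=> hF; elim: r => [|i r IH].
  by have -> : (fun y => \sum_(i <- [::]) F i y) = (fun=> 0);
    [apply/funext => y; rewrite big_nil|exact: polyb_cst].
have -> : (fun y => \sum_(j <- i :: r) F j y) = (fun y => F i y + \sum_(j <- r) F j y).
  by apply/funext => y; rewrite big_cons.
exact: polybD.
Qed.

Section Composition.
Variable W : V -> V.
Hypothesis hW : forall i, polyb (fun y => W y ord0 i).

Lemma polyb_psum m : polyb (fun y => psum m (W y)).
Proof. by apply: polyb_sum => i; exact: polybX. Qed.

Lemma polyb_pprod s : polyb (fun y => pprod s (W y)).
Proof.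
elim: s => [|m s IH].
  by have -> : (fun y => pprod [::] (W y)) = (fun=> 1);
    [apply/funext => y; rewrite pprod_nil|exact: polyb_cst].
have -> : (fun y => pprod (m :: s) (W y)) = (fun y => psum m (W y) * pprod s (W y)).
  by apply/funext => y; rewrite pprod_cons.
by apply: polybM IH; exact: polyb_psum.
Qed.

Lemma polyb_gpp s i : polyb (fun y => gpp s i (W y)).
Proof.
elim: s => [|m s IH] /=; first exact: polyb_cst.
apply: polybD; apply: polybM => //; first exact: polyb_psum.
  exact: polyb_pprod.
by apply: polybM; [exact: polyb_cst|exact: polybX].
Qed.

End Composition.

Lemma polyb_wq (c d : R) i : polyb (fun y => mapw (wq c d) y ord0 i).
Proof.
have -> : (fun y => mapw (wq c d) y ord0 i) = (fun y => (y ord0 i ^+ 2 + - c) * d^-1).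
  by apply/funext => y; rewrite mxE.
apply: polybM (polyb_cst _); apply: polybD (polyb_cst _).
by apply: polybX; exact: polyb_coord.
Qed.

Lemma wq_continuous (c d : R) : continuous (@mapw R N (wq c d)).
Proof.
apply: mapw_continuous; apply: continuous_mul (@cst_continuous _ _ _).
by apply: continuous_sub (@cst_continuous _ _ _) => u; exact: exprn_continuous.
Qed.

(** Every term other than [theta M] times the generator of [f] carries [dcut] or [psum 2 * ddcut],
    and so is of order [1 / M] at a fixed point. *)
Lemma gen_mul_theta b k1 k2 f g h (M : R) y : jet2 f g h -> regular b y ->
  gen GRing.inv b k1 k2 (fun y => f y * theta M y) y =
  theta M y * gen GRing.inv b k1 k2 f y +
  f y * (2 * (psum 2 y * ddcut M (psum 2 y)) + (N%:R + 2 * drift_cst N b k1 k2) * dcut M (psum 2 y))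
  + 2 * dcut M (psum 2 y) * \sum_(i < N) g i y * y ord0 i.
Proof.
move=> jf ry; rewrite (gen_mul _ _ _ _ _ jf (jet2_theta N M)).
rewrite (gen_radial _ _ _ _ _ (is_derive_cut M) (is_derive_dcut M) (@continuous_ddcut R M)).
rewrite drift_coord// [in RHS]mulr_sumr.
have -> : \sum_(i < N) 2 * dcut M (psum 2 y) * (g i y * y ord0 i) =
  \sum_(i < N) g i y * (dcut M (psum 2 y) * (2 * y ord0 i)) by apply: eq_bigr => i _; ring.
by ring.
Qed.

End PolynomialGrowth.

(** * Dynkin's formula, from cutoff functions to polynomials *)

Section Diffusion.
Variables (R : realType) (N : nat) (b : bool) (k1 k2 : R) (x : 'rV[R]_N).
Variable mu : R -> probability 'rV[R]_N R.
Local Notation V := 'rV[R]_N.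
Local Notation leb := (@lebesgue_measure R).
Local Notation L := (gen GRing.inv b k1 k2).
Implicit Types (h f g : V -> R).
Hypothesis Hmu : diffusion_marginals (chamber b) L (dom b) x mu.

Definition expect (s : R) (h : V -> R) : R := Rintegral (mu s) setT h.

Local Notation S := (@chamber R N b).

Let muS s : 0 <= s -> mu s (~` S) = 0%E.
Proof. by move=> s0; exact: Hmu.1. Qed.

Let mS : measurable S. Proof. exact: measurable_chamber. Qed.

Definition time_measurable (h : V -> R) :=
  measurable_fun `[(0 : R), +oo[%classic (fun s => expect s h).

Definition integrable_at (h : V -> R) :=
  forall s, 0 <= s -> (mu s).-integrable setT (EFin \o h).

Lemma integrable_at_bounded h (K : R) : measurable_fun setT h ->
  (forall y, S y -> `|h y| <= K) -> integrable_at h.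
Proof. by move=> mh hK s s0; exact: (eintegrable_bounded mS (muS s0) mh hK). Qed.

Lemma integrable_at_dom f : dom b f -> integrable_at f.
Proof.
move=> [[cf _] cs _ _]; have [K K0 hK] := compact_support_bounded cf cs.
by apply: (@integrable_at_bounded f K) => //; exact: measurable_continuous.
Qed.

Lemma integrable_atD f g : integrable_at f -> integrable_at g ->
  integrable_at (fun y => f y + g y).
Proof.
move=> i1 i2 s s0; have := integrableD measurableT (i1 s s0) (i2 s s0).
by apply: eq_integrable.
Qed.

Lemma integrable_atZ a f : integrable_at f -> integrable_at (fun y => a * f y).
Proof.
move=> i1 s s0; have := integrableZl measurableT a (i1 s s0).
by apply: eq_integrable.
Qed.

Lemma expectD s f g : 0 <= s -> integrable_at f -> integrable_at g ->
  expect s (fun y => f y + g y) = expect s f + expect s g.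
Proof. by move=> s0 i1 i2; rewrite /expect RintegralD//; [exact: i1|exact: i2]. Qed.

Lemma expectZ s a f : 0 <= s -> integrable_at f ->
  expect s (fun y => a * f y) = a * expect s f.
Proof. by move=> s0 i1; rewrite /expect RintegralZl//; exact: i1. Qed.

Lemma integrable_at0 : integrable_at (fun=> 0).
Proof. by apply: (@integrable_at_bounded (fun=> 0) 0) => // y _; rewrite normr0. Qed.

Lemma expect_sum s I (r : seq I) (c : I -> R) (f : I -> V -> R) : 0 <= s ->
  (forall i, integrable_at (f i)) ->
  integrable_at (fun y => \sum_(i <- r) c i * f i y) /\
  expect s (fun y => \sum_(i <- r) c i * f i y) = \sum_(i <- r) c i * expect s (f i).
Proof.
move=> s0 hi; elim: r => [|i r [IH1 IH2]].
  rewrite big_nil; under eq_fun do rewrite big_nil.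
  by split; [exact: integrable_at0|rewrite /expect expect_cst].
have -> : (fun y => \sum_(i <- i :: r) c i * f i y) =
    (fun y => c i * f i y + \sum_(i <- r) c i * f i y).
  by apply/funext => y; rewrite big_cons.
have hc := integrable_atZ (c i) (hi i).
split; first exact: integrable_atD.
by rewrite expectD// expectZ// big_cons IH2.
Qed.

Lemma time_measurable_dom f : dom b f -> time_measurable f.
Proof.
move=> df; have : measurable_fun `[(0 : R), +oo[%classic
    (fun t => f x + Rintegral leb `[0, t]%classic (fun s => expect s (L f))).
  apply: measurable_funD; first exact: measurable_cst.
  exact: measurable_Rintegral_itv.
apply: eq_measurable_fun => t; rewrite inE /= in_itv/= andbT => t0.
by rewrite -Hmu.2.
Qed.

Lemma time_measurable_cvg (h_ : nat -> V -> R) h q : (forall n, measurable_fun setT (h_ n)) ->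
  measurable_fun setT h -> integrable_at q -> (forall n y, S y -> `|h_ n y| <= q y) ->
  (forall y, S y -> (fun n => h_ n y) @ \oo --> h y) ->
  (forall n, time_measurable (h_ n)) -> time_measurable h.
Proof.
move=> mh_ mh iq hq ch th; apply: measurable_fun_cvg th _ => s /=.
rewrite in_itv/= andbT => s0.
by have [] := expect_dominated mS (muS s0) mh_ mh ch (iq s s0) hq.
Qed.

Lemma time_measurable_sum I (r : seq I) (c : I -> R) (f : I -> V -> R) :
  (forall i, integrable_at (f i)) -> (forall i, time_measurable (f i)) ->
  time_measurable (fun y => \sum_(i <- r) c i * f i y).
Proof.
move=> hi ht; have : measurable_fun `[(0 : R), +oo[%classic
    (fun s => \sum_(i <- r) c i * expect s (f i)).
  apply: measurable_sum => i; apply: measurable_funM; first exact: measurable_cst.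
  exact: ht.
apply: eq_measurable_fun => s; rewrite inE /= in_itv/= andbT => s0.
by have [_ ->] := expect_sum r c s0 hi.
Qed.

Definition sq (u : R) : R := u ^+ 2.

Lemma pprod_sq s (y : V) : pprod s (mapw sq y) = pprod (map double s) y.
Proof.
rewrite /pprod big_map; apply: eq_bigr => m _; apply: eq_bigr => i _.
by rewrite mxE /sq -exprM mul2n.
Qed.

Lemma evens_double s : evens (map double s).
Proof. by rewrite /evens all_map; apply/allP => m _ /=; rewrite odd_double. Qed.

Lemma box_cut (M : R) (y : V) : 0 < M -> theta M y != 0 -> box (M + 1) y.
Proof.
move=> M0 ty i; apply: le_trans (ler_coord_norm _ _) _.
by rewrite leNgt; apply: contra ty => /theta_support ->.
Qed.

Lemma theta_01 (M : R) (y : V) : 0 < M -> 0 <= theta M y <= 1.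
Proof. by move=> M0; rewrite cut_ge0 ?cut_le1 ?psum2_ge0. Qed.

Lemma theta_continuous (M : R) : continuous (@theta R N M).
Proof. by have [j _ _] := jet2_theta N M; exact: jet1_continuous j. Qed.

(** In type B the substitution [z_i = y_i ^ 2] maps the chamber to sorted vectors, and power sums of
    [z] are even power sums of [y]. The type A approximation is therefore applied to [h] composed
    with square roots, on a box of squared radius. *)
Lemma chamber_approx (h : V -> R) (M e : R) : continuous h -> 0 < M -> 0 < e ->
  exists P : seq (R * seq nat), all (fun c => b ==> evens c.2) P /\
  forall y, S y -> `|h y * theta M y - (\sum_(c <- P) c.1 * pprod c.2 y) * theta M y| <= e.
Proof.
move=> ch M0 e0.
suff [P [eP hP]] : exists P : seq (R * seq nat), all (fun c => b ==> evens c.2) P /\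
    forall y, S y -> box (M + 1) y -> `|h y - \sum_(c <- P) c.1 * pprod c.2 y| <= e.
  exists P; split=> // y Sy; rewrite -mulrBl normrM.
  have [->|ty] := eqVneq (theta M y) 0; first by rewrite normr0 mulr0 ltW.
  have /andP[t0 t1] := theta_01 y M0.
  by rewrite (ger0_norm t0) (le_trans _ (hP _ Sy (box_cut M0 ty)))// ler_piMr.
case bE : b; last first.
  have [||F [[P [_ FP]] hF]] := @chamberA_weierstrass R N h (M + 1) e ch => //.
    by rewrite addr_gt0.
  exists P; split; first by apply/allP.
  by move=> y Sy By; rewrite -FP; exact: hF.
pose G (z : V) := h (mapw Num.sqrt z).
have cG : continuous G.
  move=> z; apply: (@continuous_comp _ _ _ (mapw Num.sqrt) h); last exact: ch.
  by apply: mapw_continuous; exact: sqrt_continuous.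
have L0 : 0 < (M + 1) ^+ 2 by rewrite exprn_gt0// addr_gt0.
have [F [[P [_ FP]] hF]] := @chamberA_weierstrass R N G ((M + 1) ^+ 2) e cG L0 e0.
exists [seq (c.1, map double c.2) | c <- P]; split.
  by rewrite all_map; apply/allP => c _ /=; exact: evens_double.
move=> y Sy By.
have -> : \sum_(c <- [seq (c.1, map double c.2) | c <- P]) c.1 * pprod c.2 y = F (mapw sq y).
  by rewrite FP big_map; apply: eq_bigr => c _; rewrite pprod_sq.
have -> : h y = G (mapw sq y).
  congr h; apply: row_ext => i; rewrite !mxE /sq sqrtr_sqr ger0_norm//.
  by have [] := Sy i i (leqnn _).
apply: hF => [i j ij|i].
  by rewrite !mxE /sq lerXn2r ?nnegrE//; have [? ?] := Sy i j ij; [|have [] := Sy i i (leqnn _)|].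
by rewrite mxE /sq normrX lerXn2r ?nnegrE// addr_ge0// ltW.
Qed.

(** The norm is the maximum norm, so [psum 2 y <= N * M0 ^ 2], which is at most half the cutoff
    level; there [cut] is at least the cube of one half. *)
Lemma theta_ge_eighth (M0 : R) (y : V) : `|y| <= M0 ->
  8^-1 <= theta (2 * (N%:R * M0 ^+ 2 + 1)) y.
Proof.
move=> yM0; have Mp : 0 < N%:R * M0 ^+ 2 + 1 by rewrite ltr_wpDl// mulr_ge0 ?sqr_ge0.
apply: cut_ge_eighth; first by rewrite mulr_gt0.
rewrite mulrAC mulfV// mul1r; apply: (@le_trans _ _ (N%:R * M0 ^+ 2)); last by rewrite lerDl.
rewrite -sum_ord_cst; apply: ler_sum => i _.
rewrite -[leLHS]real_normK ?num_real// lerXn2r ?nnegrE//.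
  exact: le_trans (normr_ge0 _) yM0.
exact: le_trans (ler_coord_norm _ _) yM0.
Qed.

(** A merely continuous [h] is outside the domain. Written as [G * theta M], it is a uniform limit
    on the chamber of polynomials times [theta M], which belong to the domain. *)
Lemma time_measurable_continuous h : continuous h -> compact_support h -> time_measurable h.
Proof.
move=> ch [M0 hM0].
pose M := 2 * (N%:R * M0 ^+ 2 + 1).
have Mp : 0 < M by rewrite mulr_gt0// ltr_wpDl// mulr_ge0 ?sqr_ge0.
(* The lower bound on the denominator keeps [G] continuous everywhere; it is not active where [h]
   can be nonzero. *)
pose G (y : V) := h y / Num.max 8^-1 (theta M y).
have mx (y : V) : 8^-1 <= Num.max 8^-1 (theta M y) by rewrite le_max lexx.
have cm : continuous (fun y : V => Num.max 8^-1 (theta M y)).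
  move=> y; apply: (@continuous_max _ _ (fun=> 8^-1) (theta M)).
    exact: cst_continuous.
  exact: theta_continuous.
have cG : continuous G.
  apply: continuous_mul => // y.
  have m0 : Num.max 8^-1 (theta M y) != 0 by rewrite gt_eqF// (lt_le_trans _ (mx y)).
  exact: (cvgV m0 (cm y)).
have hG (y : V) : h y = G y * theta M y.
  have [yM0|M0y] := leP `|y| M0; last by rewrite /G hM0// !mul0r.
  have te : 8^-1 <= theta M y by exact: theta_ge_eighth.
  rewrite /G (max_idPr te) divfK// gt_eqF//; exact: lt_le_trans te.
have /choice[P hP] n : exists P : seq (R * seq nat), all (fun c => b ==> evens c.2) P /\
  forall y, S y -> `|G y * theta M y - (\sum_(c <- P) c.1 * pprod c.2 y) * theta M y| <= n.+1%:R^-1.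
  by apply: chamber_approx.
have [K K0 hK] := compact_support_bounded ch (ex_intro _ M0 hM0).
pose h_ n (y : V) := \sum_(c <- [seq c <- P n | b ==> evens c.2]) c.1 * pprod_cut c.2 M y.
have h_E n y : h_ n y = (\sum_(c <- P n) c.1 * pprod c.2 y) * theta M y.
  rewrite /h_ (all_filterP (hP n).1) mulr_suml; apply: eq_bigr => c _.
  by rewrite mulrA.
(* Summing over a subtype makes every index admissible, as [time_measurable_sum] requires. *)
pose I0 := {c : R * seq nat | b ==> evens c.2}.
have tm n : time_measurable (h_ n).
  have [r rE] : exists r : seq I0, map val r = [seq c <- P n | b ==> evens c.2].
    exists (pmap insub (P n)); rewrite pmap_filter//; last by move=> c; rewrite insubK.
    by apply: eq_filter => c /=; case: insubP => [? ->|/negbTE ->].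
  have -> : h_ n = (fun y => \sum_(c <- r) (val c).1 * pprod_cut (val c).2 M y).
    by apply/funext => y; rewrite /h_ -rE big_map.
  have dc (c : I0) : dom b (pprod_cut (val c).2 M).
    by apply: dom_pprod_cut => // bt; have /implyP := valP c; apply; exact: bt.
  apply: (@time_measurable_sum I0 r (fun c => (val c).1)) => c.
    exact: integrable_at_dom.
  exact: time_measurable_dom.
have d n y : S y -> `|h y - h_ n y| <= n.+1%:R^-1.
  by move=> Sy; rewrite hG h_E; exact: (hP n).2.
apply: (@time_measurable_cvg h_ h (fun=> K + 1)) => //.
- move=> n; apply: measurable_sum => c; apply: measurable_funM; first exact: measurable_cst.
  apply: measurable_continuous.
  have [j _ _] := jet2M (jet2_pprod R N c.2) (jet2_theta N M).
  exact: jet1_continuous j.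
- exact: measurable_continuous.
- by apply: (@integrable_at_bounded _ `|K + 1|).
- move=> n y Sy; have -> : h_ n y = h y - (h y - h_ n y) by ring.
  rewrite (le_trans (ler_normB _ _))// lerD//.
  by rewrite (le_trans (d n y Sy))// invf_le1 ?ltr0n// ler1n.
move=> y Sy; apply/cvgrPdist_le => e e0; near=> n.
apply: le_trans (d n y Sy) _; near: n.
have := @cvg_harmonic R => /cvgrPdist_le/(_ _ e0).
by apply: filterS => n; rewrite sub0r normrN ger0_norm//; exact: harmonic_ge0.
Unshelve. all: by end_near.
Qed.

Lemma measurable_gen ker f : C2 f -> continuous ker -> measurable_fun setT (gen ker b k1 k2 f).
Proof. by move=> fC2 ck; apply: measurable_continuous; exact: gen_continuous. Qed.

Lemma measurable_gen_inv f : C2 f -> measurable_fun setT (L f).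
Proof.
move=> fC2; apply: (@measurable_fun_cvg _ _ _ _ (fun n => gen (rker n.+1%:R^-1) b k1 k2 f)).
  by move=> n; apply: measurable_gen => //; apply: rker_continuous.
by move=> y _; exact: cvg_gen_rker.
Qed.

(** [L f] may jump at the walls, so it is reached through the continuous regularized kernels under
    the common bound [gen_bound]. *)
Lemma time_measurable_gen f : dom b f -> time_measurable (L f).
Proof.
move=> df; have [fC2 cs _ _] := df.
have [H H0 hH] := dom_hessian_bounded df.
apply: (@time_measurable_cvg (fun n => gen (rker n.+1%:R^-1) b k1 k2 f) _
  (fun=> gen_cst N k1 k2 * H)).
- by move=> n; apply: measurable_gen => //; exact: rker_continuous.
- exact: measurable_gen_inv.
- by apply: (@integrable_at_bounded _ `|gen_cst N k1 k2 * H|).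
- by move=> n y _; apply: gen_bound => //; apply: odd_ker_rker.
- by move=> y _; exact: cvg_gen_rker.
move=> n; apply: time_measurable_continuous; last exact: gen_compact_support.
by apply: gen_continuous => //; exact: rker_continuous.
Qed.

Lemma integrable_at_gen f : dom b f -> integrable_at (L f).
Proof.
move=> df; have [fC2 cs _ _] := df; have [H H0 hH] := dom_hessian_bounded df.
apply: (@integrable_at_bounded _ (gen_cst N k1 k2 * H)); first exact: measurable_gen_inv.
by move=> y _; apply: gen_bound => //; exact: odd_ker_inv.
Qed.

Lemma expect_bound s h (K : R) : 0 <= s -> measurable_fun setT h ->
  (forall y, S y -> `|h y| <= K) -> `|expect s h| <= K.
Proof.
move=> s0 mh hK; rewrite -(expect_cst (mu s) K).
apply: (expect_normr_le mS (muS s0)) => //; first exact: (integrable_at_bounded mh hK).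
exact: eintegrable_cst.
Qed.

Lemma time_measurable_itv h (t : R) : time_measurable h ->
  measurable_fun `[0, t]%classic (fun s => expect s h).
Proof.
apply: measurable_funS => // s /=; rewrite !in_itv/= andbT.
by move=> /andP[].
Qed.

Lemma norm_cvg_le (u : nat -> R) (l K : R) : u @ \oo --> l -> (forall n, `|u n| <= K) -> `|l| <= K.
Proof.
move=> /cvg_norm c uK; rewrite -(cvg_lim _ c)//.
apply: limr_le; first by apply/cvg_ex; eexists; exact: c.
exact: nearW.
Qed.

(** For the test function [collf b e * theta M] both boundary terms of Dynkin's formula are of order
    [e], while the integrand converges boundedly to the expectation of [theta M * collisions]. *)
Lemma null_collisions (M t : R) : 0 < M -> 0 <= t ->
  [/\ integrable_at (fun y => theta M y * collisions b y),
      leb.-integrable `[0, t]%classic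
        (EFin \o (fun s => expect s (fun y => theta M y * collisions b y))) &
      Rintegral leb `[0, t]%classic (fun s => expect s (fun y => theta M y * collisions b y)) = 0].
Proof.
move=> M0 t0; have [H H0 hH] := coll_hessian_bounded N b M0.
pose e n : R := n.+1%:R^-1.
have e0 n : 0 < e n by rewrite invr_gt0 ltr0n.
have e1 n : e n <= 1 by rewrite invf_le1 ?ltr0n// ler1n.
pose f n (y : V) := collf b (e n) y * theta M y.
have df n : dom b (f n) by exact: dom_coll.
pose q (y : V) := theta M y * collisions b y.
pose K := gen_cst N k1 k2 * H.
have Lf n y : `|L (f n) y| <= K.
  by apply: gen_bound => // [|i j z]; [exact: odd_ker_inv|exact: hH].
have mLf n : measurable_fun setT (L (f n)).
  by have [fC2 _ _ _] := df n; exact: measurable_gen_inv.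
have cq y : (fun n => L (f n) y) @ \oo --> q y by exact: cvg_gen_coll.
have mq : measurable_fun setT q.
  by apply: (@measurable_fun_cvg _ _ _ _ (fun n => L (f n))) => // y _; exact: cq.
have qK y : `|q y| <= K by exact: norm_cvg_le (cq y) _.
have iq : integrable_at q by exact: (@integrable_at_bounded q K).
have [|||m_ c_] := @Rintegral_itv_dominated R (fun n s => expect s (L (f n))) (fun s => expect s q) t K.
- by move=> n; apply: time_measurable_itv; exact: time_measurable_gen.
- by move=> n s /andP[s0 _]; exact: expect_bound.
- move=> s /andP[s0 _].
  have iK : (mu s).-integrable setT (EFin \o (fun=> K)) by exact: eintegrable_cst.
  by have [] := expect_dominated mS (muS s0) mLf mq (fun y _ => cq y) iK (fun n y _ => Lf n y).
split=> //.
  by apply: (@integrable_itv_bounded R _ t K) => // s /andP[s0 _]; exact: (@expect_bound s q K).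
pose B := N%:R * (N%:R * 2) : R.
have fB n y : `|f n y| <= B * e n.
  rewrite normrM (ger0_norm (proj1 (andP (theta_01 y M0)))) -[leRHS]mulr1 ler_pM//.
  - by have /andP[] := theta_01 y M0.
  - by rewrite (le_trans (collf_bound b y (e0 n)))// /B !mulrA.
  - by have /andP[] := theta_01 y M0.
have c0 : (fun n => Rintegral leb `[0, t]%classic (fun s => expect s (L (f n)))) @ \oo --> (0 : R).
  apply/cvgrPdist_le => d d0; near=> n; rewrite sub0r normrN.
  have -> : Rintegral leb `[0, t]%classic (fun s => expect s (L (f n))) = expect t (f n) - f n x.
    by rewrite /expect Hmu.2// addrAC subrr add0r.
  apply: (@le_trans _ _ ((B + B) * e n)).
    rewrite mulrDl (le_trans (ler_normB _ _))// lerD//.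
    by apply: expect_bound => //; apply: measurable_continuous; have [[]] := df n.
  near: n; have : (fun n => (B + B) * e n) @ \oo --> (0 : R).
    rewrite -[X in _ --> X](mulr0 (B + B)); apply: cvgM; first exact: cvg_cst.
    exact: cvg_harmonic.
  move=> /cvgrPdist_le/(_ _ d0); apply: filterS => n; rewrite sub0r normrN.
  by apply: le_trans; exact: ler_norm.
exact: (cvg_unique _ c_ c0).
Unshelve. all: by end_near.
Qed.

(** On the walls with [|y| <= M0] the function [theta M * collisions] is at least [8^-1], so [8 * K]
    times it dominates [|h|] everywhere. *)
Lemma null_integral h (M0 K t : R) : 0 <= t -> measurable_fun setT h -> time_measurable h ->
  (forall y, `|h y| <= K) -> (forall y, M0 < `|y| -> h y = 0) ->
  (forall y, regular b y -> h y = 0) ->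
  Rintegral leb `[0, t]%classic (fun s => expect s h) = 0.
Proof.
move=> t0 mh th hK h0 hr; pose M := 2 * (N%:R * M0 ^+ 2 + 1).
have Mp : 0 < M by rewrite mulr_gt0// ltr_wpDl// mulr_ge0 ?sqr_ge0.
have K0 : 0 <= K by exact: le_trans (normr_ge0 _) (hK 0).
have [iq iiq q0] := null_collisions Mp t0.
have ih : integrable_at h by exact: (@integrable_at_bounded h K).
have hq y : `|h y| <= 8 * K * (theta M y * collisions b y).
  have /andP[t01 _] := theta_01 y Mp; have c0 := collisions_ge0 b y.
  have tc0 : 0 <= 8 * K * (theta M y * collisions b y).
    exact: mulr_ge0 (mulr_ge0 (ler0n R 8) K0) (mulr_ge0 t01 c0).
  have [ry|nr] := pselect (regular b y).
    by rewrite (hr _ ry) normr0.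
  have [yM|My] := leP `|y| M0; last by rewrite h0// normr0.
  have te := theta_ge_eighth yM; have c1 := collisions_ge1 nr.
  apply: (le_trans (hK y)); rewrite mulrAC ler_peMl//.
  have : 8^-1 * 1 <= theta M y * collisions b y by apply: ler_pM.
  by lra.
apply/eqP; rewrite -normr_le0.
have im : leb.-integrable `[0, t]%classic (EFin \o (fun s => expect s h)).
  apply: (@integrable_itv_bounded R _ t K); first exact: time_measurable_itv.
  by move=> s /andP[s0 _]; exact: expect_bound.
apply: le_trans (le_normr_Rintegral _ im) _ => //.
rewrite -[leRHS](mulr0 (8 * K)) -[in leRHS]q0 -RintegralZl//.
apply: le_Rintegral => //.
- by have := integrable_abse im; apply: eq_integrable.
- by apply: eq_integrable (integrableZl _ (8 * K) iiq).
move=> s /=; rewrite in_itv/= => /andP[s0 _]; rewrite -expectZ//.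
apply: (expect_normr_le mS (muS s0)) => //; first exact: ih.
exact: (integrable_atZ (8 * K) iq).
Qed.

(** Induction, through Dynkin's formula for the truncated power. With [c] the moment constant and
    [p] the initial value, the factor [c (m+1)^2] of the generator bound and the induction
    hypothesis combine to [(m+1)!] times the derivative of [(p + c s)^(m+1)], which integrates
    exactly. Fatou's lemma removes the cutoff. *)
Lemma moment_bound m s : 0 <= s ->
  (mu s).-integrable setT (EFin \o (fun y : V => psum 2 y ^+ m)) /\
  expect s (fun y => psum 2 y ^+ m) <= m`!%:R * (psum 2 x + moment_cst N k1 k2 * s) ^+ m.
Proof.
set c := moment_cst _ _ _; set p := psum 2 x.
have c0 : 0 < c by exact: moment_cst_gt0.
have p0 : 0 <= p by exact: psum2_ge0.
have cE : c = moment_cst N k1 k2 by [].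
have pE : p = psum 2 x by [].
clearbody c p; elim: m s => [|m IH] t t0.
  split; first exact: eintegrable_cst.
  by rewrite /expect expect_cst expr0 mulr1.
pose f n (y : V) := psum 2 y ^+ m.+1 * theta n.+1%:R y.
have fE n : f n = pprod_cut (nseq m.+1 2%N) n.+1%:R.
  by apply/funext => y; rewrite /f /pprod_cut pprod_nseq2.
have df n : dom b (f n).
  rewrite fE; apply: dom_pprod_cut => // _.
  by rewrite /evens all_nseq orbT.
have mp k : measurable_fun [set: V] (fun y : V => psum 2 y ^+ k).
  apply: measurable_continuous; have -> : (fun y : V => psum 2 y ^+ k) = pprod (nseq k 2%N).
    by apply/funext => y; rewrite pprod_nseq2.
  by have [j _ _] := jet2_pprod R N (nseq k 2%N); exact: jet1_continuous j.
have f0 n y : 0 <= f n y.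
  by apply: mulr_ge0; [rewrite exprn_ge0 ?psum2_ge0|have /andP[] := @theta_01 n.+1%:R y (ltr0Sn _ _)].
pose P : {poly R} := (p%:P + c *: 'X) ^+ m.+1.
have PE s : P.[s] = (p + c * s) ^+ m.+1.
  by rewrite /P horner_exp hornerD hornerC hornerZ hornerX.
have dPE s : (deriv P).[s] = m.+1%:R * c * (p + c * s) ^+ m.
  rewrite /P deriv_exp derivD derivC derivZ derivX add0r hornerMn hornerM !hornerE /=.
  by rewrite -[_ *+ m.+1]mulr_natl mulrA.
have fb n : expect t (f n) <= m.+1`!%:R * (p + c * t) ^+ m.+1.
  have -> : expect t (f n) = f n x + Rintegral leb `[0, t]%classic (fun s => expect s (L (f n))).
    exact: Hmu.2.
  have fx : f n x <= p ^+ m.+1.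
    rewrite pE ler_piMr ?exprn_ge0 ?psum2_ge0//.
    by have /andP[] := @theta_01 n.+1%:R x (ltr0Sn _ _).
  (* [P.[0]] is [p ^+ m.+1], so the initial value is absorbed because the factorial is at least
     1. *)
  apply: (@le_trans _ _ (p ^+ m.+1 + m.+1`!%:R * (P.[t] - P.[0]))); last first.
    rewrite !PE mulr0 addr0 mulrBr addrCA gerDl subr_le0 ler_peMl ?exprn_ge0//.
    by rewrite ler1n fact_gt0.
  apply: lerD => //; rewrite -Rintegral_deriv//.
  have cP : continuous (fun s => (deriv P).[s]) by exact: continuous_horner.
  have [K K0 hK] : exists2 K : R, 0 <= K & forall s, 0 <= s <= t -> `|(deriv P).[s]| <= K.
    exists (m.+1%:R * c * (p + c * t) ^+ m).
      by rewrite !mulr_ge0 ?exprn_ge0 ?addr_ge0 ?mulr_ge0// ltW.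
    move=> s /andP[s0 st]; have cs0 : 0 <= c * s by rewrite mulr_ge0// ltW.
    rewrite dPE ger0_norm; last by rewrite !mulr_ge0 ?exprn_ge0 ?addr_ge0// ltW.
    rewrite ler_wpM2l ?mulr_ge0// ?(ltW c0)// lerXn2r ?nnegrE ?addr_ge0//.
      by rewrite mulr_ge0// ltW.
    by rewrite lerD2l ler_pM2l.
  have iP : leb.-integrable `[0, t]%classic (EFin \o (fun s => (deriv P).[s])).
    apply: (@integrable_itv_bounded R _ t K) => //.
    by apply: measurable_funS (continuous_measurable_fun cP).
  rewrite -RintegralZl//; apply: le_Rintegral => //.
  - have [H H0 hH] := dom_hessian_bounded (df n).
    apply: (@integrable_itv_bounded R _ t (gen_cst N k1 k2 * H)).
      by apply: time_measurable_itv; exact: time_measurable_gen.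
    move=> s /andP[s0 _]; apply: expect_bound => //.
      by have [fC2 _ _ _] := df n; exact: measurable_gen_inv.
    by move=> y _; apply: gen_bound => //; exact: odd_ker_inv.
  - by apply: eq_integrable (integrableZl _ _ iP).
  move=> s /=; rewrite in_itv/= => /andP[s0 _]; have [i1 b1] := IH s s0.
  have C0 : 0 <= c * m.+1%:R ^+ 2 by rewrite mulr_ge0 ?exprn_ge0// ltW.
  apply: (@le_trans _ _ (c * m.+1%:R ^+ 2 * expect s (fun y => psum 2 y ^+ m))).
    rewrite /expect -RintegralZl//.
    apply: le_trans (ler_norm _) (expect_normr_le mS (muS s0) _ _ _).
    - by have := integrable_at_gen (df n); apply.
    - by apply: eq_integrable (integrableZl measurableT (c * m.+1%:R ^+ 2) i1).
    - by move=> y _; rewrite cE; apply: gen_pow_cut_bound => //; exact: odd_ker_inv.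
  apply: le_trans (ler_wpM2l C0 b1) _; rewrite dPE factS natrM le_eqVlt; apply/orP; left.
  by apply/eqP; ring.
apply: (@expect_fatou _ _ _ (mu t) f) => //.
- by move=> n; have := integrable_at_dom (df n); apply.
- move=> y; rewrite /f -[X in _ --> X]mulr1; apply: cvgM; first exact: cvg_cst.
  exact: cvg_cut.
Qed.

Lemma polyb_expect h (t : R) : measurable_fun setT h -> polyb h ->
  integrable_at h /\ exists K, forall s, 0 <= s <= t -> `|expect s h| <= K.
Proof.
move=> mh [[C k] /= C0 hC].
pose q (y : V) := C * 2 ^+ k * (1 + psum 2 y ^+ k).
have hq y : `|h y| <= q y.
  apply: le_trans (hC y) _; rewrite /q -mulrA ler_wpM2l//.
  have p0 := psum2_ge0 y; set p := psum 2 y in p0 *.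
  have pk : 0 <= p ^+ k by rewrite exprn_ge0.
  have e2 : 1 <= 2 ^+ k :> R by rewrite exprn_ege1// ler1n.
  have [p1|/ltW p1] := leP p 1.
    apply: (@le_trans _ _ (2 ^+ k)); last by rewrite ler_peMr ?lerDl// (le_trans ler01).
    by rewrite lerXn2r ?nnegrE ?addr_ge0//; lra.
  apply: (@le_trans _ _ ((2 * p) ^+ k)).
    by rewrite lerXn2r ?nnegrE ?addr_ge0 ?mulr_ge0//; lra.
  by rewrite exprMn ler_wpM2l ?lerDr// (le_trans ler01).
have D0 : 0 <= C * 2 ^+ k by rewrite mulr_ge0// exprn_ge0.
have ip : integrable_at (fun y => psum 2 y ^+ k) by move=> s s0; have [] := moment_bound k s0.
have iq1 : integrable_at (fun y => 1 + psum 2 y ^+ k).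
  by apply: integrable_atD => // s s0; exact: eintegrable_cst.
have iq : integrable_at q by exact: integrable_atZ.
have ih : integrable_at h.
  by move=> s s0; apply: (eintegrable_le mS (muS s0) mh (iq s s0)) => y _; exact: hq.
split=> //; exists (C * 2 ^+ k * (1 + k`!%:R * (psum 2 x + moment_cst N k1 k2 * t) ^+ k)).
move=> s /andP[s0 st].
apply: le_trans (expect_normr_le mS (muS s0) (ih s s0) (iq s s0) (fun y _ => hq y)) _.
rewrite -/(expect s q) /q expectZ// ler_wpM2l// expectD//; last first.
  by move=> ? ?; exact: eintegrable_cst.
rewrite {1}/expect expect_cst lerD2l.
have [_ b1] := moment_bound k s0; apply: le_trans b1 _; rewrite ler_wpM2l//.
have c0 := moment_cst_gt0 N k1 k2; have p0 := psum2_ge0 x.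
rewrite lerXn2r ?nnegrE ?addr_ge0// ?(mulr_ge0 (ltW c0))//; first exact: le_trans st.
by rewrite lerD2l ler_pM2l.
Qed.

(** [F] replaces [L f] across the walls, where it is continuous; the integrals agree because no time
    is spent there. The cutoff terms are bounded uniformly in the level and tend to 0, and the
    moment bounds provide the domination. *)
Lemma dynkin_poly (f : V -> R) (g : 'I_N -> V -> R) (h : 'I_N -> 'I_N -> V -> R) (F : V -> R) :
  jet2 f g h -> perm_invariant f -> (b -> sign_invariant f) ->
  polyb f -> polyb (fun y => \sum_(i < N) g i y * y ord0 i) -> continuous F -> polyb F ->
  (forall y, regular b y -> L f y = F y) ->
  forall t, 0 <= t -> expect t f = f x + Rintegral leb `[0, t]%classic (fun s => expect s F).
Proof.
move=> jf pf sf bf bg cF bF hF t t0.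
have [[[_ _] j2 _] cf] := (jf, jet1_continuous (let: And3 j _ _ := jf in j)).
have cg : continuous (fun y => \sum_(i < N) g i y * y ord0 i).
  apply: continuous_bigsum => i _; apply: continuous_mul; last exact: continuous_coord.
  exact: jet1_continuous (j2 i).
set A : V -> R := fun y => \sum_(i < N) g i y * y ord0 i in bg cg.
pose K := N%:R + 2 * drift_cst N b k1 k2.
pose M n : R := n.+1%:R.
have M0 n : 0 < M n by rewrite ltr0n.
have M1 n (a : R) : 0 <= a -> a / M n <= a.
  by move=> a0; rewrite ler_pdivrMr// ler_peMr// ler1n.
pose fn n (y : V) := f y * theta (M n) y.
(* The right-hand side of [gen_mul_theta] with [F] in place of [L f]. Being continuous with compact
   support, it has expectations measurable in time, and it differs from [L (fn n)] only on the
   walls. *)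
pose Phi n (y : V) := theta (M n) y * F y + f y * (2 * (psum 2 y * ddcut (M n) (psum 2 y)) +
  K * dcut (M n) (psum 2 y)) + 2 * dcut (M n) (psum 2 y) * A y.
have dfn n : dom b (fn n) by exact: dom_mul_theta (M0 n) jf pf sf.
(* 6 and 3 are the constants of [ddcut_bound] and [dcut_bound], the level [M n] being at least 1. *)
pose q (y : V) : R := `|F y| + `|f y| * (2 * 6 + `|K| * 3) + 2 * 3 * `|A y|.
have abs_b (G : V -> R) : polyb G -> polyb (fun y => `|G y|).
  by move=> [p p0 hp]; exists p => // y; rewrite normr_id.
have bq : polyb q.
  have b3 := polybM (polyb_cst N (2 * 3 : R)) (abs_b _ bg).
  exact: polybD (polybD (abs_b _ bF) (polybM (abs_b _ bf) (polyb_cst N (2 * 6 + `|K| * 3)))) b3.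
have cabs (G : V -> R) : continuous G -> continuous (fun y => `|G y|).
  by move=> cG y; apply: continuous_comp (cG y) _; exact: norm_continuous.
have cstc (a : R) : continuous (fun _ : V => a) by exact: cst_continuous.
have cq : continuous q.
  apply: continuous_add; last by apply: continuous_mul => //; exact: cabs.
  apply: continuous_add; first exact: cabs.
  by apply: continuous_mul => //; exact: cabs.
have [iq [Kq hKq]] := polyb_expect t (measurable_continuous cq) bq.
have Phiq n y : `|Phi n y| <= q y.
  have /andP[th0 th1] := theta_01 y (M0 n).
  have d1 := le_trans (dcut_bound (M0 n) (psum2_ge0 y)) (M1 n 3 (ler0n _ _)).
  have d2 := le_trans (ddcut_bound (M0 n) (psum2_ge0 y)) (M1 n 6 (ler0n _ _)).
  rewrite /Phi /q (le_trans (ler_normD _ _))// lerD//; last first.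
    by rewrite normrM ler_wpM2r// normrM (@ger0_norm _ 2)// ler_wpM2l.
  rewrite (le_trans (ler_normD _ _))// lerD//.
    by rewrite normrM (ger0_norm th0) ler_piMl.
  rewrite normrM ler_wpM2l// (le_trans (ler_normD _ _))// lerD//.
    by rewrite normrM (@ger0_norm _ 2)// ler_wpM2l.
  by rewrite normrM ler_wpM2l.
have cPhi n : continuous (Phi n).
  have cp := jet1_continuous (let: And3 j _ _ := jet2_psum2 R N in j).
  have cc (w : R -> R) : continuous w -> continuous (fun y : V => w (psum 2 y)).
    by move=> cw; exact: continuous_fcomp.
  have cd (u du : R -> R) : (forall u0 : R, is_derive u0 1 u (du u0)) -> continuous u.
    by move=> hu u0; apply: differentiable_continuous; apply/derivable1_diffP; case: (hu u0).
  have c1 := cc _ (cd _ _ (is_derive_dcut (M n))); have c2 := cc _ (@continuous_ddcut R (M n)).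
  apply: continuous_add; last by apply: continuous_mul => //; exact: continuous_mul.
  apply: continuous_add; first by apply: continuous_mul => //; exact: theta_continuous.
  apply: continuous_mul => //; apply: continuous_add; apply: continuous_mul => //.
  exact: continuous_mul.
have Phi0 n y : M n + 1 < `|y| -> Phi n y = 0.
  move=> My; have My2 : M n <= psum 2 y.
    have y1 : 1 <= `|y| by have := M0 n; lra.
    by apply: le_trans (ler_norm_psum2 _); rewrite expr2 (le_trans _ (ler_peMl _ y1))//; lra.
  rewrite /Phi theta_support// /dcut /ddcut pos_cut_0// ?psum2_ge0//.
  by rewrite expr0n /=; ring.
have tPhi n : time_measurable (Phi n).
  by apply: time_measurable_continuous => //; exists (M n + 1); exact: Phi0.
have null n : Rintegral leb `[0, t]%classic (fun s => expect s (L (fn n))) =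
    Rintegral leb `[0, t]%classic (fun s => expect s (Phi n)).
  have [H H0 hH] := dom_hessian_bounded (dfn n).
  have [KP KP0 hKP] := compact_support_bounded (cPhi n) (ex_intro _ _ (Phi0 n)).
  have bL y : `|L (fn n) y| <= gen_cst N k1 k2 * H.
    by apply: gen_bound => //; exact: odd_ker_inv.
  have [fC2 _ _ _] := dfn n; have mL := measurable_gen_inv fC2.
  have mPhi := measurable_continuous (cPhi n).
  have iL : integrable_at (L (fn n)) by exact: integrable_at_gen.
  have iPhi : integrable_at (Phi n) by exact: (@integrable_at_bounded _ KP).
  pose D y := L (fn n) y + (-1) * Phi n y.
  have iPhi1 := integrable_atZ (-1) iPhi.
  have ED s : 0 <= s -> expect s D = expect s (L (fn n)) - expect s (Phi n).
    by move=> s0; rewrite /D expectD// expectZ// mulN1r.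
  have tL := time_measurable_gen (dfn n).
  have tD : time_measurable D.
    have : measurable_fun `[(0 : R), +oo[%classic (fun s => expect s (L (fn n)) - expect s (Phi n)).
      by apply: measurable_funB; [exact: tL|exact: tPhi].
    by apply: eq_measurable_fun => s; rewrite inE /= in_itv/= andbT => s0; rewrite ED.
  have int u (B : R) : time_measurable u -> measurable_fun setT u -> (forall y, `|u y| <= B) ->
      leb.-integrable `[0, t]%classic (EFin \o (fun s => expect s u)).
    move=> tu mu' uB; apply: (@integrable_itv_bounded R _ t B); first exact: time_measurable_itv.
    by move=> s /andP[s0 _]; exact: expect_bound.
  have : Rintegral leb `[0, t]%classic (fun s => expect s D) = 0.
    have [B hB] : compact_support (L (fn n)) by apply: gen_compact_support; have [] := dfn n.
    apply: (@null_integral D (Num.max B (M n + 1)) (gen_cst N k1 k2 * H + KP)) => //.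
    - by apply: measurable_funD => //; apply: measurable_funM => //; exact: measurable_cst.
    - by move=> y; rewrite /D mulN1r (le_trans (ler_normB _ _))// lerD.
    - by move=> y; rewrite gt_max => /andP[By My]; rewrite /D Phi0// hB// mulr0 addr0.
    - move=> y ry; rewrite /D (gen_mul_theta k1 k2 (M n) jf ry) hF// mulN1r; exact: subrr.
  rewrite (@eq_Rintegral _ _ _ leb _ (fun s => expect s (L (fn n)) - expect s (Phi n))); last first.
    by move=> s; rewrite inE /= in_itv/= => /andP[s0 _]; exact: ED.
  rewrite RintegralB//; first by move=> /eqP; rewrite subr_eq0 => /eqP.
  - exact: int bL.
  - exact: int hKP.
have cPhiF y : (fun n => Phi n y) @ \oo --> F y.
  have z (a : R) : (fun n => a / M n) @ \oo --> (0 : R).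
    rewrite -(mulr0 a); apply: cvgM; first exact: cvg_cst.
    exact: cvg_harmonic.
  have sq0 (u : nat -> R) (a : R) : (forall n, `|u n| <= a / M n) -> u @ \oo --> (0 : R).
    move=> ub; apply/cvgrPdist_le => e e0; have /cvgrPdist_le/(_ _ e0) := z a.
    by apply: filterS => n; rewrite !sub0r !normrN; apply: le_trans; exact: le_trans (ub n) (ler_norm _).
  have z1 := sq0 _ _ (fun n => dcut_bound (M0 n) (psum2_ge0 y)).
  have z2 := sq0 _ _ (fun n => ddcut_bound (M0 n) (psum2_ge0 y)).
  have -> : F y = 1 * F y + f y * (2 * 0 + K * 0) + 2 * 0 * A y by ring.
  apply: cvgD; last first.
    by apply: cvgM (cvg_cst _); apply: cvgM z1; exact: cvg_cst.
  apply: cvgD; first by apply: cvgM (cvg_cst _); exact: cvg_cut.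
  apply: cvgM; first exact: cvg_cst.
  by apply: cvgD; apply: cvgM => //; exact: cvg_cst.
have cE s : 0 <= s -> (fun n => expect s (Phi n)) @ \oo --> expect s F.
  move=> s0; have [] := expect_dominated mS (muS s0) (fun n => measurable_continuous (cPhi n))
    (measurable_continuous cF) (fun y _ => cPhiF y) (iq s s0) (fun n y _ => Phiq n y).
  by [].
have [|||_ cI] := @Rintegral_itv_dominated R (fun n s => expect s (Phi n)) (fun s => expect s F) t Kq.
- by move=> n; exact: time_measurable_itv.
- move=> n s st; have /andP[s0 _] := st; apply: le_trans (hKq s st); apply: le_trans (ler_norm _).
  apply: (expect_normr_le mS (muS s0)) => //; last exact: iq.
  by apply: (eintegrable_le mS (muS s0) _ (iq s s0)) => //; exact: measurable_continuous.
- by move=> s /andP[s0 _]; exact: cE.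
have cfn y : (fun n => fn n y) @ \oo --> f y.
  by rewrite -[X in _ --> X]mulr1; apply: cvgM; [exact: cvg_cst|exact: cvg_cut].

have mabs := measurable_continuous (cabs _ cf).
have [iaf _] := polyb_expect t mabs (abs_b _ bf).
have fnf n y : `|fn n y| <= `|f y|.
  by have /andP[th0 th1] := theta_01 y (M0 n); rewrite normrM (ger0_norm th0) ler_piMr.
have [_ cEf] := expect_dominated mS (muS t0)
  (fun n => measurable_continuous (let: conj c _ := (let: And4 C _ _ _ := dfn n in C) in c))
  (measurable_continuous cf) (fun y _ => cfn y) (iaf t t0) (fun n y _ => fnf n y).
have c2 : (fun n => expect t (fn n)) @ \oo -->
    f x + Rintegral leb `[0, t]%classic (fun s => expect s F).
  have -> : (fun n => expect t (fn n)) =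
      (fun n => fn n x + Rintegral leb `[0, t]%classic (fun s => expect s (Phi n))).
    by apply/funext => n; rewrite -null; exact: Hmu.2.
  exact: cvgD.
exact: (cvg_unique _ cEf c2).
Qed.

End Diffusion.

(** * Moments as polynomials in time *)

Section MomentPolynomials.
Variable R : realType.
Local Notation leb := (@lebesgue_measure R).

Definition lincomb (P : seq (R * seq nat)) (e : seq nat -> R) : R := \sum_(c <- P) c.1 * e c.2.

Lemma poly_eq_nneg (P Q : {poly R}) : (forall t, 0 <= t -> P.[t] = Q.[t]) -> P = Q.
Proof.
move=> PQ; apply/eqP; rewrite -subr_eq0; apply/negPn/negP => h.
have := @max_poly_roots _ (P - Q) [seq n%:R | n <- iota 0 (size (P - Q))] h.
rewrite size_map size_iota ltnn => H; have : false; last by [].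
apply: H; last by rewrite map_inj_uniq ?iota_uniq// => m n /eqP; rewrite eqr_nat => /eqP.
apply/allP => _ /mapP[n _ ->]; rewrite /root !hornerE PQ ?subrr//.
Qed.

Lemma poly_integral_uniq (P q : {poly R}) (a : R) :
  (forall t, 0 <= t -> P.[t] = a + Rintegral leb `[0, t]%classic (fun s => q.[s])) ->
  deriv P = q /\ P.[0] = a.
Proof.
move=> h; have [Q [dQ Q0]] := poly_antiderivative q a.
suff -> : P = Q by [].
apply: poly_eq_nneg => t t0; rewrite h// -dQ Rintegral_deriv// Q0.
by rewrite addrCA subrr addr0.
Qed.

(** As [P s] involves only lists of smaller weight, induction presents each moment as the integral
    of a polynomial. Polynomials that agree on [t >= 0] are equal, so the derivative relation holds
    as an identity of polynomials. *)
Lemma moment_polys (e : R -> seq nat -> R) (e0 : seq nat -> R)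
    (P : seq nat -> seq (R * seq nat)) :
  (forall s, all (fun c => wlt (sumn s) c.2) (P s)) ->
  (forall s t, 0 <= t -> e t s = e0 s + Rintegral leb `[0, t]%classic (fun u => lincomb (P s) (e u))) ->
  exists M : seq nat -> {poly R}, forall s,
    [/\ forall t, 0 <= t -> e t s = (M s).[t],
        deriv (M s) = \sum_(c <- P s) c.1 *: M c.2 & (M s).[0] = e0 s].
Proof.
move=> wP eP.
have ex n : forall s, (sumn s < n)%N -> exists Q : {poly R}, forall t, 0 <= t -> e t s = Q.[t].
  elim: n => // n IH s sn.
  have [q hq] : exists q : {poly R}, forall u, 0 <= u -> lincomb (P s) (e u) = q.[u].
    have := wP s; rewrite /lincomb; elim: (P s) => [_|c r IHr /= /andP[wc wr]].
      by exists 0 => u _; rewrite big_nil horner0.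
    have [q1 h1] := IHr wr; have [q2 h2] := IH c.2 (leq_trans wc sn).
    by exists (c.1 *: q2 + q1) => u u0; rewrite big_cons h1// h2// hornerD hornerZ.
  have [Q [dQ Q0]] := poly_antiderivative q (e0 s); exists Q => t t0.
  rewrite eP// -Q0 -[LHS]addr0 (@eq_Rintegral _ _ _ leb _ (fun u => q.[u])).
    by rewrite -dQ Rintegral_deriv// addr0 addrCA subrr addr0.
  by move=> u; rewrite inE /= in_itv/= => /andP[u0 _]; exact: hq.
have /choice[M hM] s : exists Q : {poly R}, forall t, 0 <= t -> e t s = Q.[t].
  exact: ex (ltnSn (sumn s)).
exists M => s.
suff [h1 h2] : deriv (M s) = \sum_(c <- P s) c.1 *: M c.2 /\ (M s).[0] = e0 s.
  by split => //; exact: hM.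
apply: poly_integral_uniq => t t0; rewrite -hM// eP//; congr (_ + _).
apply: eq_Rintegral => u; rewrite inE /= in_itv/= => /andP[u0 _].
rewrite /lincomb horner_sum; apply: eq_bigr => c _; by rewrite hornerZ hM.
Qed.

End MomentPolynomials.

(** * Moment equations for both types *)

Section PowerSumMoments.
Variables (R : realType) (N : nat) (b : bool) (k1 k2 : R) (x : 'rV[R]_N).
Variable mu : R -> probability 'rV[R]_N R.
Local Notation V := 'rV[R]_N.
Local Notation leb := (@lebesgue_measure R).
Hypothesis Hmu : diffusion_marginals (chamber b) (gen GRing.inv b k1 k2) (dom b) x mu.

Section Substitution.
Variable W : V -> V.
Hypotheses (cW : continuous W) (bW : forall i, polyb (fun y => W y ord0 i)).

Lemma pprod_comp_continuous s : continuous (fun y => pprod s (W y)).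
Proof.
move=> y; apply: (@continuous_comp _ _ _ W (@pprod R N s)); first exact: cW.
by have [j _ _] := jet2_pprod R N s; exact: (jet1_continuous j).
Qed.

Lemma expect_lincomb (P : seq (R * seq nat)) u : 0 <= u ->
  expect mu u (fun y => lincomb P (fun s => pprod s (W y))) =
  lincomb P (fun s => expect mu u (fun y => pprod s (W y))).
Proof.
move=> u0.
have iW s : integrable_at mu (fun y => pprod s (W y)).
  have mW := measurable_continuous (@pprod_comp_continuous s).
  by have [] := polyb_expect Hmu 0 mW (polyb_pprod bW s).
have [_ h] := expect_sum Hmu P (fun c => c.1) u0 (fun c : R * seq nat => iW c.2).
exact: h.
Qed.

Lemma lincomb_continuous (P : seq (R * seq nat)) : continuous (fun y => lincomb P (fun s => pprod s (W y))).
Proof.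
apply: continuous_bigsum => c _; apply: continuous_mul; first exact: cst_continuous.
exact: pprod_comp_continuous.
Qed.

Lemma polyb_lincomb (P : seq (R * seq nat)) : polyb (fun y => lincomb P (fun s => pprod s (W y))).
Proof. by apply: polyb_sum => c; apply: polybM (polyb_cst _ _) _; exact: polyb_pprod. Qed.

End Substitution.

Lemma dynkin_lincomb (W : V -> V) g h s (P : seq (R * seq nat)) : continuous W ->
  (forall i, polyb (fun y => W y ord0 i)) ->
  jet2 (fun y => pprod s (W y)) g h -> perm_invariant (fun y => pprod s (W y)) ->
  (b -> sign_invariant (fun y => pprod s (W y))) ->
  polyb (fun y => \sum_(i < N) g i y * y ord0 i) ->
  (forall y, regular b y -> gen GRing.inv b k1 k2 (fun y => pprod s (W y)) y =
     lincomb P (fun s => pprod s (W y))) ->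
  forall t, 0 <= t -> expect mu t (fun y => pprod s (W y)) = pprod s (W x) +
    Rintegral leb `[0, t]%classic
      (fun u => lincomb P (fun s => expect mu u (fun y => pprod s (W y)))).
Proof.
move=> cW bW js ps ss bg hP t t0.
have := dynkin_poly Hmu js ps ss (polyb_pprod bW s) bg (@lincomb_continuous W cW P)
  (@polyb_lincomb W bW P) hP t0.
move=> ->; congr (_ + _); apply: eq_Rintegral => u; rewrite inE /= in_itv/= => /andP[u0 _].
exact: expect_lincomb.
Qed.

End PowerSumMoments.

Section OperatorLists.
Variables (R : realType) (N : nat).
Local Notation V := 'rV[R]_N.

(** The list is chosen for the operator, independently of any process: one and the same list serves
    the type A process and the leading part in type B, which makes the limiting equations
    identical. *)
Lemma opO_lincomb a e beta k : (e <= 1)%N -> exists P : seq nat -> seq (R * seq nat), forall s,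
  all (fun c => wlt (sumn s) c.2) (P s) /\
  forall y : V, distinct y -> opO a e beta k s y = lincomb (P s) (fun s => pprod s y).
Proof.
move=> e1; suff /choice[P hP] s : exists P : seq (R * seq nat), all (fun c => wlt (sumn s) c.2) P /\
    forall y : V, distinct y -> opO a e beta k s y = lincomb P (fun s => pprod s y) by exists P.
have [F [[P [wP PF]] hF]] := @sympoly_opO R N a e beta k s e1.
by exists P; split=> // y dy; rewrite hF// PF.
Qed.

Lemma gpp_lincomb : exists P : seq nat -> seq (R * seq nat), forall s,
  all (fun c => wlt (sumn s) c.2) (P s) /\
  forall y : V, \sum_(i < N) gpp s i y = lincomb (P s) (fun s => pprod s y).
Proof.
suff /choice[P hP] s : exists P : seq (R * seq nat), all (fun c => wlt (sumn s) c.2) P /\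
    forall y : V, \sum_(i < N) gpp s i y = lincomb P (fun s => pprod s y) by exists P.
have [P [wP PF]] := @sympoly_gpp R N 0 s.
exists P; split=> // y; rewrite /lincomb -PF; apply: eq_bigr => i _.
by rewrite expr0 mul1r.
Qed.

Lemma opO_gpp k s (y : V) : opO 0 0 1 k s y = \sum_(i < N) gpp s i y.
Proof.
rewrite /opO mul1r [X in X + _ + _]big1; last by move=> i _; rewrite !mul0r.
rewrite [X in _ * X]big1 ?mulr0 ?add0r ?addr0// => i _.
by rewrite big1// => j _; rewrite !mul0r.
Qed.

Lemma lincomb_cat (P Q : seq (R * seq nat)) e : lincomb (P ++ Q) e = lincomb P e + lincomb Q e.
Proof. by rewrite /lincomb big_cat. Qed.

Lemma lincomb_scale a (P : seq (R * seq nat)) e :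
  lincomb [seq (a * c.1, c.2) | c <- P] e = a * lincomb P e.
Proof. by rewrite /lincomb big_map mulr_sumr; apply: eq_bigr => c _; rewrite mulrA. Qed.

End OperatorLists.

Lemma momentsA (R : realType) (N : nat) (k : R) (x : 'rV[R]_N) (mu : R -> probability 'rV[R]_N R)
    (P : seq nat -> seq (R * seq nat)) :
  diffusion_marginals (chamber false) (gen GRing.inv false 0 k) (dom false) x mu ->
  (forall s, all (fun c => wlt (sumn s) c.2) (P s) /\
     forall y : 'rV[R]_N, distinct y -> opO 2^-1 0 0 k s y = lincomb (P s) (fun s => pprod s y)) ->
  exists M : seq nat -> {poly R}, forall s,
    [/\ forall t, 0 <= t -> expect mu t (fun y => pprod s y) = (M s).[t],
        deriv (M s) = \sum_(c <- P s) c.1 *: M c.2 & (M s).[0] = pprod s x].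
Proof.
move=> Hmu hP.
apply: (@moment_polys R (fun t s => expect mu t (fun y => pprod s y)) (fun s => pprod s x) P).
  by move=> s; have [] := hP s.
move=> s t t0; apply: (@dynkin_lincomb R N false 0 k x mu Hmu id _ _ s (P s)) t0 => //.
- by move=> y; exact: cvg_id.
- exact: polyb_coord.
- exact: jet2_pprod.
- by move=> p y; exact: pprod_perm.
- apply: polyb_sum => i; apply: polybM; last exact: polyb_coord.
  by apply: (@polyb_gpp R N id); exact: polyb_coord.
by move=> y [dy _]; rewrite genA_pprod//; have [_ ->] := hP s.
Qed.

(** * Type B moments around a moving centre *)

Section Shift.
Variables (R : realType) (N : nat).
Local Notation V := 'rV[R]_N.

(** The triples hold a coefficient, a power of [b] and an exponent list, none depending on [b] or
    [z]. Polynomial dependence on [b] is what allows the centre to move with time. *)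
Lemma pprod_shift c s : exists P : seq (R * nat * seq nat), forall b (z : V),
  pprod s (mapw (fun u => (u - b) / c) z) = \sum_(d <- P) d.1.1 * b ^+ d.1.2 * pprod d.2 z.
Proof.
elim: s => [|m s [P hP]].
  exists [:: ((1, 0%N), [::])] => b z; rewrite big_seq1 !pprod_nil expr0 !mulr1.
  by [].
exists [seq ((d.1.1 * (c ^- m * (-1) ^+ i * 'C(m, i)%:R), (d.1.2 + i)%N), (m - i)%N :: d.2) |
   d <- P, i <- iota 0 m.+1] => b z.
rewrite big_allpairs_dep pprod_cons hP mulr_sumr; apply: eq_bigr => d _.
have -> : psum m (mapw (fun u => (u - b) / c) z) =
    \sum_(i <- iota 0 m.+1) c ^- m * (-1) ^+ i * 'C(m, i)%:R * b ^+ i * psum (m - i) z.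
  rewrite /psum; under [RHS]eq_bigr do rewrite mulr_sumr.
  rewrite [RHS]exchange_big; apply: eq_bigr => l _.
  rewrite mxE expr_div_n exprBn -[iota 0 m.+1]/(index_iota 0 m.+1) big_mkord mulr_suml.
  by apply: eq_bigr => i _; rewrite -[_ *+ 'C(m, i)]mulr_natl; ring.
rewrite mulr_suml; apply: eq_bigr => i _ /=.
by rewrite pprod_cons exprD; ring.
Qed.

(** Moving the centre acts through the sum of the partial derivatives, the same first-order operator
    as the term with factor [2 * k1 / c] in the generator. *)
Lemma is_derive_pprod_wq c s (b : R) (y : V) : is_derive b 1 (fun b => pprod s (mapw (wq b c) y))
  (- c^-1 * \sum_(i < N) gpp s i (mapw (wq b c) y)).
Proof.
elim: s => [|m s IH].
  have -> : (fun b => pprod [::] (mapw (wq b c) y)) = (fun _ : R => 1) :> (R -> R).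
    by apply/funext => b'; rewrite pprod_nil.
  by rewrite /= big1// mulr0; exact: is_derive_cst.
have dw (i : 'I_N) : is_derive b 1 (fun b => mapw (wq b c) y ord0 i) (- c^-1).
  have -> : (fun b => mapw (wq b c) y ord0 i) = cst (y ord0 i ^+ 2 / c) + (fun b => - c^-1 * b) :> (R -> R).
    by apply/funext => b'; rewrite mxE /wq fctE /=; ring.
  apply: is_derive_eq (is_deriveD (is_derive_cst _ _ _) (is_derive_mulr _ (is_derive_id b 1))) _.
  by rewrite add0r mulr1.
have dp : is_derive b 1 (fun b => psum m (mapw (wq b c) y))
    (- c^-1 * \sum_(i < N) m%:R * mapw (wq b c) y ord0 i ^+ m.-1).
  have -> : (fun b => psum m (mapw (wq b c) y)) =
      \sum_(i < N) (fun b => mapw (wq b c) y ord0 i ^+ m) :> (R -> R).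
    by apply/funext => b'; rewrite fct_sumE.
  apply: is_derive_eq (is_derive_sum (fun i : 'I_N => is_derive_comp (is_derive_exprn m _) (dw i))) _.
  by rewrite mulr_sumr; apply: eq_bigr => i _; ring.
have -> : (fun b => pprod (m :: s) (mapw (wq b c) y)) =
    (fun b => psum m (mapw (wq b c) y) * pprod s (mapw (wq b c) y)) :> (R -> R).
  by apply/funext => b'; rewrite pprod_cons.
apply: is_derive_eq (is_derive_mul dp IH) _ => /=.
by rewrite big_split/= -!mulr_sumr; ring.
Qed.

End Shift.

Section TypeB.
Variables (R : realType) (N : nat) (k1 k2 : R) (x : 'rV[R]_N).
Variable mu : R -> probability 'rV[R]_N R.
Local Notation V := 'rV[R]_N.
Local Notation leb := (@lebesgue_measure R).
Hypothesis Hmu : diffusion_marginals (chamber true) (gen GRing.inv true k1 k2) (dom true) x mu.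
Variables PA PM PD : seq nat -> seq (R * seq nat).
Hypotheses
  (hA : forall s, all (fun c => wlt (sumn s) c.2) (PA s) /\
     forall y : V, distinct y -> opO 2^-1 0 0 k2 s y = lincomb (PA s) (fun s => pprod s y))
  (hM : forall s, all (fun c => wlt (sumn s) c.2) (PM s) /\
     forall y : V, distinct y -> opO 2 1 1 k2 s y = lincomb (PM s) (fun s => pprod s y))
  (hD : forall s, all (fun c => wlt (sumn s) c.2) (PD s) /\
     forall y : V, \sum_(i < N) gpp s i y = lincomb (PD s) (fun s => pprod s y)).

Let genP (b c : R) s := [seq (4 * b / c ^+ 2 * d.1, d.2) | d <- PA s] ++
  [seq (c^-1 * d.1, d.2) | d <- PM s] ++ [seq (2 * k1 / c * d.1, d.2) | d <- PD s].

Lemma distinct_wq b c (y : V) : c != 0 -> regular true y -> distinct (mapw (wq b c) y).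
Proof.
move=> c0 [dy /(_ isT)[sy _]] i j ij; rewrite !mxE /wq -subr_eq0.
have -> : (y ord0 i ^+ 2 - b) / c - (y ord0 j ^+ 2 - b) / c =
  (y ord0 i - y ord0 j) * (y ord0 i + y ord0 j) / c by field.
by rewrite !mulf_neq0 ?invr_neq0 ?subr_eq0 ?dy ?sy.
Qed.

Lemma dynkinB b c s t : c != 0 -> 0 <= t ->
  expect mu t (fun y => pprod s (mapw (wq b c) y)) = pprod s (mapw (wq b c) x) +
    Rintegral leb `[0, t]%classic
      (fun u => lincomb (genP b c s) (fun s => expect mu u (fun y => pprod s (mapw (wq b c) y)))).
Proof.
move=> c0 t0; apply: (dynkin_lincomb Hmu _ _ (jet2_pprod_wq N b c s)) t0 => //.
- exact: wq_continuous.
- exact: polyb_wq.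
- move=> p y; rewrite -[RHS](pprod_perm _ p); congr pprod.
  by apply: row_ext => i; rewrite !mxE.
- move=> _ e y; congr pprod; apply: row_ext => i; rewrite !mxE /wq exprMn.
  by rewrite -exprM mulnC exprM sqrrN !expr1n mul1r.
- apply: polyb_sum => i; apply: polybM; last exact: polyb_coord.
  apply: polybM.
    by apply: (@polyb_gpp R N (mapw (wq b c))) => j; exact: polyb_wq.
  by apply: polybM; [exact: polyb_cst|exact: polyb_coord].
move=> y ry; rewrite genB_pprod_wq// !lincomb_cat !lincomb_scale opO_gpp.
have dw := distinct_wq b c0 ry.
by have [_ ->] := hA s => //; have [_ ->] := hM s => //; have [_ ->] := hD s; rewrite addrA.
Qed.

Lemma wq_shift b c (y : V) : mapw (wq b c) y = mapw (fun u => (u - b) / c) (mapw (wq 0 1) y).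
Proof. by apply: row_ext => i; rewrite !mxE /wq subr0 divr1. Qed.

(* Since [b] and the time enter polynomially, one may set [b := 2 * k1 * u] and
   differentiate both dependences; the contribution of [b] cancels the term of the
   generator that diverges with [k1]. *)
Lemma momentsB c : c != 0 -> exists phi : seq nat -> {poly R}, forall s,
  [/\ forall u, 0 <= u -> expect mu u (fun y => pprod s (mapw (wq (2 * k1 * u) c) y)) = (phi s).[u],
      forall u, 0 <= u -> (deriv (phi s)).[u] =
        8 * k1 * u / c ^+ 2 * lincomb (PA s) (fun s => (phi s).[u]) +
        c^-1 * lincomb (PM s) (fun s => (phi s).[u]) &
      (phi s).[0] = pprod s (mapw (wq 0 c) x)].
Proof.
move=> c0.
have wG b d s : all (fun c => wlt (sumn s) c.2) (genP b d s).
  rewrite /genP !all_cat !all_map; apply/and3P; split.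
  - by have [] := hA s.
  - by have [] := hM s.
  - by have [] := hD s.
(* The moments of the plain squares are polynomials in time; those for any other fixed centre and
   the scale [c] are linear combinations of them. *)
have [M hMo] := @moment_polys R (fun u s => expect mu u (fun y => pprod s (mapw (wq 0 1) y)))
  (fun s => pprod s (mapw (wq 0 1) x)) (genP 0 1) (wG 0 1)
  (fun s t t0 => dynkinB 0 s (oner_neq0 R) t0).
have ME s u : 0 <= u -> expect mu u (fun y => pprod s (mapw (wq 0 1) y)) = (M s).[u].
  by move=> u0; have [-> //] := hMo s.
have /choice[S hS] s := pprod_shift N c s.
have EE s b : (fun y : V => pprod s (mapw (wq b c) y)) =
    (fun y => lincomb [seq (d.1.1 * b ^+ d.1.2, d.2) | d <- S s] (fun s => pprod s (mapw (wq 0 1) y))).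
  by apply/funext => y; rewrite wq_shift hS /lincomb big_map.
have cz := @wq_continuous R N 0 1; have bz := @polyb_wq R N 0 1.
pose T s b : {poly R} := \sum_(d <- S s) (d.1.1 * b ^+ d.1.2) *: M d.2.
have TE s b u : 0 <= u -> expect mu u (fun y => pprod s (mapw (wq b c) y)) = (T s b).[u].
  move=> u0; rewrite EE (expect_lincomb Hmu cz bz)// /lincomb big_map horner_sum.
  by apply: eq_bigr => d _; rewrite hornerZ ME.
have dT s b : deriv (T s b) = \sum_(d <- genP b c s) d.1 *: T d.2 b.
  have [|//] := @poly_integral_uniq R (T s b) (\sum_(d <- genP b c s) d.1 *: T d.2 b)
    (pprod s (mapw (wq b c) x)).
  move=> t t0; rewrite -TE// dynkinB//; congr (_ + _).
  apply: eq_Rintegral => u; rewrite inE /= in_itv/= => /andP[u0 _].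
  by rewrite horner_sum; apply: eq_bigr => d _; rewrite hornerZ TE.
(* The derivative in [b] computed in two ways: from the expansion in powers of [b], and from
   [is_derive_pprod_wq]. *)
have dbE s b (y : V) : \sum_(d <- S s) d.1.1 * (d.1.2%:R * b ^+ d.1.2.-1) * pprod d.2 (mapw (wq 0 1) y) =
    - c^-1 * lincomb (PD s) (fun s => pprod s (mapw (wq b c) y)).
  have h1 := is_derive_pprod_wq c s b y; have [_ hDs] := hD s; rewrite hDs in h1.
  have h2 : is_derive b 1 (fun b => pprod s (mapw (wq b c) y))
      (\sum_(d <- S s) d.1.1 * (d.1.2%:R * b ^+ d.1.2.-1) * pprod d.2 (mapw (wq 0 1) y)).
    have -> : (fun b => pprod s (mapw (wq b c) y)) = (fun b => \sum_(d <- S s)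
        (pprod d.2 (mapw (wq 0 1) y) * d.1.1) * b ^+ d.1.2).
      by apply/funext => b'; rewrite wq_shift hS; apply: eq_bigr => d _; ring.
    elim: (S s) => [|d r IH].
      have -> : (fun b => \sum_(d <- [::]) (pprod d.2 (mapw (wq 0 1) y) * d.1.1) * b ^+ d.1.2) =
        (fun _ : R => 0) :> (R -> R) by apply/funext => b'; rewrite big_nil.
      by rewrite big_nil; exact: is_derive_cst.
    have -> : (fun b => \sum_(d <- d :: r) (pprod d.2 (mapw (wq 0 1) y) * d.1.1) * b ^+ d.1.2) =
      (fun b => (pprod d.2 (mapw (wq 0 1) y) * d.1.1) * b ^+ d.1.2) +
      (fun b => \sum_(d <- r) (pprod d.2 (mapw (wq 0 1) y) * d.1.1) * b ^+ d.1.2) :> (R -> R).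
      by apply/funext => b'; rewrite big_cons.
    apply: is_derive_eq (is_deriveD (is_derive_mulr _ (is_derive_exprn d.1.2 b)) IH) _.
    by rewrite big_cons; congr (_ + _); ring.
  by case: h1 h2 => _ <- [_ <-].
pose phi s : {poly R} := \sum_(d <- S s) d.1.1 *: (((2 * k1) *: 'X) ^+ d.1.2 * M d.2).
have phiT s u : (phi s).[u] = (T s (2 * k1 * u)).[u].
  rewrite /phi /T !horner_sum; apply: eq_bigr => d _.
  by rewrite !hornerZ hornerM horner_exp hornerZ hornerX mulrA.
exists phi => s; split.
- by move=> u u0; rewrite TE// phiT.
- move=> u u0; set b := 2 * k1 * u.
  have dphi : (deriv (phi s)).[u] =
      2 * k1 * (\sum_(d <- S s) d.1.1 * (d.1.2%:R * b ^+ d.1.2.-1) * (M d.2).[u]) + (deriv (T s b)).[u].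
    rewrite /phi /T !raddf_sum !horner_sum /= mulr_sumr -big_split/=; apply: eq_bigr => d _.
    rewrite !derivZ derivM deriv_exp derivZ derivX !hornerZ hornerD !hornerM hornerMn hornerM.
    rewrite !horner_exp !hornerZ hornerX hornerC -/b.
    by rewrite -[_ *+ d.1.2]mulr_natl; ring.
  have dbT : \sum_(d <- S s) d.1.1 * (d.1.2%:R * b ^+ d.1.2.-1) * (M d.2).[u] =
      - c^-1 * lincomb (PD s) (fun s => (T s b).[u]).
    pose P1 := [seq (d.1.1 * (d.1.2%:R * b ^+ d.1.2.-1), d.2) | d <- S s].
    have e1 : expect mu u (fun y => lincomb P1 (fun s => pprod s (mapw (wq 0 1) y))) =
        \sum_(d <- S s) d.1.1 * (d.1.2%:R * b ^+ d.1.2.-1) * (M d.2).[u].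
      rewrite (expect_lincomb Hmu cz bz)// /lincomb big_map; apply: eq_bigr => d _.
      by rewrite ME.
    rewrite -e1; pose P2 := [seq (- c^-1 * d.1, d.2) | d <- PD s].
    have -> : (fun y : V => lincomb P1 (fun s => pprod s (mapw (wq 0 1) y))) =
        (fun y => lincomb P2 (fun s => pprod s (mapw (wq b c) y))).
      by apply/funext => y; rewrite lincomb_scale -dbE /lincomb big_map.
    rewrite (expect_lincomb Hmu (@wq_continuous R N b c) (@polyb_wq R N b c))// lincomb_scale.
    by congr (_ * _); apply: eq_bigr => d _; rewrite TE.
  have dTE : (deriv (T s b)).[u] = lincomb (genP b c s) (fun s => (T s b).[u]).
    by rewrite dT horner_sum; apply: eq_bigr => d _; rewrite hornerZ.
  rewrite dphi dbT dTE !lincomb_cat !lincomb_scale.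
  have eqT P : lincomb P (fun s => (T s b).[u]) = lincomb P (fun s => (phi s).[u]).
    by apply: eq_bigr => d _; rewrite phiT.
  by rewrite !eqT /b; field.
rewrite phiT mulr0 -TE// dynkinB// set_itv1 Rintegral_set1 addr0//.
Qed.

End TypeB.

(** * Convergence of the moments *)

Section MomentConvergence.
Variables (R : realType) (N : nat).
Local Notation V := 'rV[R]_N.
Local Notation leb := (@lebesgue_measure R).

Lemma poly_deriv_bound (P : {poly R}) (t K u : R) : 0 <= u <= t ->
  (forall v, 0 <= v <= t -> `|(deriv P).[v]| <= K) -> `|P.[u] - P.[0]| <= K * u.
Proof.
move=> /andP[u0 ut] hK; rewrite -Rintegral_deriv//; apply: Rintegral_itv_bound => //.
  have cP : continuous (fun s => (deriv P).[s]) by exact: continuous_horner.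
  by apply: measurable_funS (continuous_measurable_fun cP).
by move=> v /andP[v0 vu]; rewrite hK// v0 (le_trans vu).
Qed.

Lemma scaling_small (t d : R) : 0 < t -> 0 < d ->
  \forall k \near +oo, 0 < k /\ (2 * Num.sqrt (2 * t * k))^-1 <= d.
Proof.
move=> t0 d0; near=> k; have k0 : 0 < k by near: k; exact: nbhs_pinfty_gt.
split=> //.
have kd : (d ^+ 2)^-1 / (8 * t) <= k by near: k; apply: nbhs_pinfty_ge; exact: num_real.
have s0 : 0 < 2 * Num.sqrt (2 * t * k) by rewrite mulr_gt0// sqrtr_gt0 !mulr_gt0.
rewrite -[d]invrK lef_pV2 ?posrE ?invr_gt0//.
rewrite -(@ler_pXn2r _ 2)// ?nnegrE ?(ltW s0) ?invr_ge0 ?(ltW d0)//.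
rewrite exprMn sqr_sqrtr; last by rewrite !mulr_ge0 ?ltW.
move: kd; rewrite ler_pdivrMr ?mulr_gt0// exprVn => /le_trans; apply.
by rewrite le_eqVlt; apply/orP; left; apply/eqP; ring.
Unshelve. all: by end_near.
Qed.

(** At time 0 the centre is 0, and the growing scale sends the fixed starting point to the origin,
    where the type A process starts. *)
Lemma cvg_pprod_wq0 s (x : V) (t e : R) : 0 < t -> 0 < e ->
  \forall k \near +oo, `|pprod s (mapw (wq 0 (2 * Num.sqrt (2 * t * k))) x) - pprod s (0 : V)| <= e.
Proof.
move=> t0 e0; pose z : V := mapw (wq 0 1) x.
have cz : continuous (fun v : R => pprod s (v *: z)).
  move=> v; apply: (@continuous_comp _ _ _ (fun v : R => v *: z) (@pprod R N s)).
    exact: scalel_continuous.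
  by have [j _ _] := jet2_pprod R N s; exact: (jet1_continuous j).
have /cvgrPdist_le/(_ _ e0) := cz 0; rewrite scale0r => -[d /= d0 hd].
have [d2 d20 dd2] : exists2 d2 : R, 0 < d2 & d2 < d by exists (d / 2); [rewrite divr_gt0|rewrite ltr_pdivrMr// ltr_pMr// ltr1n].
apply: filterS (scaling_small t0 d20) => k [k0 hk].
have c0 : 0 < 2 * Num.sqrt (2 * t * k) by rewrite mulr_gt0// sqrtr_gt0 !mulr_gt0.
have -> : mapw (wq 0 (2 * Num.sqrt (2 * t * k))) x = (2 * Num.sqrt (2 * t * k))^-1 *: z.
  by apply: row_ext => i; rewrite !mxE /wq divr1 !subr0 mulrC.
rewrite distrC; apply: hd; rewrite /= sub0r normrN gtr0_norm ?invr_gt0//.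
exact: le_lt_trans hk dd2.
Qed.

(** With [c ^ 2 = 8 t k] the leading coefficient is [u / t], so in the limit the type A equations
    are run at speed [u / t]. They are solved by the type A moments at time [u ^ 2 / (2 t)], which
    is [t / 2] at [u = t]. Induction on the weight gives convergence uniformly for [u] in
    [[0, t]]. *)
Lemma moments_converge (k2 t : R) (x : V) (X : R -> R -> probability V R)
    (XA : R -> probability V R) : 0 < t ->
  (forall k1, 0 < k1 ->
     diffusion_marginals (chamber true) (gen GRing.inv true k1 k2) (dom true) x (X k1)) ->
  diffusion_marginals (chamber false) (gen GRing.inv false 0 k2) (dom false) 0 XA ->
  forall s, (fun k1 => expect (X k1) t
      (fun y => pprod s (mapw (wq (2 * k1 * t) (2 * Num.sqrt (2 * t * k1))) y))) @ +oo -->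
    expect XA (t / 2) (fun y => pprod s y).
Proof.
move=> t0 HX HXA.
have [PA hA] := @opO_lincomb R N 2^-1 0 0 k2 isT.
have [PM hM] := @opO_lincomb R N 2 1 1 k2 isT.
have [PD hD] := @gpp_lincomb R N.
have [M hMo] := momentsA HXA hA.
pose c k := 2 * Num.sqrt (2 * t * k).
have c_gt0 k : 0 < k -> 0 < c k by move=> k0; rewrite mulr_gt0// sqrtr_gt0 !mulr_gt0.
have c2 k : 0 < k -> c k ^+ 2 = 8 * t * k.
  by move=> k0; rewrite /c exprMn sqr_sqrtr; [ring|rewrite !mulr_ge0 ?ltW].
have /choice[phi hphi] k : exists phi : seq nat -> {poly R}, 0 < k -> forall s,
  [/\ forall u, 0 <= u -> expect (X k) u (fun y => pprod s (mapw (wq (2 * k * u) (c k)) y)) = (phi s).[u],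
      forall u, 0 <= u -> (deriv (phi s)).[u] =
        u / t * lincomb (PA s) (fun s => (phi s).[u]) +
        (c k)^-1 * lincomb (PM s) (fun s => (phi s).[u]) &
      (phi s).[0] = pprod s (mapw (wq 0 (c k)) x)].
  have [k0|k0] := pselect (0 < k); last by exists (fun=> 0).
  have [phi hp] := momentsB (HX k k0) hA hM hD (lt0r_neq0 (c_gt0 k k0)).
  exists phi => _ s; have [h1 h2 h3] := hp s; split=> // u u0.
  rewrite h2//; congr (_ * _ + _); rewrite c2//; field.
  by rewrite !gt_eqF.
pose psi s : {poly R} := M s \Po ((2 * t)^-1 *: 'X^2).
have psiE s u : (psi s).[u] = (M s).[u ^+ 2 / (2 * t)].
  by rewrite /psi horner_comp hornerZ hornerXn mulrC.
have dpsi s u : (deriv (psi s)).[u] = u / t * lincomb (PA s) (fun s => (psi s).[u]).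
  have [_ dM _] := hMo s.
  rewrite /psi deriv_comp derivZ derivXn hornerM horner_comp !hornerZ hornerMn !hornerXn expr1 dM.
  rewrite horner_sum [LHS]mulrC; congr (_ * _).
    by rewrite -[_ *+ 2]mulr_natl; field; rewrite gt_eqF.
  by apply: eq_bigr => d _; rewrite hornerZ psiE [_ / _]mulrC.
have key n : forall s, (sumn s < n)%N -> forall e, 0 < e ->
    \forall k \near +oo, forall u, 0 <= u <= t -> `|(phi k s).[u] - (psi s).[u]| <= e.
  elim: n => // n IH s sn e e0.
  have lin (P : seq (R * seq nat)) : all (fun c => wlt (sumn s) c.2) P -> forall d, 0 < d ->
      \forall k \near +oo, forall u, 0 <= u <= t ->
        `|lincomb P (fun s => (phi k s).[u]) - lincomb P (fun s => (psi s).[u])| <= d.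
    elim: P => [_|p P IHP /= /andP[wp wP]] d d0.
      by apply: nearW => k u _; rewrite /lincomb !big_nil subrr normr0 ltW.
    have d2 : 0 < d / 2 by rewrite divr_gt0.
    have a0 : 0 < `|p.1| + 1 by rewrite ltr_wpDl.
    have d3 : 0 < d / 2 / (`|p.1| + 1) by rewrite divr_gt0.
    apply: filterS2 (IHP wP _ d2) (IH p.2 (leq_trans wp sn) _ d3) => k h1 h2 u ut.
    rewrite /lincomb !big_cons opprD addrACA -mulrBr [d in _ <= d]splitr addrC.
    rewrite (le_trans (ler_normD _ _))// lerD ?h1// normrM.
    apply: (@le_trans _ _ ((`|p.1| + 1) * (d / 2 / (`|p.1| + 1)))).
      by rewrite ler_pM// ?h2// lerDl.
    by rewrite mulrCA divff ?mulr1// gt_eqF.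
  have [K [K0 hK]] : exists K : R, 0 <= K /\ forall u, 0 <= u <= t ->
      `|lincomb (PM s) (fun s => (psi s).[u])| <= K.
    pose q : {poly R} := \sum_(d <- PM s) d.1 *: psi d.2.
    have qE u : q.[u] = lincomb (PM s) (fun s => (psi s).[u]).
      by rewrite /q horner_sum; apply: eq_bigr => d _; rewrite hornerZ.
    have [m m01 hm] := EVT_max (ltW t0) (continuous_subspaceT (fun u => cvg_norm (@continuous_horner _ q u))).
    exists `|q.[m]|; split=> // u ut; rewrite -qE; apply: hm.
    by rewrite in_itv.
  (* The initial value costs [d] and the derivative at most [d * t], together [e / 2]. *)
  pose d := e / (2 * (1 + t)).
  have d0 : 0 < d by rewrite divr_gt0// mulr_gt0// addr_gt0.
  have d20 : 0 < d / 2 by rewrite divr_gt0.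
  (* [K + d] will bound the [PM] term, and this bound on [(c k)^-1] makes its contribution at most
     [d / 2]. *)
  have dK : 0 < d / (2 * (K + d)) by rewrite divr_gt0// mulr_gt0// ltr_wpDl.
  have n1 := lin _ (hA s).1 _ d20; have n2 := lin _ (hM s).1 _ d0.
  have n3 := scaling_small t0 dK; have n4 := cvg_pprod_wq0 s x t0 d0.
  apply: filterS2 (filterI n1 n2) (filterI n3 n4) => k [h1 h2] [[k0 h3] h4] u ut.
  have [_ dphi phi0] := hphi k k0 s.
  pose P := phi k s - psi s.
  have dP v : 0 <= v <= t -> `|(deriv P).[v]| <= d.
    move=> vt; have /andP[v0 vt'] := vt.
    rewrite /P derivB hornerD hornerN dphi// dpsi addrAC -mulrBr.
    rewrite (le_trans (ler_normD _ _))// [leRHS]splitr lerD//.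
      rewrite normrM (le_trans _ (h1 v vt))// ler_piMl// ger0_norm ?divr_ge0// ?(ltW t0)//.
      by rewrite ler_pdivrMr// mul1r.
    have c1 : 0 <= (c k)^-1 by rewrite invr_ge0 ltW// c_gt0.
    rewrite normrM (ger0_norm c1).
    have b1 : `|lincomb (PM s) (fun s => (phi k s).[v])| <= K + d.
      rewrite -[lincomb _ _](subrK (lincomb (PM s) (fun s => (psi s).[v]))) addrC.
      by rewrite (le_trans (ler_normD _ _))// lerD ?hK ?h2.
    apply: (@le_trans _ _ (d / (2 * (K + d)) * (K + d))); first exact: ler_pM.
    rewrite le_eqVlt; apply/orP; left; apply/eqP; field.
    by rewrite gt_eqF// ltr_wpDl.
  have b2 := poly_deriv_bound ut dP.
  have b0 : `|P.[0]| <= d.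
    have [_ _ M0] := hMo s; rewrite /P hornerD hornerN phi0 psiE expr0n mul0r M0.
    exact: h4.
  rewrite -hornerN -hornerD -/P -[P.[u]](subrK P.[0]).
  rewrite (le_trans (ler_normD _ _))//; have /andP[u0 ut'] := ut.
  have -> : e = 2 * d * (1 + t) by rewrite /d; field; rewrite gt_eqF// addr_gt0.
  have : d * u <= d * t by rewrite ler_pM2l.
  have := mulr_ge0 (ltW d0) (ltW t0); lra.
move=> s; apply/cvgrPdist_lt => e e0.
have [hM1 _ _] := hMo s.
have e20 : 0 < e / 2 by rewrite divr_gt0.
apply: filterS2 (key _ s (ltnSn _) _ e20) (nbhs_pinfty_gt (num_real (0 : R))) => k h k0.
have [h1 _ _] := hphi k k0 s; rewrite (h1 t (ltW t0)) hM1 ?divr_ge0 ?ltW//.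
have -> : t / 2 = t ^+ 2 / (2 * t) by field; rewrite gt_eqF.
have tt : 0 <= t <= t by rewrite lexx ltW.
rewrite -psiE distrC; apply: le_lt_trans (h t tt) _.
by rewrite ltr_pdivrMr// ltr_pMr// ltr1n.
Qed.

End MomentConvergence.

(** * Taylor polynomials of the sine, and growth of factorials *)

Section SineApproximation.
Variable R : realType.

Lemma is_derive_horner (P : {poly R}) (x : R) : is_derive x 1 (fun u => P.[u]) (deriv P).[x].
Proof.
apply: DeriveDef; first exact: derivable_horner.
by rewrite -derive1E derivE.
Qed.

(** On [x >= 0] the claimed bound minus [f] vanishes at 0 and has nonnegative derivative; negative
    [x] are reached by reflection. *)
Lemma taylor_step (f g : R -> R) n : (forall x : R, is_derive x 1 f (g x)) -> f 0 = 0 ->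
  (forall x, `|g x| <= `|x| ^+ n / n`!%:R) -> forall x, `|f x| <= `|x| ^+ n.+1 / n.+1`!%:R.
Proof.
have pos (f' g' : R -> R) : (forall x : R, is_derive x 1 f' (g' x)) -> f' 0 = 0 ->
    (forall x, 0 <= x -> g' x <= x ^+ n / n`!%:R) -> forall x, 0 <= x -> f' x <= x ^+ n.+1 / n.+1`!%:R.
  move=> df f0 gn x x0.
  pose h := (fun y : R => (n.+1`!%:R)^-1 * y ^+ n.+1) - f'.
  have dh (y : R) : is_derive y 1 h (y ^+ n / n`!%:R - g' y).
    apply: is_derive_eq (is_deriveB (is_derive_mulr (n.+1`!%:R)^-1 (is_derive_exprn n.+1 y)) (df y)) _.
    rewrite factS natrM /=; congr (_ - _); field.
    by rewrite pnatr_eq0 -lt0n fact_gt0 /= addrC natr1 pnatr_eq0.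
  have ch : {within `[0, x], continuous h}.
    apply: continuous_subspaceT => y; apply: differentiable_continuous.
    by apply/derivable1_diffP; case: (dh y).
  have [c] := MVT_segment x0 (fun y _ => dh y) ch.
  rewrite in_itv/= subr0 => /andP[c0 cx] hx.
  have : 0 <= h x - h 0 by rewrite hx mulr_ge0// subr_ge0 gn.
  by rewrite /h !fctE f0 expr0n mulr0 subrr subr0 subr_ge0 [_ / _]mulrC.
move=> df f0 gn.
have up (f' g' : R -> R) : (forall x : R, is_derive x 1 f' (g' x)) -> f' 0 = 0 ->
    (forall x, `|g' x| <= `|x| ^+ n / n`!%:R) -> forall x, 0 <= x -> `|f' x| <= x ^+ n.+1 / n.+1`!%:R.
  move=> df' f0' gn' x x0; rewrite ler_norml; apply/andP; split.
    rewrite lerNl; have -> : - f' x = (- f') x by [].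
    apply: (@pos (- f') (- g')) => //.
    - by rewrite fctE f0' oppr0.
    - by move=> y y0; have := gn' y; rewrite (ger0_norm y0) ler_norml => /andP[]; rewrite fctE lerNl.
  apply: (@pos f' g') => // y y0.
  by have := gn' y; rewrite (ger0_norm y0) ler_norml => /andP[].
move=> x; have [x0|x0] := leP 0 x; first by rewrite (ger0_norm x0); exact: (up f g).
have -> : f x = (fun y => f (-1 * y)) (- x) by rewrite mulN1r opprK.
rewrite (ltr0_norm x0); apply: (@up (fun y => f (-1 * y)) (fun y => g (-1 * y) * (-1))).
- move=> y; apply: is_derive_comp (df _) _.
  by apply: is_derive_eq (is_derive_mulr (-1) (is_derive_id y 1)) _; rewrite mulr1.
- by rewrite mulr0.
- by move=> y; rewrite mulrN1 mulN1r normrN -[`|y|]normrN.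
by rewrite oppr_ge0 ltW.
Qed.

(** Sine and cosine go together in the induction: up to sign, the remainder of one is the derivative
    of the next remainder of the other. *)
Lemma sin_taylor n : exists S : {poly R}, forall x : R, `|sin x - S.[x]| <= `|x| ^+ n / n`!%:R.
Proof.
suff [S [_ [h _]]] : exists S C : {poly R}, (forall x : R, `|sin x - S.[x]| <= `|x| ^+ n / n`!%:R) /\
    (forall x : R, `|cos x - C.[x]| <= `|x| ^+ n / n`!%:R) by exists S.
elim: n => [|n [S [C [hS hC]]]].
  exists 0, 0; split=> x; rewrite horner0 subr0 expr0 divr1; [exact: sin_max|exact: cos_max].
have [S' [dS S0]] := poly_antiderivative C 0.
have [C' [dC C0]] := poly_antiderivative (- S) 1.
exists S', C'; split.
  apply: (@taylor_step _ (fun x => cos x - C.[x])) => //; last by rewrite sin0 S0 subrr.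
  by move=> x; apply: is_deriveB; rewrite -dS; exact: is_derive_horner.
apply: (@taylor_step _ (fun x => - sin x - (- S).[x])); last 2 first.
- by rewrite cos0 C0 subrr.
- by move=> x; rewrite hornerN -opprD normrN.
by move=> x; apply: is_deriveB; rewrite -dC; exact: is_derive_horner.
Qed.

(** [(n j)!] is [n! ^ j] times a product of binomial coefficients, each bounded by a power of 2. *)
Lemma fact_mul_bound n j : ((n * j)`! <= 2 ^ (n * j * j) * n`! ^ j)%N.
Proof.
have bin2 m k : ('C(m, k) <= 2 ^ m)%N.
  elim: m k => [|m IH] [|k]; rewrite ?bin0 ?expn_gt0//.
  by rewrite binS expnS mul2n -addnn leq_add.
elim: j => [|j IH]; first by rewrite muln0 expn0.
have kn : (n <= n * j.+1)%N by rewrite mulnS leq_addr.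
rewrite -(bin_fact kn) mulnS addKn.
apply: (@leq_trans (2 ^ (n + n * j) * (n`! * (2 ^ (n * j * j) * n`! ^ j)))).
  by rewrite leq_mul// ?bin2// leq_mul.
have -> : (2 ^ (n + n * j) * (n`! * (2 ^ (n * j * j) * n`! ^ j)) =
    2 ^ (n + n * j + n * j * j) * n`! ^ j.+1)%N.
  by rewrite [(2 ^ (n + n * j + _))%N]expnD expnS mulnACA -!mulnA.
rewrite leq_mul2r leq_exp2l//; apply/orP; right.
by rewrite mulnS mulnDl leq_add2l leq_addl.
Qed.

Lemma fact_double n : (n`! * n`! <= (2 * n)`!)%N.
Proof.
have h : (n <= 2 * n)%N by rewrite mul2n -addnn leq_addr.
by rewrite -(bin_fact h) mul2n -addnn addnK leq_pmull// bin_gt0 leq_addr.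
Qed.

(** The moment growth [B^m m!] at [m = n j] meets the [j]-th power of the Taylor denominator. Since
    [(2 n)! >= (n!)^2], the ratio is at most [A ^ n / n!], a term of the exponential series. *)
Lemma cvg_moment_ratio (B : R) j : (0 < j)%N -> 0 <= B ->
  (fun n => B ^+ (n * j) * (n * j)`!%:R / (2 * n)`!%:R ^+ j) @ \oo --> (0 : R).
Proof.
move=> j0 B0; pose A := B ^+ j * 2 ^+ (j * j).
apply: (squeeze_cvgr _ (cvg_cst (0 : R)) (cvg_exp_coeff A)).
apply: nearW => n; rewrite /exp_coeff /=.
have f0 : (0 : R) < n`!%:R by rewrite ltr0n fact_gt0.
have g0 : (0 : R) < (2 * n)`!%:R by rewrite ltr0n fact_gt0.
apply/andP; split.
  by rewrite divr_ge0 ?exprn_ge0 ?(ltW g0)// mulr_ge0// exprn_ge0.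
have h1 : ((n * j)`!%:R : R) <= 2 ^+ (n * j * j) * n`!%:R ^+ j.
  by rewrite -!natrX -natrM ler_nat fact_mul_bound.
have h2 : n`!%:R * n`!%:R <= (2 * n)`!%:R :> R by rewrite -natrM ler_nat fact_double.
rewrite ler_pdivrMr ?exprn_gt0//.
apply: (@le_trans _ _ (B ^+ (n * j) * (2 ^+ (n * j * j) * n`!%:R ^+ j))).
  by rewrite ler_wpM2l ?exprn_ge0.
apply: (@le_trans _ _ (A ^+ n / n`!%:R * (n`!%:R * n`!%:R) ^+ j)); last first.
  rewrite ler_wpM2l//; first by rewrite divr_ge0 ?(ltW f0)// exprn_ge0// mulr_ge0 ?exprn_ge0.
  by rewrite lerXn2r// nnegrE ?mulr_ge0// ltW.
have -> : B ^+ (n * j) * (2 ^+ (n * j * j) * n`!%:R ^+ j) = A ^+ n * n`!%:R ^+ j.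
  by rewrite /A exprMn -!exprM -mulnA [(n * (j * j))%N]mulnC [(n * j)%N]mulnC mulrA.
rewrite [(n`!%:R * n`!%:R) ^+ j]exprMn.
have -> : A ^+ n * n`!%:R ^+ j = A ^+ n / n`!%:R * (n`!%:R ^+ j * n`!%:R).
  by field; rewrite gt_eqF.
have A0 : 0 <= A by rewrite mulr_ge0 ?exprn_ge0.
rewrite ler_wpM2l ?divr_ge0 ?exprn_ge0 ?(ltW f0)// ler_wpM2l ?exprn_ge0 ?(ltW f0)//.
by rewrite -{1}[n`!%:R]expr1 ler_weXn2l// ler1n fact_gt0.
Qed.

End SineApproximation.

(** * Perturbation of power sums, and approximation by sines *)

Section MomentTools.
Variables (R : realType) (N : nat).
Local Notation V := 'rV[R]_N.

Lemma exprn_perturb (u v E : R) m : 0 <= E -> `|u| <= 1 -> `|v - u| <= E ->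
  `|v ^+ m - u ^+ m| <= (1 + E) ^+ m - 1.
Proof.
move=> E0 u1 vu; have v1 : `|v| <= 1 + E.
  by rewrite -[v](subrK u) addrC (le_trans (ler_normD _ _))// lerD.
elim: m => [|m IH]; first by rewrite !expr0 !subrr normr0.
have -> : v ^+ m.+1 - u ^+ m.+1 = (v - u) * v ^+ m + u * (v ^+ m - u ^+ m) by rewrite !exprS; ring.
rewrite (le_trans (ler_normD _ _))// !normrM.
apply: (@le_trans _ _ (E * (1 + E) ^+ m + 1 * ((1 + E) ^+ m - 1))).
  by rewrite lerD// ler_pM// normrX lerXn2r// nnegrE ?addr_ge0.
by rewrite exprS le_eqVlt; apply/orP; left; apply/eqP; ring.
Qed.

(** Only [u] is bounded by 1: it will be the vector of sines, and [v] that of their Taylor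
    polynomials. *)
Lemma pprod_perturb (u v : V) (E : R) s : 0 <= E -> (forall i, `|u ord0 i| <= 1) ->
  (forall i, `|v ord0 i - u ord0 i| <= E) ->
  `|pprod s v - pprod s u| <= N%:R ^+ size s * ((1 + E) ^+ sumn s - 1).
Proof.
move=> E0 u1 vu.
have E1 k : 1 <= (1 + E) ^+ k by rewrite exprn_ege1// lerDl.
have pu m : `|psum m u| <= N%:R.
  rewrite (le_trans (ler_norm_sum _ _ _))// -[leRHS]mulr1 -sum_ord_cst ler_sum// => i _.
  by rewrite normrX exprn_ile1.
have pvu m : `|psum m v - psum m u| <= N%:R * ((1 + E) ^+ m - 1).
  rewrite /psum -sumrB (le_trans (ler_norm_sum _ _ _))// -sum_ord_cst ler_sum// => i _.
  exact: exprn_perturb.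
elim: s => [|m s IH] /=; first by rewrite !pprod_nil !expr0 !subrr normr0 mulr0.
have qv : `|pprod s v| <= N%:R ^+ size s * (1 + E) ^+ sumn s.
  elim: s {IH} => [|k s IH] /=; first by rewrite pprod_nil normr1 !expr0 mulr1.
  rewrite pprod_cons normrM exprS exprD mulrACA ler_pM//.
  rewrite -[psum k v](subrK (psum k u)) (le_trans (ler_normD _ _))//.
  have -> : N%:R * (1 + E) ^+ k = N%:R * ((1 + E) ^+ k - 1) + N%:R by ring.
  by rewrite lerD.
rewrite !pprod_cons.
have -> : psum m v * pprod s v - psum m u * pprod s u =
  (psum m v - psum m u) * pprod s v + psum m u * (pprod s v - pprod s u) by ring.
rewrite (le_trans (ler_normD _ _))// !normrM.
apply: (@le_trans _ _ (N%:R * ((1 + E) ^+ m - 1) * (N%:R ^+ size s * (1 + E) ^+ sumn s)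
   + N%:R * (N%:R ^+ size s * ((1 + E) ^+ sumn s - 1)))).
  by rewrite lerD// ler_pM.
by rewrite exprS exprD le_eqVlt; apply/orP; left; apply/eqP; ring.
Qed.

(** The bound has no constant term, so its expectation tends to 0 together with those of the powers
    of [E]. The first term serves for [E <= 1], the second for [E >= 1]. *)
Lemma pow_excess (E : R) n : 0 <= E -> (1 + E) ^+ n - 1 <= 2 ^+ n.+1 * (E + E ^+ n.+1).
Proof.
move=> E0; have p n' : 0 <= E ^+ n' by rewrite exprn_ge0.
apply: (@le_trans _ _ ((1 + E) ^+ n.+1 - 1)).
  by rewrite lerD2r exprS ler_peMl ?lerDl// exprn_ge0// addr_ge0.
have [E1|/ltW E1] := leP E 1.
  apply: (@le_trans _ _ (2 ^+ n.+1 * E)); last first.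
    by rewrite ler_wpM2l ?exprn_ge0// lerDl.
  elim: n.+1 => [|m IH]; first by rewrite !expr0 subrr mul1r.
  have e2 : (1 + E) ^+ m <= 2 ^+ m by rewrite lerXn2r ?nnegrE ?addr_ge0//; lra.
  have -> : (1 + E) ^+ m.+1 - 1 = ((1 + E) ^+ m - 1) + (1 + E) ^+ m * E by rewrite exprS; ring.
  have -> : 2 ^+ m.+1 * E = 2 ^+ m * E + 2 ^+ m * E by rewrite exprS; ring.
  by rewrite lerD// ler_wpM2r.
apply: (@le_trans _ _ ((2 * E) ^+ n.+1)).
  rewrite lerBlDr (@le_trans _ _ ((2 * E) ^+ n.+1))// ?lerDl//.
  by rewrite lerXn2r ?nnegrE ?addr_ge0 ?mulr_ge0//; lra.
by rewrite exprMn ler_wpM2l ?exprn_ge0// lerDr.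
Qed.

Lemma psum_double_le n (y : V) : psum (2 * n.+1) y <= psum 2 y ^+ n.+1.
Proof.
elim: n => [|n IH]; first by rewrite muln1 expr1.
rewrite exprSr; apply: (@le_trans _ _ (psum (2 * n.+1) y * psum 2 y)); last first.
  by rewrite ler_wpM2r ?psum2_ge0.
rewrite {1 2}/psum mulr_suml ler_sum// => i _; rewrite mulnS exprD mulrC.
by rewrite ler_wpM2l ?ler_sqr_psum2// exprM exprn_ge0// sqr_ge0.
Qed.

Lemma sympoly_pprod_horner (q : {poly R}) s :
  sympoly xpredT (fun y : V => pprod s (mapw (horner q) y)).
Proof.
elim: s => [|m s IH].
  by apply: sympoly_ext (@sympoly_cst R N xpredT 1 isT) => y; rewrite pprod_nil.
apply: (@sympoly_ext _ _ _ (fun y => (\sum_(i < N) (q ^+ m).[y ord0 i]) * pprod s (mapw (horner q) y))).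
  by move=> y; rewrite pprod_cons; congr (_ * _); apply: eq_bigr => i _; rewrite mxE horner_exp.
by apply: (@sympolyM _ _ _ xpredT xpredT) => //; exact: sympoly_psum_horner.
Qed.

Lemma sympolyX (F : V -> R) n : sympoly xpredT F -> sympoly xpredT (fun y => F y ^+ n).
Proof.
move=> hF; elim: n => [|n IH]; first by apply: sympoly_ext (@sympoly_cst R N xpredT 1 isT) => y; rewrite expr0.
apply: (@sympoly_ext _ _ _ (fun y => F y * F y ^+ n)); first by move=> y; rewrite exprS.
exact: (@sympolyM _ _ _ xpredT xpredT).
Qed.

Lemma sympoly_perm Q (F : V -> R) (p : 'S_N) (y : V) : sympoly Q F -> F (\row_i y ord0 (p i)) = F y.
Proof. by move=> [P [_ hP]]; rewrite !hP; apply: eq_bigr => c _; rewrite pprod_perm. Qed.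

(** While all [|xi * y_i|] are at most one half, the sine is increasing and inverted by [asin], so
    [g] is a continuous function of the sines. Otherwise [4 * xi ^ 2 * psum 2 y] is at least 1, and
    the quadratic term absorbs the crude bound [2 * B + e]. *)
Lemma sine_weierstrass (g : V -> R) (B e xi : R) : continuous g -> (forall y, `|g y| <= B) ->
  0 < e -> 0 < xi -> exists F, sympoly xpredT F /\ forall y, chamberA y ->
    `|g y - F (mapw (fun u => sin (xi * u)) y)| <= e + (2 * B + e) * (4 * xi ^+ 2) * psum 2 y.
Proof.
move=> cg gB e0 xi0; pose a : R := sin 2^-1.
have h2 : 0 < (2^-1 : R) by []. have pi1 := @pihalf_ge1 R.
have hin u : `|u| <= 2^-1 -> u \in `[(- (pi / 2 : R)), pi / 2].
  by rewrite ler_norml in_itv/= => /andP[h1 h3]; apply/andP; split; lra.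
have ha : `|(2^-1 : R)| <= 2^-1 by rewrite ger0_norm// ltW.
have a1 : a < 1.
  have p2 : (pi / 2 : R) \in `[(- (pi / 2)), pi / 2] by rewrite in_itv/= lexx andbT; lra.
  by rewrite -[1](@sin_pihalf R) /a (ltr_sin (hin _ ha) p2); lra.
have aN1 : - 1 < - a by rewrite ltrN2.
have mono (u v : R) : `|u| <= 2^-1 -> `|v| <= 2^-1 -> u <= v -> sin u <= sin v.
  by move=> hu hv uv; rewrite leNgt (ltr_sin (hin _ hv) (hin _ hu)) -leNgt.
have a0 : 0 <= a by rewrite -(@sin0 R); apply: mono; rewrite ?normr0 ?invr_ge0.
(* Clipping at the sine of one half keeps the argument of [asin] strictly inside [(-1, 1)], and
   hence makes [w] continuous on the whole line. *)
pose clip (u : R) : R := Num.max (- a) (Num.min u a).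
have clip1 u : - 1 < clip u < 1.
  rewrite /clip lt_max aN1/= gt_max gt_min a1 orbT andbT.
  by rewrite ltrNl; apply: lt_le_trans a0; rewrite ltrN10.
have cclip : continuous clip.
  move=> u; apply: (@continuous_max _ _ (fun=> - a) (fun u => Num.min u a)).
    exact: cst_continuous.
  apply: (@continuous_min _ _ id (fun=> a)); first exact: cvg_id.
  exact: cst_continuous.
pose w (u : R) := asin (clip u) / xi.
have cw : continuous w.
  apply: continuous_mul; last exact: cst_continuous.
  move=> u; apply: (@continuous_comp _ _ _ clip asin); first exact: cclip.
  exact: continuous_asin.
have cG : continuous (fun u : V => g (mapw w u)).
  move=> u; apply: (@continuous_comp _ _ _ (mapw w) g); last exact: cg.
  by apply: mapw_continuous.
have [F [sF hF]] := @chamberA_weierstrass R N (fun u => g (mapw w u)) 1 e cG ltr01 e0.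
exists F; split=> // y Sy; set u := mapw _ y.
have bu : box 1 u by move=> i; rewrite mxE; exact: sin_max.
have p0 := psum2_ge0 y; have B0 : 0 <= B by exact: le_trans (normr_ge0 _) (gB 0).
have Be : 0 <= 2 * B + e by lra.
have C0 : 0 <= (2 * B + e) * (4 * xi ^+ 2) by rewrite mulr_ge0// mulr_ge0// sqr_ge0.
have [hy|/existsNP[i /negP]] := pselect (forall i, `|xi * y ord0 i| <= 2^-1).
  have Su : chamberA u by move=> i j ij; rewrite !mxE mono// ler_pM2l// Sy.
  have gu : g (mapw w u) = g y.
    congr g; apply: row_ext => i; rewrite !mxE /w.
    have := hy i; rewrite ler_norml => /andP[y1 y2].
    have -> : clip (sin (xi * y ord0 i)) = sin (xi * y ord0 i).
      rewrite /clip min_l ?max_r//; last by apply: mono.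
      by rewrite /a -sinN; apply: mono => //; rewrite normrN.
    by rewrite sinK ?hin// mulrC mulKf// gt_eqF.
  by rewrite -gu (le_trans (hF _ Su bu))// lerDl mulr_ge0.
rewrite -ltNge => hi.
have pi4 : 1 <= 4 * xi ^+ 2 * psum 2 y.
  apply: (@le_trans _ _ (4 * xi ^+ 2 * y ord0 i ^+ 2)); last first.
    by rewrite ler_wpM2l ?ler_sqr_psum2// mulr_ge0// sqr_ge0.
  have h3 : (2^-1) ^+ 2 <= `|xi * y ord0 i| ^+ 2 by rewrite lerXn2r ?nnegrE// ltW.
  move: h3; rewrite real_normK ?num_real// exprMn => h3.
  by rewrite -mulrA; lra.
(* [u] may be unsorted here, as the sine is no longer monotone; [F] being symmetric, it is bounded
   at a sorted rearrangement. *)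
have [p Sp] := chamberA_sort u; set v := (\row_i _) in Sp.
have Fv : F v = F u by exact: sympoly_perm sF.
have bv : box 1 v by move=> j; rewrite mxE.
have Fb : `|F u| <= B + e.
  rewrite -Fv -[F v](subrK (g (mapw w v))) addrC (le_trans (ler_normD _ _))// lerD//.
  by rewrite distrC hF.
apply: (@le_trans _ _ (2 * B + e)).
  rewrite (le_trans (ler_normB _ _))//; have := gB y; lra.
apply: (@le_trans _ _ (e + (2 * B + e))); first by rewrite lerDr ltW.
by rewrite -mulrA lerD2l ler_peMr.
Qed.

End MomentTools.

(** * The method of moments *)

Section SymmetricExpectations.
Variables (R : realType) (N : nat) (P : probability 'rV[R]_N R).
Local Notation V := 'rV[R]_N.
Variable W : V -> V.
Hypothesis iW : forall s, P.-integrable setT (EFin \o (fun y => pprod s (W y))).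

Lemma integrable_lincomb (r : seq (R * seq nat)) :
  P.-integrable setT (EFin \o (fun y => lincomb r (fun s => pprod s (W y)))) /\
  Rintegral P setT (fun y => lincomb r (fun s => pprod s (W y))) =
  lincomb r (fun s => Rintegral P setT (fun y => pprod s (W y))).
Proof.
elim: r => [|c r [IH1 IH2]].
  have -> : (fun y => lincomb [::] (fun s => pprod s (W y))) = (fun=> 0).
    by apply/funext => y; rewrite /lincomb big_nil.
  by rewrite /lincomb big_nil expect_cst; split => //; exact: eintegrable_cst.
have -> : (fun y => lincomb (c :: r) (fun s => pprod s (W y))) =
    (fun y => c.1 * pprod c.2 (W y) + lincomb r (fun s => pprod s (W y))).
  by apply/funext => y; rewrite /lincomb big_cons.
have i1 : P.-integrable setT (EFin \o (fun y => c.1 * pprod c.2 (W y))).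
  by apply: eq_integrable (integrableZl measurableT c.1 (iW c.2)).
split; first by apply: eq_integrable (integrableD measurableT i1 IH1).
by rewrite RintegralD// IH2 RintegralZl// /lincomb big_cons.
Qed.

Lemma integrable_sympoly Q F : sympoly Q F -> P.-integrable setT (EFin \o (fun y => F (W y))).
Proof.
move=> [r [_ hr]]; have [h _] := integrable_lincomb r.
by apply: eq_integrable h => // y _ /=; rewrite hr.
Qed.

End SymmetricExpectations.

Section MethodOfMoments.
Variables (R : realType) (N : nat).
Local Notation V := 'rV[R]_N.
Variables (P : R -> probability V R) (S : set V) (W : R -> V -> V) (nu : probability V R).
Hypotheses (mS : measurable S) (PS : forall k, 0 < k -> P k (~` S) = 0%E)
  (WS : forall k y, 0 < k -> S y -> chamberA (W k y)) (cW : forall k, 0 < k -> continuous (W k))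
  (iW : forall k s, 0 < k -> (P k).-integrable setT (EFin \o (fun y => pprod s (W k y)))).
Hypotheses (nuS : nu (~` @chamberA R N) = 0%E)
  (inu : forall s, nu.-integrable setT (EFin \o (fun y => pprod s y))).
Hypothesis cvg_moments : forall s,
  (fun k => Rintegral (P k) setT (fun y => pprod s (W k y))) @ +oo -->
  Rintegral nu setT (fun y => pprod s y).
Variable B : R.
Hypotheses (B0 : 0 <= B)
  (nu_growth : forall m, Rintegral nu setT (fun y => psum 2 y ^+ m) <= m`!%:R * B ^+ m).

Let mA : measurable (@chamberA R N). Proof. exact: (@measurable_chamber R N false). Qed.

Let pos_near : \forall k \near +oo, (0 : R) < k.
Proof. by apply: nbhs_pinfty_gt; exact: num_real. Qed.

Lemma cvg_sympoly Q F : sympoly Q F ->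
  (fun k => Rintegral (P k) setT (fun y => F (W k y))) @ +oo --> Rintegral nu setT F.
Proof.
move=> [r [_ hr]].
have -> : Rintegral nu setT F = lincomb r (fun s => Rintegral nu setT (fun y => pprod s y)).
  by rewrite -(integrable_lincomb (W := id) inu r).2; congr Rintegral; apply/funext.
have c1 : (fun k => lincomb r (fun s => Rintegral (P k) setT (fun y => pprod s (W k y)))) @ +oo -->
    lincomb r (fun s => Rintegral nu setT (fun y => pprod s y)).
  by apply: cvg_bigsum => c _; apply: cvgM; [exact: cvg_cst|exact: cvg_moments].
apply: cvg_trans c1; apply: near_eq_cvg; apply: filterS pos_near => k k0.
rewrite -(integrable_lincomb (fun s => iW s k0) r).2; congr Rintegral; apply/funext => y.
by rewrite hr.
Qed.

Let sn (xi : R) : V -> V := mapw (fun u => sin (xi * u)).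

Lemma sn_continuous xi : continuous (sn xi).
Proof.
apply: mapw_continuous => u.
apply: (@continuous_comp _ _ _ (fun v => xi * v) sin); last exact: continuous_sin.
by apply: cvgM; [exact: cvg_cst|exact: cvg_id].
Qed.

Let psn_bound xi s (y : V) : `|pprod s (sn xi y)| <= N%:R ^+ size s.
Proof.
elim: s => [|m s IH] /=; first by rewrite pprod_nil normr1.
rewrite pprod_cons normrM exprS ler_pM//.
rewrite (le_trans (ler_norm_sum _ _ _))// -[leRHS]mulr1 -sum_ord_cst ler_sum// => i _.
by rewrite mxE normrX exprn_ile1// sin_max.
Qed.

Let mpsn xi s (H : V -> V) : continuous H -> measurable_fun setT (fun y => pprod s (sn xi (H y))).
Proof.
move=> cH; apply: measurable_continuous => y.
apply: (@continuous_comp _ _ _ H (fun y => pprod s (sn xi y))); first exact: cH.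
by apply: pprod_comp_continuous; exact: sn_continuous.
Qed.

(** The error bound [Rn n] for replacing the sine by its Taylor polynomial is a symmetric
    polynomial, so its expectation under [P k] converges to that under [nu], which is small for
    large [n] by [nu_growth]. Growth of the limit moments thus controls the laws [P k] for large
    [k]. *)
Lemma cvg_trig xi s : (fun k => Rintegral (P k) setT (fun y => pprod s (sn xi (W k y)))) @ +oo -->
  Rintegral nu setT (fun y => pprod s (sn xi y)).
Proof.
have /choice[T hT] n : exists S : {poly R}, forall x : R, `|sin x - S.[x]| <= `|x| ^+ n / n`!%:R.
  exact: sin_taylor.
pose q n : {poly R} := T (2 * n)%N \Po (xi *: 'X).
have qE n x : (q n).[x] = (T (2 * n)%N).[xi * x] by rewrite /q horner_comp hornerZ hornerX.
(* The even order turns the absolute value in the Taylor remainder into a polynomial; summing over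
   all coordinates makes it symmetric. *)
pose En n (y : V) := xi ^+ (2 * n) / (2 * n)`!%:R * psum (2 * n) y.
have even2 n (x : R) : 0 <= x ^+ (2 * n) by rewrite exprM exprn_ge0// sqr_ge0.
have f0 n : (0 : R) < n`!%:R by rewrite ltr0n fact_gt0.
have En0 n y : 0 <= En n y.
  by rewrite mulr_ge0// ?divr_ge0// ?even2//; apply: sumr_ge0 => i _; exact: even2.
pose w := (sumn s).+1; pose C := N%:R ^+ size s * 2 ^+ w : R.
have C0 : 0 <= C by rewrite mulr_ge0 ?exprn_ge0.
pose Rn n (y : V) := C * (En n y + En n y ^+ w).
have Rbound n (y : V) : `|pprod s (sn xi y) - pprod s (mapw (horner (q n)) y)| <= Rn n y.
  rewrite distrC /Rn /C -mulrA; apply: (@le_trans _ _ (N%:R ^+ size s * ((1 + En n y) ^+ sumn s - 1))).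
    apply: pprod_perturb => // i; first by rewrite mxE sin_max.
    rewrite !mxE qE distrC (le_trans (hT _ _))// /En mulrAC ler_wpM2r ?invr_ge0 ?(ltW (f0 _))//.
    rewrite /psum mulr_sumr (bigD1 i)//= -exprMn.
    have -> : `|xi * y ord0 i| ^+ (2 * n) = (xi * y ord0 i) ^+ (2 * n).
      by rewrite !exprM real_normK ?num_real.
    by rewrite lerDl; apply: sumr_ge0 => j _; rewrite mulr_ge0 ?even2.
  by rewrite ler_wpM2l ?exprn_ge0// pow_excess.
have sEn n : sympoly xpredT (En n).
  by apply: sympolyZ; apply: sympoly_ext (pprod1 _) _; exact: sympoly_pprod.
have sRn n : sympoly xpredT (Rn n).
  by apply: sympolyZ; apply: sympolyD => //; exact: sympolyX.
have sq n := sympoly_pprod_horner N (q n) s.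
have iEnX n j : nu.-integrable setT (EFin \o (fun y => En n y ^+ j)).
  exact: (@integrable_sympoly _ _ nu id inu _ _ (sympolyX j (sEn n))).
have Enj j : (0 < j)%N -> (fun n => Rintegral nu setT (fun y => En n y ^+ j)) @ \oo --> (0 : R).
  move=> j0.
  have B1 : 0 <= xi ^+ 2 * B by rewrite mulr_ge0// sqr_ge0.
  have := cvg_moment_ratio j0 B1.
  apply: (@squeeze_cvgr _ _ _ _ (fun=> 0)) (cvg_cst _); near=> n.
  have n0 : (0 < n)%N by near: n; exact: nbhs_infty_gt.
  apply/andP; split.
    rewrite -[leLHS](expect_cst nu); apply: (expect_le mA nuS) => //.
    - exact: eintegrable_cst.
    - by move=> y _; rewrite exprn_ge0.
  pose D := xi ^+ (2 * n * j) / (2 * n)`!%:R ^+ j.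
  have c0 : 0 <= xi ^+ (2 * n) / (2 * n)`!%:R by rewrite divr_ge0 ?even2 ?(ltW (f0 _)).
  have D0 : 0 <= D by rewrite /D exprM -expr_div_n exprn_ge0.
  have ip : nu.-integrable setT (EFin \o (fun y => psum 2 y ^+ (n * j))).
    by have := inu (nseq (n * j) 2%N); apply: eq_integrable => // y _ /=; rewrite pprod_nseq2.
  apply: (@le_trans _ _ (D * Rintegral nu setT (fun y => psum 2 y ^+ (n * j)))).
    rewrite -RintegralZl//; apply: (expect_le mA nuS) => //.
      by apply: eq_integrable (integrableZl measurableT D ip).
    move=> y _; have -> : D * psum 2 y ^+ (n * j) = (xi ^+ (2 * n) / (2 * n)`!%:R * psum 2 y ^+ n) ^+ j.
      by rewrite /D !exprMn exprVn -!exprM.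
    rewrite lerXn2r ?nnegrE ?En0// ?(mulr_ge0 c0) ?exprn_ge0 ?psum2_ge0//.
    rewrite ler_wpM2l//.
    by rewrite -(prednK n0); exact: psum_double_le.
  apply: (le_trans (ler_wpM2l D0 (nu_growth _))).
  rewrite le_eqVlt; apply/orP; left; apply/eqP.
  by rewrite /D exprMn -!exprM mulnA; ring.
have Rn_cvg : (fun n => Rintegral nu setT (Rn n)) @ \oo --> (0 : R).
  have -> : (fun n => Rintegral nu setT (Rn n)) = (fun n => C *
      (Rintegral nu setT (fun y => En n y ^+ 1) + Rintegral nu setT (fun y => En n y ^+ w))).
    apply/funext => n; rewrite /Rn RintegralZl//; last first.
      by apply: eq_integrable (integrableD measurableT (iEnX n 1%N) (iEnX n w)).
    by congr (_ * _); rewrite -RintegralD//; congr Rintegral; apply/funext => y; rewrite expr1.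
  rewrite -[X in _ --> X](mulr0 C) -[X in _ --> C * X]addr0.
  by apply: cvgM; [exact: cvg_cst|apply: cvgD; exact: Enj].
apply/cvgrPdist_le => e e0; have e5 : 0 < e / 5 by rewrite divr_gt0.
have /cvgrPdist_le/(_ _ e5)[n _ /(_ n (leqnn n))] := Rn_cvg.
rewrite sub0r normrN => /(le_trans (ler_norm _)) hn.
have /cvgrPdist_le/(_ _ e5) h1 := cvg_sympoly (sRn n).
have /cvgrPdist_le/(_ _ e5) h2 := cvg_sympoly (sq n).
apply: filterS2 pos_near (filterI h1 h2) => k k0 [{}h1 {}h2].
have dk := expect_normr_le mS (PS k0).
have bk : `|Rintegral (P k) setT (fun y => pprod s (sn xi (W k y))) -
    Rintegral (P k) setT (fun y => pprod s (mapw (horner (q n)) (W k y)))| <=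
    Rintegral (P k) setT (fun y => Rn n (W k y)).
  have i1 : (P k).-integrable setT (EFin \o (fun y => pprod s (sn xi (W k y)))).
    apply: (eintegrable_bounded mS (PS k0) (mpsn xi s (cW k0))) => y _; exact: psn_bound.
  have i2 := integrable_sympoly (fun s => iW s k0) (sq n).
  rewrite -RintegralB//; apply: dk.
  - by apply: eq_integrable (integrableB measurableT i1 i2).
  - exact: (@integrable_sympoly _ _ (P k) (W k) (fun s => iW s k0) _ _ (sRn n)).
  - by move=> y _; exact: Rbound.
have bnu : `|Rintegral nu setT (fun y => pprod s (sn xi y)) -
    Rintegral nu setT (fun y => pprod s (mapw (horner (q n)) y))| <= Rintegral nu setT (Rn n).
  have i1 : nu.-integrable setT (EFin \o (fun y => pprod s (sn xi y))).
    apply: (eintegrable_bounded mA nuS (mpsn xi s (H := id) _)) => [y|y _]; first exact: cvg_id.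
    exact: psn_bound.
  have i2 := @integrable_sympoly _ _ nu id inu _ _ (sq n).
  rewrite -RintegralB//; apply: (expect_normr_le mA nuS).
  - by apply: eq_integrable (integrableB measurableT i1 i2).
  - exact: (@integrable_sympoly _ _ nu id inu _ _ (sRn n)).
  - by move=> y _; exact: Rbound.
move: h1 h2 bk bnu hn; rewrite !ler_norml => /andP[? ?] /andP[? ?] /andP[? ?] /andP[? ?] ?.
by apply/andP; split; lra.
Unshelve. all: by end_near.
Qed.

(** The sine approximation errs by a small constant plus a multiple of the second moment. The latter
    converges to [m2], hence is at most [m2 + 1] for large [k], and a low frequency [xi] makes its
    coefficient small. *)
Lemma method_of_moments (g : V -> R) (A : R) : continuous g -> (forall y, `|g y| <= A) ->
  (fun k => Rintegral (P k) setT (fun y => g (W k y))) @ +oo --> Rintegral nu setT g.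
Proof.
move=> cg gA; have A0 : 0 <= A by exact: le_trans (normr_ge0 _) (gA 0).
pose m2 := Rintegral nu setT (psum 2).
have s2 : sympoly xpredT (@psum R N 2).
  by apply: sympoly_ext (pprod1 _) _; exact: sympoly_pprod.
have ip2 : nu.-integrable setT (EFin \o (fun y : V => psum 2 y)).
  exact: (@integrable_sympoly _ _ nu id inu _ _ s2).
have m20 : 0 <= m2.
  rewrite -[leLHS](expect_cst nu); apply: (expect_le mA nuS) => //.
    exact: eintegrable_cst.
  by move=> y _; exact: psum2_ge0.
apply/cvgrPdist_le => e e0; pose d := e / 5.
have d0 : 0 < d by rewrite divr_gt0.
(* Chosen so that [c * (m2 + 1) = d]; each replacement of [g] by [h] then costs at most [2 * d]. *)
pose K := (2 * A + d) * 4 * (m2 + 1).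
have K0 : 0 < K by rewrite !mulr_gt0 ?ltr_wpDl ?mulr_ge0.
pose xi := Num.sqrt (d / K).
have xi0 : 0 < xi by rewrite sqrtr_gt0 divr_gt0.
have xi2 : xi ^+ 2 = d / K by rewrite sqr_sqrtr// divr_ge0// ltW.
have [F [[r [_ hr]] hF]] := sine_weierstrass cg gA d0 xi0.
pose h (y : V) := F (sn xi y).
pose c := (2 * A + d) * (4 * xi ^+ 2).
have Ad : 0 <= 2 * A + d by lra.
have c0 : 0 <= c by rewrite mulr_ge0// mulr_ge0// sqr_ge0.
have cm : c * (m2 + 1) = d.
  rewrite /c xi2 /K; field.
  by rewrite !gt_eqF// ltr_wpDl ?mulr_ge0.
have hE (H : V -> V) : (fun y => h (H y)) = (fun y => lincomb r (fun s => pprod s (sn xi (H y)))).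
  by apply/funext => y; rewrite /h hr.
have i_sn k s : 0 < k -> (P k).-integrable setT (EFin \o (fun y => pprod s (sn xi (W k y)))).
  move=> k0; apply: (eintegrable_bounded mS (PS k0) (mpsn xi s (cW k0))) => y _.
  exact: psn_bound.
have inu_sn s : nu.-integrable setT (EFin \o (fun y => pprod s (sn xi y))).
  apply: (eintegrable_bounded mA nuS (mpsn xi s (H := id) _)) => [y|y _]; first exact: cvg_id.
  exact: psn_bound.
have ch : (fun k => Rintegral (P k) setT (fun y => h (W k y))) @ +oo --> Rintegral nu setT h.
  rewrite -[h]/(fun y => h (id y)) (hE id) (integrable_lincomb inu_sn r).2.
  have c1 : (fun k => lincomb r (fun s => Rintegral (P k) setT (fun y => pprod s (sn xi (W k y))))) @ +oo -->
      lincomb r (fun s => Rintegral nu setT (fun y => pprod s (sn xi y))).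
    by apply: cvg_bigsum => s _; apply: cvgM; [exact: cvg_cst|exact: cvg_trig].
  apply: cvg_trans c1; apply: near_eq_cvg; apply: filterS pos_near => k k0.
  exact: esym (integrable_lincomb (fun s => i_sn k s k0) r).2.
have bound (Q : probability V R) (D : set V) (H : V -> V) (q2 : R) : measurable D -> Q (~` D) = 0%E ->
    (forall y, D y -> chamberA (H y)) -> continuous H ->
    Q.-integrable setT (EFin \o (fun y => h (H y))) ->
    Q.-integrable setT (EFin \o (fun y => psum 2 (H y))) ->
    Rintegral Q setT (fun y => psum 2 (H y)) <= m2 + 1 ->
    `|Rintegral Q setT (fun y => g (H y)) - Rintegral Q setT (fun y => h (H y))| <= 2 * d.
  move=> mD QD DH cH ih ip pm.
  have ig : Q.-integrable setT (EFin \o (fun y => g (H y))).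
    apply: (eintegrable_bounded mD QD (K := A)) => //; apply: measurable_continuous => y.
    by apply: (@continuous_comp _ _ _ H g); [exact: cH|exact: cg].
  have icp : Q.-integrable setT (EFin \o (fun y => c * psum 2 (H y))).
    by apply: eq_integrable (integrableZl measurableT c ip).
  have idq : Q.-integrable setT (EFin \o (fun=> d)) by exact: eintegrable_cst.
  rewrite -RintegralB//; apply: (@le_trans _ _ (Rintegral Q setT (fun y => d + c * psum 2 (H y)))).
    apply: (expect_normr_le mD QD).
    - by apply: eq_integrable (integrableB measurableT ig ih).
    - by apply: eq_integrable (integrableD measurableT idq icp).
    - by move=> y Dy; exact: hF (DH y Dy).
  rewrite RintegralD// expect_cst RintegralZl// [2 * d]mulr_natl mulr2n lerD2l -cm.
  by rewrite ler_wpM2l.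
have /cvgrPdist_le/(_ _ d0) h1 := ch.
have /cvgrPdist_le/(_ _ ltr01) h2 := cvg_sympoly s2.
apply: filterS2 pos_near (filterI h1 h2) => k k0 [{}h1 {}h2].
have b1 : `|Rintegral (P k) setT (fun y => g (W k y)) - Rintegral (P k) setT (fun y => h (W k y))| <= 2 * d.
  apply: (bound (P k) S (W k) 0) => //.
  - exact: PS.
  - by move=> y; exact: WS.
  - exact: cW.
  - by rewrite hE; exact: (integrable_lincomb (fun s => i_sn k s k0) r).1.
  - exact: (@integrable_sympoly _ _ (P k) (W k) (fun s => iW s k0) _ _ s2).
  by move: h2; rewrite ler_norml => /andP[h2 _]; rewrite -/m2 in h2; lra.
have b2 : `|Rintegral nu setT g - Rintegral nu setT h| <= 2 * d.
  apply: (bound nu (@chamberA R N) id 0) => //.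
  - by move=> y; exact: cvg_id.
  - by rewrite (hE id); exact: (integrable_lincomb inu_sn r).1.
  by rewrite -/m2 lerDl.
have de : e = 5 * d by rewrite /d; field.
have tri (x1 x2 x3 x4 : R) : `|x1 - x2| <= 2 * d -> `|x2 - x3| <= d -> `|x4 - x3| <= 2 * d ->
    `|x1 - x4| <= e.
  by rewrite de !ler_norml => /andP[? ?] /andP[? ?] /andP[? ?]; apply/andP; split; lra.
exact: tri b2 h1 b1.
Qed.

End MethodOfMoments.

(** * From the squares back to the shifted process *)

Section Linearization.
Variables (R : realType) (N : nat).
Local Notation V := 'rV[R]_N.

Lemma diffusion_marginals_sub (S : set V) L (Dom Dom' : (V -> R) -> Prop) x mu :
  (forall f, Dom' f -> Dom f) -> diffusion_marginals S L Dom x mu ->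
  diffusion_marginals S L Dom' x mu.
Proof. by move=> h [h1 h2]; split=> // f /h; exact: h2. Qed.

Lemma chamberA_mapw_wq b c (y : V) : 0 < c -> chamberB y -> chamberA (mapw (wq b c) y).
Proof.
move=> c0 Sy i j ij; rewrite !mxE /wq ler_pM2r ?invr_gt0// lerD2r.
by have [h1 h2] := Sy i j ij; rewrite lerXn2r// nnegrE (le_trans h2).
Qed.

(** The difference is [(u - s0)^2 / (2 s0)], and [u >= 0] gives [|u - s0| <= 2 |w|] for
    [w = (u - s0)(u + s0) / (2 s0)]. *)
Lemma wq_shift_bound (s0 u : R) : 0 < s0 -> 0 <= u ->
  `|wq (s0 ^+ 2) (2 * s0) u - (u - s0)| <= 2 / s0 * wq (s0 ^+ 2) (2 * s0) u ^+ 2.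
Proof.
move=> s00 u0; have -> : wq (s0 ^+ 2) (2 * s0) u - (u - s0) = (u - s0) ^+ 2 / (2 * s0).
  by rewrite /wq; field; rewrite gt_eqF.
rewrite ger0_norm; last by rewrite divr_ge0 ?sqr_ge0// mulr_ge0// ltW.
have -> : 2 / s0 * wq (s0 ^+ 2) (2 * s0) u ^+ 2 = (u - s0) ^+ 2 / (2 * s0) * ((u + s0) ^+ 2 / s0 ^+ 2).
  by rewrite /wq; field; rewrite gt_eqF.
rewrite ler_peMr//; first by rewrite divr_ge0 ?sqr_ge0// mulr_ge0// ltW.
by rewrite ler_pdivlMr ?exprn_gt0// mul1r lerXn2r ?nnegrE ?addr_ge0 ?(ltW s00)// lerDr.
Qed.

End Linearization.

Theorem theorem4p2 (R : realType) (N : nat) (HN : (1 <= N)%N)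
  (x : 'rV[R]_N) (hx : chamberB x) (k2 : R) (hk2 : 0 < k2)
  (X : R -> R -> probability 'rV[R]_N R)
  (HX : forall k1 : R, 0 < k1 -> BesselB_marginals k1 k2 x (X k1))
  (XA : R -> probability 'rV[R]_N R)
  (HXA : BesselA_marginals k2 0 XA)
  (t : R) (ht : 0 < t) :
  forall g : 'rV[R]_N -> R, continuous g -> bounded_fun g ->
    (fun k1 : R => Rintegral (X k1 t) setT
        (fun y => g (y - Num.sqrt (2 * t * k1) *: const_mx 1)))
      @ +oo --> Rintegral (XA (t / 2)) setT g.

Proof.
move=> g cg [M [_ hM]].
have [A gA] : exists A : R, forall y, `|g y| <= A.
  by exists (`|M| + 1) => y; apply: hM => //; rewrite (le_lt_trans (ler_norm _))// ltrDl.
have A0 : 0 <= A by exact: le_trans (normr_ge0 _) (gA 0).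
have HB k : 0 < k ->
    diffusion_marginals (chamber true) (gen GRing.inv true k k2) (dom true) x (X k).
  move=> k0; rewrite -genB_gen; apply: diffusion_marginals_sub (HX k k0).
  exact: domB_dom.
have HA : diffusion_marginals (chamber false) (gen GRing.inv false 0 k2) (dom false) 0 XA.
  by rewrite -genA_gen; apply: diffusion_marginals_sub HXA; exact: domA_dom.
have t20 : 0 <= t / 2 by rewrite divr_ge0// ltW.
pose c k := 2 * Num.sqrt (2 * t * k).
pose W k : 'rV[R]_N -> 'rV[R]_N := mapw (wq (2 * k * t) (c k)).
have s0_gt0 k : 0 < k -> 0 < Num.sqrt (2 * t * k) by move=> k0; rewrite sqrtr_gt0 !mulr_gt0.
(* At time [t] the centre is the square of the shift. *)
have WE k : 0 < k -> W k = mapw (wq (Num.sqrt (2 * t * k) ^+ 2) (c k)).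
  by move=> k0; rewrite /W sqr_sqrtr ?mulr_ge0 ?(ltW ht) ?(ltW k0)// mulrAC.
have cW k : 0 < k -> continuous (W k) by move=> _; exact: wq_continuous.
have mB : measurable (@chamberB R N) by exact: (@measurable_chamber R N true).
have PB k : 0 < k -> X k t (~` @chamberB R N) = 0%E by move=> k0; exact: (HB k k0).1 (ltW ht).
have WS k y : 0 < k -> chamberB y -> chamberA (W k y).
  by move=> k0; apply: chamberA_mapw_wq; rewrite mulr_gt0// s0_gt0.
have iW k s : 0 < k -> (X k t).-integrable setT (EFin \o (fun y => pprod s (W k y))).
  move=> k0; have bW := polyb_pprod (@polyb_wq R N (2 * k * t) (c k)) s.
  have mW := measurable_continuous (@pprod_comp_continuous R N (W k) (cW k k0) s).
  by have [h _] := polyb_expect (HB k k0) 0 mW bW; apply: h; exact: ltW.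
have inu s : (XA (t / 2)).-integrable setT (EFin \o (fun y : 'rV[R]_N => pprod s y)).
  have bW := polyb_pprod (W := id) (@polyb_coord R N) s.
  have mW : measurable_fun setT (fun y : 'rV[R]_N => pprod s y).
    by apply: measurable_continuous; have [j _ _] := jet2_pprod R N s; exact: jet1_continuous j.
  by have [h _] := polyb_expect HA 0 mW bW; exact: h.
have nu0 : XA (t / 2) (~` @chamberA R N) = 0%E by exact: HA.1.
have cm := moments_converge ht HB HA.
(* The base of the bound in [moment_bound] at time [t / 2], where the starting point 0 contributes
   nothing. *)
pose B := moment_cst N 0 k2 * (t / 2).
have B0 : 0 <= B by rewrite mulr_ge0// ltW// moment_cst_gt0.
have growth m : Rintegral (XA (t / 2)) setT (fun y => psum 2 y ^+ m) <= m`!%:R * B ^+ m.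
  have [_] := moment_bound HA m t20.
  have -> : psum 2 (0 : 'rV[R]_N) = 0 by rewrite /psum big1// => i _; rewrite mxE expr0n.
  by rewrite add0r.
have lim_W := method_of_moments mB PB WS cW iW nu0 inu cm B0 growth cg gA.
pose m2 := Rintegral (XA (t / 2)) setT (@psum R N 2).
have s2 : sympoly xpredT (@psum R N 2).
  by apply: sympoly_ext (pprod1 _) _; exact: sympoly_pprod.
have lim2 := cvg_sympoly iW inu cm s2; rewrite -/m2 in lim2.
apply/cvgrPdist_le => e e0; have e3 : 0 < e / 3 by rewrite divr_gt0.
pose K := `|m2| + 1; have K0 : 0 < K by rewrite ltr_wpDl.
(* Makes the Chebyshev bound [2 * A * K / L ^ 2] for leaving the box at most [e / 3], using
   [L <= L ^ 2]. *)
pose L := 1 + 6 * A * K / e.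
have AK0 : 0 <= 6 * A * K / e by rewrite divr_ge0 ?(ltW e0)// !mulr_ge0// ltW.
have L1 : 1 <= L by rewrite lerDl.
have L0 : 0 < L by exact: lt_le_trans L1.
have [d d0 hd] := unif_continuous_box L cg e3.
(* In the box [wq_shift_bound] gives a displacement of at most [2 / s0 * L ^ 2 = 4 / c * L ^ 2];
   bounding [c^-1] by this number brings it down to [d / 2]. *)
have dl0 : 0 < d / (8 * L ^+ 2) by rewrite divr_gt0// mulr_gt0// exprn_gt0.
have /cvgrPdist_le/(_ _ e3) h1 := lim_W.
have /cvgrPdist_le/(_ _ ltr01) h2 := lim2.
apply: filterS2 (scaling_small ht dl0) (filterI h1 h2) => k [k0 ck] [{}h1 {}h2].
set s0 := Num.sqrt (2 * t * k) in ck *; have s00 : 0 < s0 by exact: s0_gt0.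
pose H (y : 'rV[R]_N) := y - s0 *: const_mx 1.
have cH : continuous H.
  have -> : H = mapw (fun u => u - s0).
    by apply/funext => y; apply: row_ext => i; rewrite !mxE mulr1.
  apply: mapw_continuous; apply: continuous_sub; last exact: cst_continuous.
  by move=> u; exact: cvg_id.
pose a := 2 * A / L ^+ 2.
have a0 : 0 <= a by rewrite divr_ge0 ?exprn_ge0 ?(ltW L0)// mulr_ge0.
have close y : chamberB y -> `|g (W k y) - g (H y)| <= e / 3 + a * psum 2 (W k y).
  move=> Sy; have p0 := psum2_ge0 (W k y); have ap0 := mulr_ge0 a0 p0.
  have [bW|/existsNP[i /negP]] := pselect (box L (W k y)).
    apply: (@le_trans _ _ (e / 3)); last by rewrite lerDl.
    apply/ltW/hd => //; apply: (@le_lt_trans _ _ (d / 2)); last by rewrite ltr_pdivrMr// ltr_pMr// ltr1n.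
    apply: ler_norm_coord => [|i]; first by rewrite divr_ge0// ltW.
    have -> : (W k y - H y) ord0 i = wq (s0 ^+ 2) (2 * s0) (y ord0 i) - (y ord0 i - s0).
      by rewrite WE// !mxE mulr1.
    have [_ y0] := Sy i i (leqnn _).
    apply: (le_trans (wq_shift_bound s00 y0)).
    have wL : wq (s0 ^+ 2) (2 * s0) (y ord0 i) ^+ 2 <= L ^+ 2.
      have := bW i; rewrite WE// mxE -/s0 => h.
      by rewrite -[leLHS]real_normK ?num_real// lerXn2r ?nnegrE// ltW.
    apply: (@le_trans _ _ (4 * (2 * s0)^-1 * L ^+ 2)).
      have -> : 4 * (2 * s0)^-1 = 2 / s0 by field; rewrite gt_eqF.
      by rewrite ler_wpM2l// divr_ge0// ltW.
    apply: (@le_trans _ _ (4 * (d / (8 * L ^+ 2)) * L ^+ 2)).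
      by rewrite ler_wpM2r ?exprn_ge0 ?(ltW L0)// ler_wpM2l.
    by rewrite le_eqVlt; apply/orP; left; apply/eqP; field; rewrite gt_eqF.
  rewrite -ltNge => hi; apply: (@le_trans _ _ (2 * A)).
    by rewrite (le_trans (ler_normB _ _))// mulr_natl mulr2n lerD.
  apply: (@le_trans _ _ (a * psum 2 (W k y))); last by rewrite lerDr ltW.
  have Lp : L ^+ 2 <= psum 2 (W k y).
    apply: le_trans (ler_sqr_psum2 _ i); rewrite -[leRHS]real_normK ?num_real//.
    by rewrite lerXn2r ?nnegrE// ltW.
  rewrite /a mulrAC ler_pdivlMr ?exprn_gt0// ler_wpM2l//.
  exact: mulr_ge0.
have iP (h : 'rV[R]_N -> R) : measurable_fun setT h -> (forall y, `|h y| <= A) ->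
    (X k t).-integrable setT (EFin \o h).
  by move=> mh hA; apply: (eintegrable_bounded mB (PB k k0) mh) => y _; exact: hA.
have cgH (Q : 'rV[R]_N -> 'rV[R]_N) : continuous Q -> measurable_fun setT (fun y => g (Q y)).
  move=> cQ; apply: measurable_continuous => y.
  by apply: (@continuous_comp _ _ _ Q g); [exact: cQ|exact: cg].
have i1 := iP _ (cgH _ (cW k k0)) (fun y => gA (W k y)).
have i2 := iP _ (cgH _ cH) (fun y => gA (H y)).
have ip : (X k t).-integrable setT (EFin \o (fun y => psum 2 (W k y))).
  exact: (@integrable_sympoly _ _ (X k t) (W k) (fun s => iW k s k0) _ _ s2).
have iap : (X k t).-integrable setT (EFin \o (fun y => a * psum 2 (W k y))).
  by apply: eq_integrable (integrableZl measurableT a ip).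
have ie : (X k t).-integrable setT (EFin \o (fun=> e / 3)) by exact: eintegrable_cst.
have b1 : `|Rintegral (X k t) setT (fun y => g (W k y)) - Rintegral (X k t) setT (fun y => g (H y))| <=
    e / 3 + e / 3.
  rewrite -RintegralB//.
  apply: (@le_trans _ _ (Rintegral (X k t) setT (fun y => e / 3 + a * psum 2 (W k y)))).
    apply: (expect_normr_le mB (PB k k0)).
    - by apply: eq_integrable (integrableB measurableT i1 i2).
    - by apply: eq_integrable (integrableD measurableT ie iap).
    - by move=> y; exact: close.
  rewrite RintegralD// expect_cst RintegralZl// lerD2l.
  have pK : Rintegral (X k t) setT (fun y => psum 2 (W k y)) <= K.
    move: h2; rewrite ler_norml => /andP[h2 _]; have := ler_norm m2; rewrite /K; lra.
  apply: le_trans (ler_wpM2l a0 pK) _.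
  rewrite /a mulrAC ler_pdivrMr ?exprn_gt0//.
  apply: (@le_trans _ _ (e / 3 * L)); last first.
    by rewrite ler_wpM2l ?(ltW e3)// expr2 ler_peMl// ltW.
  have -> : e / 3 * L = e / 3 + 2 * A * K by rewrite /L; field; rewrite gt_eqF.
  by rewrite lerDr ltW.
have tri (x1 x2 x3 : R) : `|x1 - x2| <= e / 3 -> `|x2 - x3| <= e / 3 + e / 3 -> `|x1 - x3| <= e.
  by rewrite !ler_norml => /andP[? ?] /andP[? ?]; apply/andP; split; lra.
exact: tri h1 b1.
Qed.
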